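(* Let $M,N$ be positive integers with $N\ge M$, $\lambda_S,\lambda_R,\mu>0$, and let $f_0$ be a probability density on $\mathbb{R}^{3M}$. Let $F_0(\mathbf v,\mathbf w)=f_0(\mathbf v)e^{-\pi|\mathbf w|^2}$ for $(\mathbf v,\mathbf w)\in\mathbb{R}^{3M}\times\mathbb{R}^{3N}$ and $$f(\mathbf v,t)=\int_{\mathbb{R}^{3N}}\big(e^{\mathcal Lt}F_0\big)(\mathbf v,\mathbf w)\,\mathrm{d}\mathbf w,$$ with $\mathcal L$ as in the context. Then for all $t\ge0$, $$S(f(\cdot,t))\le\left[\frac{M}{N+M}+\frac{N}{N+M}e^{-\frac{\mu}{3}\frac{N+M}{N}t}\right]S(f_0).$$
   Context: Write $\mathbf z=(z_1,\dots,z_{M+N})\in(\mathbb{R}^3)^{M+N}$ with $\mathbf v=(z_1,\dots,z_M)$, $\mathbf w=(z_{M+1},\dots,z_{M+N})$. For $1\le i<j\le M+N$ and $\omega\in\mathbb{S}^2$, $r_{ij}(\omega)$ is the linear map of $(\mathbb{R}^3)^{M+N}$ acting on $(z_i,z_j)$ by $\begin{pmatrix}I_3-\omega\omega^T&\omega\omega^T\\\omega\omega^T&I_3-\omega\omega^T\end{pmatrix}$ and as the identity on the other $z_l$ (a symmetric orthogonal involution). $(R_{ij}F)(\mathbf z)=\int_{\mathbb{S}^2}F(r_{ij}(\omega)^{-1}\mathbf z)\,\mathrm{d}\omega$ with $\mathrm{d}\omega$ the uniform probability measure on $\mathbb{S}^2$. The generator is $$\mathcal L=\frac{\lambda_S}{M-1}\sum_{1\le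 i<j\le M}(R_{ij}-I)+\frac{\lambda_R}{N-1}\sum_{M<i<j\le M+N}(R_{ij}-I)+\frac{\mu}{N}\sum_{i=1}^M\sum_{j=M+1}^{M+N}(R_{ij}-I),$$ a bounded operator on $L^1(\mathbb{R}^{3(M+N)})$ (a term with an empty sum is absent). $S(g)=\int_{\mathbb{R}^{3M}}g(\mathbf v)\log\big(g(\mathbf v)/e^{-\pi|\mathbf v|^2}\big)\mathrm{d}\mathbf v$. *)

(* Defs.v *)
From mathcomp Require Import all_boot all_algebra all_classical all_reals all_analysis.
Import GRing.Theory Num.Theory.

Set Implicit Arguments.
Unset Strict Implicit.
Unset Printing Implicit Defensive.

Local Open Scope classical_set_scope.
Local Open Scope ring_scope.

Section Kac.
Variable R : realType.

Definition leb := @lebesgue_measure R.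

(* A velocity in R^3 and a configuration (z_1,...,z_K) in (R^3)^K.  Both are
   tuples, so they carry the (Borel) product sigma-algebra of the library. *)
Definition V3 := 3.-tuple R.
Definition Config (K : nat) := K.-tuple V3.

Definition comp (x : V3) (l : 'I_3) : R := tnth x l.

(* Lebesgue integral over R^3 of a nonnegative function (iterated; by
   Tonelli this is the Lebesgue integral for measurable integrands). *)
Definition int3 (h : V3 -> \bar R) : \bar R :=
  (\int[leb]_x \int[leb]_y \int[leb]_z h [tuple x; y; z])%E.

Fixpoint intC (K : nat) : (Config K -> \bar R) -> \bar R :=
  match K with
  | 0 => fun H => H [tuple]
  | K'.+1 => fun H => int3 (fun a => @intC K' (fun t => H [tuple of a :: t]))
  end.

Definition intCs (K : nat) (h : Config K -> \bar R) : \bar R :=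
  (intC (fun z => h^\+ z) - intC (fun z => h^\- z))%E.

Definition sqnorm (K : nat) (z : Config K) : R :=
  \sum_(i < K) \sum_(l < 3) (comp (tnth z i) l) ^+ 2.
Definition gauss (K : nat) (z : Config K) : R := expR (- pi * sqnorm z).

(* uniform probability measure on S^2, in spherical coordinates:
   int_{S^2} h dω = (1/4π) ∫_0^π ∫_0^{2π} h(ω(θ,φ)) sin θ dφ dθ,
   for nonnegative h *)
Definition sph_pt (th ph : R) : V3 :=
  [tuple sin th * cos ph; sin th * sin ph; cos th].
Definition sphere_int (h : V3 -> \bar R) : \bar R :=
  (((4 * pi)^-1)%:E *
   \int[leb]_(th in `[0%R, (pi : R)]%classic)
     \int[leb]_(ph in `[0%R, (2 * pi : R)%R]%classic)
        (h (sph_pt th ph) * (sin th)%:E))%E.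

(* the collision map r_ij(ω): on (z_i, z_j) it acts by the block matrix
   [[I - ωω^T, ωω^T], [ωω^T, I - ωω^T]], identity on the other z_l *)
Definition proj_part (w x y : V3) : V3 :=
  [tuple \sum_(m < 3) (((l == m)%:R - comp w l * comp w m) * comp x m
                       + comp w l * comp w m * comp y m) | l < 3].
Definition rcoll (K : nat) (i j : 'I_K) (w : V3) (z : Config K) : Config K :=
  [tuple (if k == i then proj_part w (tnth z i) (tnth z j)
          else if k == j then proj_part w (tnth z j) (tnth z i)
          else tnth z k) | k < K].

(* (R_ij F)(z) = ∫_{S^2} F(r_ij(ω)^{-1} z) dω  ; r_ij(ω)^{-1} = r_ij(ω) *)
Definition Rij (K : nat) (i j : 'I_K) (F : Config K -> \bar R) (z : Config K)
  : \bar R := sphere_int (fun w => F (rcoll i j w z)).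

(* The rate in front of (R_ij - I) in L, for i < j, indices 0..M+N-1
   (the paper's 1..M are 0..M-1 here). *)
Definition rate (M N : nat) (lamS lamR mu : R) (i j : 'I_(M + N)) : R :=
  if (j < M)%N then lamS / (M.-1)%:R
  else if (M <= i)%N then lamR / (N.-1)%:R
  else mu / N%:R.

(* L = A - c I with A = Σ_{i<j} rate_ij R_ij and c = Σ_{i<j} rate_ij *)
Definition Aop (M N : nat) (lamS lamR mu : R)
  (F : Config (M + N) -> \bar R) (z : Config (M + N)) : \bar R :=
  (\sum_(i < M + N) \sum_(j < M + N | (i < j)%N)
     (@rate M N lamS lamR mu i j)%:E * Rij i j F z)%E.
Definition ctot (M N : nat) (lamS lamR mu : R) : R :=
  \sum_(i < M + N) \sum_(j < M + N | (i < j)%N) @rate M N lamS lamR mu i j.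

Definition expLt (M N : nat) (lamS lamR mu t : R)
  (F : Config (M + N) -> \bar R) (z : Config (M + N)) : \bar R :=
  ((expR (- @ctot M N lamS lamR mu * t))%:E *
   \sum_(n <oo) ((t ^+ n / (n`!)%:R)%:E
                 * iter n (@Aop M N lamS lamR mu) F z))%E.

Definition vpart (M N : nat) (z : Config (M + N)) : Config M :=
  [tuple tnth z (lshift N i) | i < M].
Definition wpart (M N : nat) (z : Config (M + N)) : Config N :=
  [tuple tnth z (rshift M j) | j < N].

Definition F0 (M N : nat) (f0 : Config M -> R) (z : Config (M + N)) : \bar R :=
  (f0 (vpart z) * gauss (wpart z))%:E.

Definition marginal (M N : nat) (G : Config (M + N) -> \bar R) (v : Config M)
  : \bar R := intC (fun w : Config N => G [tuple of v ++ w]).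

Definition ent_integrand (M : nat) (g : Config M -> \bar R) (v : Config M)
  : \bar R :=
  match g v with
  | r%:E => (if r == 0 then 0 else r * ln (r / gauss v))%:E
  | +oo%E => +oo%E
  | -oo%E => 0%E
  end.

Definition entropy (M : nat) (g : Config M -> \bar R) : \bar R :=
  intCs (ent_integrand g).

End Kac.

(* Main.v *)
Require Import Defs.
From HB Require Import structures.
From mathcomp Require Import all_boot all_order all_algebra all_classical all_reals all_analysis.
From mathcomp Require Import measurable_realfun simple_functions measurable_fun_approximation lebesgue_Rintegral ring lra finmap.
Import HBNNSimple.
Import Order.TTheory GRing.Theory Num.Theory.
Import numFieldNormedType.Exports.

Set Implicit Arguments.
Unset Strict Implicit.
Unset Printing Implicit Defensive.
Local Open Scope classical_set_scope.
Local Open Scope ring_scope.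

(** Let h = f0 / gauss. Collisions preserve the Gaussian, so expanding the
    exponential series gives (e^{Lt} F0)(z) = gauss(z) * E h(S z), where S is the
    random linear map (R^3)^(M+N) -> (R^3)^M obtained from the projection onto the
    first M particles by a Poisson number of random collisions. Each such S maps the
    standard Gaussian of (R^3)^(M+N) to that of (R^3)^M, and f(.,t) / gauss is the
    average over the law nu of S of N_S h(v) = E_w h(S(v,w)), w Gaussian. By convexity of
    the entropy Ent it suffices that the nu-average of Ent(N_S h) is at most
    kappa Ent(h), with kappa the bracket of the statement.

    If h varies only by O(lam), with second order remainder O(lam^2), then up to
    O(lam^3) both sides are the same multiple of E |P S^T V|^2 and kappa |V|^2, where V
    is the slope of h at the origin and P the projection onto the first M particles.
    These two numbers are equal because the mean energies of the two groups of
    particles solve a closed linear system.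

    The estimate becomes exact by rescaling. Writing a Gaussian x as
    (p + y) / sqrt 2, the entropy of h is the entropy of its conditional mean given p
    plus the mean entropy of its slices y |-> h((p + y) / sqrt 2), and the entropy of
    N_S h is subadditive in the same way. Hence the defect
    E Ent(N_S h) - kappa Ent(h) is at most the sum of two defects at scale
    lam / sqrt 2, so it is O(2^n (2^(-n/2) lam)^3) for all n, and therefore
    nonpositive. Finally C^{1,1} functions are dense in L^1, and unbounded densities
    are reached by truncation and Fatou's lemma. *)

(** * Probability measures built from functionals *)

(** The rescaling is matched to second order terms: each splitting doubles the number of pieces and
    halves the squared scale, so quadratic contributions keep their total size while cubic
    remainders shrink. A sharp constant is therefore decided by a covariance computation, and
    [kappa] is read off from it. The price is uniformity: the cubic constant must be the same for
    every piece. This is why densities are first confined to an interval [[a, b]] with [0 < a], with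
    linear and quadratic increment bounds sharing one constant [C], and why [coarse] and [zoom] are
    shown to preserve all of these bounds. The statement is phrased with iterated integrals, angular
    integrals and a power series of operators on extended nonnegative functions. Each of them is
    additive, homogeneous and continuous along increasing sequences, hence is integration against a
    genuine measure. Once everything is a probability, entropies of bounded densities become real
    expectations, and infinite values only return in the final passage to the limit. *)

Section tonelli.
Context d1 d2 (T1 : measurableType d1) (T2 : measurableType d2) (R : realType).
Variables (P1 : {sigma_finite_measure set T1 -> \bar R})
  (P2 : {sigma_finite_measure set T2 -> \bar R}).
Local Open Scope ereal_scope.

Lemma measurable_integral2 (f : T1 -> T2 -> \bar R) :
  measurable_fun setT (fun p : T1 * T2 => f p.1 p.2) ->
  (forall x y, 0 <= f x y) ->
  measurable_fun setT (fun x => \int[P2]_y f x y).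
Proof.
move=> mf f0.
by apply: (@measurable_fun_fubini_tonelli_F _ _ _ _ _ P2 (fun p : T1 * T2 => f p.1 p.2)).
Qed.

Lemma tonelli (f : T1 -> T2 -> \bar R) :
  measurable_fun setT (fun p : T1 * T2 => f p.1 p.2) ->
  (forall x y, 0 <= f x y) ->
  \int[P1]_x \int[P2]_y f x y = \int[P2]_y \int[P1]_x f x y.
Proof.
move=> mf f0.
by apply: (@fubini_tonelli _ _ _ _ _ P1 P2 (fun p : T1 * T2 => f p.1 p.2)).
Qed.

Lemma tonelli_prod (f : T1 * T2 -> \bar R) : measurable_fun setT f ->
  (forall p, 0 <= f p) ->
  \int[P1 \x P2]_p f p = \int[P1]_x \int[P2]_y f (x, y).
Proof. by move=> mf f0; apply: (@fubini_tonelli1 _ _ _ _ _ P1 P2 f). Qed.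

End tonelli.
Arguments measurable_integral2 {d1 d2 T1 T2 R P2} f.
Arguments tonelli {d1 d2 T1 T2 R P1 P2} f.
Arguments tonelli_prod {d1 d2 T1 T2 R P1 P2} f.

Section pushforward_probability.
Context d1 d2 (T1 : measurableType d1) (T2 : measurableType d2) (R : realType).
Variables (P : probability T1 R) (f : T1 -> T2) (mf : measurable_fun setT f).

Definition pushP (_ : measurable_fun setT f) : set T2 -> \bar R := pushforward P f.

Let pushP0 : pushP mf set0 = 0%E.
Proof. by rewrite /pushP /pushforward preimage_set0 measure0. Qed.
Let pushP_ge0 A : (0 <= pushP mf A)%E.
Proof. exact: measure_ge0. Qed.
Let pushP_sigma : semi_sigma_additive (pushP mf).
Proof.
move=> F mF tF mUF; rewrite /pushP /pushforward preimage_bigcup.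
apply: measure_semi_sigma_additive.
- by move=> n; rewrite -[X in measurable X]setTI; exact: mf.
- apply/trivIsetP => i j _ _ ij; rewrite -preimage_setI.
  by move/trivIsetP : tF => -> //; rewrite preimage_set0.
- by rewrite -preimage_bigcup -[X in measurable X]setTI; exact: mf.
Qed.
HB.instance Definition _ := isMeasure.Build _ _ _ (pushP mf) pushP0 pushP_ge0 pushP_sigma.
Let pushPT : pushP mf setT = 1%E.
Proof. by rewrite /pushP /pushforward preimage_setT probability_setT. Qed.
HB.instance Definition _ := @Measure_isProbability.Build _ _ R (pushP mf) pushPT.

(** Packaged as an opaque existence statement, so that only the change of variables formula of
    [push_probability] is visible afterwards. *)
Lemma push_probability_ex : {Q : probability T2 R |
  forall g, measurable_fun setT g -> (forall y, 0 <= g y)%E ->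
  (\int[Q]_y g y = \int[P]_x g (f x))%E}.
Proof.
exists (pushP mf) => g mg g0.
have := @ge0_integral_pushforward _ _ _ _ R f mf P setT g.
by rewrite preimage_setT /=; apply.
Qed.

Definition push_probability : probability T2 R := sval push_probability_ex.

Lemma integral_push (g : T2 -> \bar R) : measurable_fun setT g ->
  (forall y, 0 <= g y)%E ->
  (\int[push_probability]_y g y = \int[P]_x g (f x))%E.
Proof. exact: (svalP push_probability_ex). Qed.

End pushforward_probability.

Section functional_measure.
Context d (T : measurableType d) (R : realType).
Local Open Scope ereal_scope.
Variable Phi : (T -> \bar R) -> \bar R.

Definition nnm (f : T -> \bar R) := measurable_fun setT f /\ forall x, 0 <= f x.

(** Axioms of an integral on nonnegative measurable functions; [mean_lim] is monotone convergence.
    Nothing is asked of [Phi] on other functions. *)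
Record mean_functional := MeanFunctional {
  mean_ge0 : forall f, nnm f -> 0 <= Phi f ;
  meanD : forall f g, nnm f -> nnm g -> Phi (fun x => f x + g x) = Phi f + Phi g ;
  meanZ : forall (c : R) f, (0 <= c)%R -> nnm f ->
    Phi (fun x => c%:E * f x) = c%:E * Phi f ;
  mean_lim : forall (f : (T -> \bar R)^nat) g, (forall n, nnm (f n)) ->
    (forall x, {homo f ^~ x : m n / (m <= n)%N >-> m <= n}) ->
    (forall x, f n x @[n --> \oo] --> g x) ->
    Phi (f n) @[n --> \oo] --> Phi g }.

Hypothesis PhiP : mean_functional.

Definition mean_measure (_ : mean_functional) (A : set T) : \bar R :=
  Phi (fun x => (\1_A x)%:E).

Let nnm_indic (A : set T) : measurable A -> nnm (fun x => (\1_A x : R)%:E).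
Proof. by move=> mA; split=> [|x]; [exact/measurable_EFinP|rewrite lee_fin]. Qed.

Let mean0 : Phi (fun=> 0) = 0.
Proof.
have n0 : nnm (fun=> 0) by split.
transitivity (Phi (fun=> 0%:E * 0)); last by rewrite (meanZ PhiP)// mul0e.
by congr Phi; apply/funext => x; rewrite mule0.
Qed.

Let mm0 : mean_measure PhiP set0 = 0.
Proof.
by rewrite /mean_measure -[RHS]mean0; congr Phi; apply/funext => x; rewrite indic0.
Qed.
Let mm_ge0 A : 0 <= (if `[< measurable A >] then mean_measure PhiP A else 0).
Proof. by case: asboolP => // mA; apply: (mean_ge0 PhiP); exact: nnm_indic. Qed.

(** Set to 0 off the measurable sets: the axioms do not control [Phi] there, while a measure has to
    be nonnegative on every set. *)
Definition mean_meas (_ : mean_functional) (A : set T) : \bar R :=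
  if `[< measurable A >] then mean_measure PhiP A else 0.
Let mm0' : mean_meas PhiP set0 = 0.
Proof. by rewrite /mean_meas asboolT// mm0. Qed.

Let mean_sum (I : Type) (s : seq I) (f : I -> T -> \bar R) :
  (forall i, nnm (f i)) ->
  nnm (fun x => \sum_(i <- s) f i x) /\
  Phi (fun x => \sum_(i <- s) f i x) = \sum_(i <- s) Phi (f i).
Proof.
move=> nf; elim: s => [|i s [IH1 IH2]].
  rewrite big_nil -[RHS]mean0; split.
    split=> [|x]; last by rewrite big_nil.
    by rewrite (_ : (fun x => _) = (fun=> 0))//; apply/funext => x; rewrite big_nil.
  by congr Phi; apply/funext => x; rewrite big_nil.
have mE : (fun x => \sum_(j <- i :: s) f j x) = (fun x => f i x + \sum_(j <- s) f j x).
  by apply/funext => x; rewrite big_cons.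
rewrite mE; split.
  split=> [|x]; last by rewrite adde_ge0 ?(nf i).2// IH1.2.
  by apply: emeasurable_funD; [exact: (nf i).1|exact: IH1.1].
by rewrite (meanD PhiP)// IH2 big_cons.
Qed.

Let mm_sigma : semi_sigma_additive (mean_meas PhiP).
Proof.
move=> F mF tF mUF; rewrite /mean_meas asboolT//.
have -> : (fun n => \sum_(0 <= i < n) mean_meas PhiP (F i)) =
  (fun n => Phi (fun x => \sum_(0 <= i < n) (\1_(F i) x)%:E)).
  apply/funext => n; rewrite (mean_sum _ (fun i => nnm_indic (mF i))).2.
  by apply: eq_bigr => i _; rewrite /mean_meas asboolT.
apply: (mean_lim PhiP).
- by move=> n; exact: (mean_sum _ (fun i => nnm_indic (mF i))).1.
- move=> x m n mn; apply: lee_sum_nneg_natr => // k _ _; by rewrite lee_fin.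
- move=> x; under eq_fun do rewrite sumEFin.
  have [xF|nx] := pselect ((\bigcup_n F n) x).
    rewrite indicE mem_set//; case: xF => k _ Fkx.
    apply: cvg_near_cst; exists k.+1 => // n /= kn.
    rewrite (bigD1_seq k) /= ?mem_index_iota ?iota_uniq//.
    rewrite [X in (X + _)%R]indicE mem_set// big1_seq ?addr0// => i /andP[ik _].
    rewrite indicE memNset// => Fix.
    move/trivIsetP : tF => /(_ i k Logic.I Logic.I ik) FF.
    by have : (F i `&` F k) x by []; rewrite FF.
  rewrite indicE memNset//; apply: cvg_near_cst; exists 0%N => // n _ /=.
  rewrite big1// => i _; rewrite indicE memNset// => Fix; apply: nx.
  by exists i.
Qed.

HB.instance Definition _ := isMeasure.Build _ _ _ (mean_meas PhiP) mm0' mm_ge0 mm_sigma.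

(** Additivity and homogeneity settle simple functions, and both sides pass to the limit along the
    increasing sequence [nnsfun_approx]. *)
Lemma mean_functionalE : {m : {measure set T -> \bar R} |
  forall f, nnm f -> Phi f = \int[m]_x f x}.
Proof.
exists (mean_meas PhiP) => f nf.
have f0 : forall x, setT x -> 0 <= f x by move=> x _; exact: nf.2.
pose g := nnsfun_approx measurableT nf.1.
have gi (h : {nnsfun T >-> R}) : Phi (EFin \o h) = \int[mean_meas PhiP]_x (h x)%:E.
  have -> : (EFin \o h) = (fun x => \sum_(r <- finmap.enum_fset (fset_set (range h)))
      r%:E * (\1_(h @^-1` [set r]) x)%:E).
    apply/funext => x /=; rewrite (fimfunE h x) fsbig_finite//=.
    by rewrite -sumEFin; apply: eq_bigr => r _; rewrite EFinM.
  (* The values of [h] are nonnegative, so [Num.max 0 r] changes nothing on its range; it makes the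
     summand nonnegative for every real [r], as [mean_sum] demands. *)
  pose hh r x := (Num.max 0 r)%:E * (\1_(h @^-1` [set r]) x : R)%:E.
  have hhE : (fun x => \sum_(r <- finmap.enum_fset (fset_set (range h)))
      r%:E * (\1_(h @^-1` [set r]) x)%:E) = 
      (fun x => \sum_(r <- finmap.enum_fset (fset_set (range h))) hh r x).
    apply/funext => x; apply: eq_big_seq => r; rewrite in_fset_set// in_setE => -[y _ <-].
    by rewrite /hh max_r.
  have mh r : measurable (h @^-1` [set r]) by [].
  have nhh r : nnm (hh r).
    split=> [|x]; last by rewrite /hh -EFinM lee_fin mulr_ge0// le_max lexx.
    by apply: emeasurable_funM => //; exact: (nnm_indic (mh r)).1.
  rewrite hhE (mean_sum _ nhh).2.
  under [RHS]eq_integral => x _.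
    rewrite -[(h x)%:E]/((EFin \o h) x).
    have -> : (EFin \o h) x = \sum_(r <- finmap.enum_fset (fset_set (range h))) hh r x.
      by rewrite -[RHS]/((fun x => \sum_(r <- finmap.enum_fset (fset_set (range h))) hh r x) x)
       -hhE /= (fimfunE h x) fsbig_finite//= -sumEFin; apply: eq_bigr => r _; rewrite EFinM.
    over.
  rewrite ge0_integral_sum//; [|by move=> r; exact: (nhh r).1|by move=> r x _; exact: (nhh r).2].
  apply: eq_bigr => r _; rewrite /hh.
  rewrite (meanZ PhiP) ?le_max ?lexx//; last exact: nnm_indic.
  rewrite ge0_integralZl ?lee_fin ?le_max ?lexx//; last exact: (nnm_indic (mh r)).1.
  by rewrite integral_indic// setIT /= /mean_meas asboolT.
have c1 : \int[mean_meas PhiP]_x (g n x)%:E @[n --> \oo] --> \int[mean_meas PhiP]_x f x.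
  rewrite (_ : (fun x => f x) = (fun x => limn (fun n => (g n x)%:E))); last first.
    apply/funext => x; apply/esym/cvg_lim => //.
    exact: cvg_nnsfun_approx.
  apply: cvg_monotone_convergence => //.
  - by move=> n; exact/measurable_EFinP.
  - by move=> n x _; rewrite lee_fin.
  - by move=> x _ m n mn; rewrite lee_fin; exact/lefP/nd_nnsfun_approx.
have c2 : Phi (EFin \o g n) @[n --> \oo] --> Phi f.
  apply: (mean_lim PhiP).
  - by move=> n; split=> [|x] /=; [exact/measurable_EFinP|rewrite lee_fin].
  - by move=> x m n mn; rewrite lee_fin; exact/lefP/nd_nnsfun_approx.
  - move=> x; exact: cvg_nnsfun_approx.
rewrite -(cvg_lim _ c2)// -(cvg_lim _ c1)//; congr (limn _).
by apply/funext => n; rewrite gi.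
Qed.

End functional_measure.

Section probability_of_measure.
Context d (T : measurableType d) (R : realType) (m : {measure set T -> \bar R}).
Definition mprob (_ : m setT = 1%E) : set T -> \bar R := m.
Variable m1 : m setT = 1%E.
HB.instance Definition _ := Measure.on (mprob m1).
HB.instance Definition _ := @Measure_isProbability.Build _ _ R (mprob m1) m1.
Definition probability_of_measure : probability T R := mprob m1.
End probability_of_measure.

Lemma mean_probabilityE d (T : measurableType d) (R : realType)
  (Phi : (T -> \bar R) -> \bar R) : mean_functional Phi -> Phi (fun=> 1%E) = 1%E ->
  {P : probability T R | forall f, nnm f -> Phi f = \int[P]_x f x}%E.
Proof.
move=> PhiP Phi1; have [m mE] := mean_functionalE PhiP.
have m1 : m setT = 1%E.
  have n1 : nnm (fun _ : T => 1%E : \bar R) by split.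
  by rewrite -[LHS]mul1e -(integral_cst m measurableT 1) -mE.
by exists (probability_of_measure m1) => f nf; rewrite mE.
Qed.

Section product_probability.
Context d1 d2 (T1 : measurableType d1) (T2 : measurableType d2) (R : realType).
Variables (P1 : probability T1 R) (P2 : probability T2 R).

Lemma prodP_ex : {P : probability (T1 * T2)%type R | forall f, nnm f ->
  (\int[P]_p f p = \int[P1]_x \int[P2]_y f (x, y))%E}.
Proof. by exists (P1 \x P2)%E => f [mf f0]; exact: (tonelli_prod f mf f0). Qed.

(* Sealed behind an existence lemma, so that unification never unfolds a product measure. *)
Definition prodP : probability (T1 * T2)%type R := sval prodP_ex.

Lemma integral_prodP (f : T1 * T2 -> \bar R) : nnm f ->
  (\int[prodP]_p f p = \int[P1]_x \int[P2]_y f (x, y))%E.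
Proof. exact: (svalP prodP_ex). Qed.

End product_probability.
Arguments integral_prodP {d1 d2 T1 T2 R P1 P2} [f].

(** * Configurations in coordinates *)

Section coordinates.
Variable R : realType.
Implicit Types K M N : nat.

Definition co K (z : Config R K) (p : 'I_K * 'I_3) : R := tnth (tnth z p.1) p.2.
Definition mkC K (f : 'I_K * 'I_3 -> R) : Config R K :=
  [tuple [tuple f (i, l) | l < 3] | i < K].

Lemma co_mkC K (f : 'I_K * 'I_3 -> R) p : co (mkC f) p = f p.
Proof. by case: p => i l; rewrite /co !tnth_mktuple. Qed.

Lemma co_inj K (z z' : Config R K) : (forall p, co z p = co z' p) -> z = z'.
Proof. by move=> zz; apply: eq_from_tnth => i; apply: eq_from_tnth => l; exact: (zz (i, l)). Qed.

Lemma measurable_co d (T : measurableType d) K (f : T -> Config R K) p :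
  measurable_fun setT f -> measurable_fun setT (fun x => co (f x) p).
Proof.
move=> mf; apply: (measurableT_comp (measurable_tnth p.2)).
exact: (measurableT_comp (measurable_tnth p.1)).
Qed.

Lemma measurable_config d (T : measurableType d) K (f : T -> Config R K) :
  (forall p, measurable_fun setT (fun x => co (f x) p)) -> measurable_fun setT f.
Proof.
move=> mf; apply/measurable_fun_tnthP => i; apply/measurable_fun_tnthP => l.
exact: (mf (i, l)).
Qed.

Lemma measurable_mkC d (T : measurableType d) K (f : T -> 'I_K * 'I_3 -> R) :
  (forall p, measurable_fun setT (f ^~ p)) -> measurable_fun setT (fun x => mkC (f x)).
Proof.
move=> mf; apply: measurable_config => p.
by rewrite (_ : (fun x => _) = f ^~ p)//; apply/funext => x; rewrite co_mkC.
Qed.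

Definition addc K (z z' : Config R K) := mkC (fun p => co z p + co z' p).
Definition sclc K (a : R) (z : Config R K) := mkC (fun p => a * co z p).
Definition dot K (z z' : Config R K) : R := \sum_p co z p * co z' p.
Definition catc M N (v : Config R M) (w : Config R N) : Config R (M + N) :=
  [tuple of v ++ w].

Lemma co_addc K (z z' : Config R K) p : co (addc z z') p = co z p + co z' p.
Proof. exact: co_mkC. Qed.
Lemma co_sclc K a (z : Config R K) p : co (sclc a z) p = a * co z p.
Proof. exact: co_mkC. Qed.

Lemma co_catl M N (v : Config R M) (w : Config R N) i l :
  co (catc v w) (lshift N i, l) = co v (i, l).
Proof. by rewrite /co /= tnth_lshift. Qed.
Lemma co_catr M N (v : Config R M) (w : Config R N) i l :
  co (catc v w) (rshift M i, l) = co w (i, l).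
Proof. by rewrite /co /= tnth_rshift. Qed.

Lemma sum_split M N (F : 'I_(M + N) * 'I_3 -> R) :
  \sum_p F p = \sum_p F (lshift N p.1, p.2) + \sum_p F (rshift M p.1, p.2).
Proof.
have pr m (g : 'I_m -> 'I_(M + N)) :
    \sum_(p : 'I_m * 'I_3) F (g p.1, p.2) = \sum_(i < m) \sum_(l < 3) F (g i, l).
  by rewrite (pair_bigA _ (fun i l => F (g i, l))).
transitivity (\sum_(i < M + N) \sum_(l < 3) F (i, l)).
  by rewrite pair_bigA; apply: eq_bigr => -[].
by rewrite !pr big_split_ord.
Qed.

Lemma sqnormE K (z : Config R K) : sqnorm z = \sum_p co z p ^+ 2.
Proof. by rewrite /sqnorm pair_bigA. Qed.

Lemma sqnorm_dot K (z : Config R K) : sqnorm z = dot z z.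
Proof. by rewrite sqnormE; apply: eq_bigr => p _; rewrite expr2. Qed.

Lemma sqnorm_cat M N (v : Config R M) (w : Config R N) :
  sqnorm (catc v w) = sqnorm v + sqnorm w.
Proof.
rewrite !sqnormE sum_split; congr (_ + _); apply: eq_bigr => -[i l] _.
  by rewrite co_catl.
by rewrite co_catr.
Qed.

Lemma sqnorm_ge0 K (z : Config R K) : 0 <= sqnorm z.
Proof. by rewrite sqnormE; apply: sumr_ge0 => p _; rewrite sqr_ge0. Qed.

Lemma gauss_cat M N (v : Config R M) (w : Config R N) :
  gauss (catc v w) = gauss v * gauss w.
Proof. by rewrite /gauss sqnorm_cat mulrDr expRD. Qed.

Lemma gauss_gt0 K (z : Config R K) : 0 < gauss z.
Proof. exact: expR_gt0. Qed.

Lemma measurable_sqnorm K : measurable_fun setT (@sqnorm R K).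
Proof.
rewrite (_ : @sqnorm R K = fun z => \sum_p co z p ^+ 2); last first.
  by apply/funext => z; rewrite sqnormE.
apply: measurable_sum => p; apply: measurable_funX.
exact: measurable_co.
Qed.

Lemma measurable_gauss K : measurable_fun setT (@gauss R K).
Proof.
apply: measurableT_comp => //; apply: measurable_funM => //.
exact: measurable_sqnorm.
Qed.

Lemma measurable_catc d (T : measurableType d) M N (f : T -> Config R M)
  (g : T -> Config R N) : measurable_fun setT f -> measurable_fun setT g ->
  measurable_fun setT (fun x => catc (f x) (g x)).
Proof.
move=> mf mg; apply: measurable_config => -[i l].
rewrite -(splitK i); case: (fintype.split i) => j /=.
  under eq_fun do rewrite co_catl; exact: measurable_co.
under eq_fun do rewrite co_catr; exact: measurable_co.
Qed.

Lemma measurable_addc d (T : measurableType d) K (f g : T -> Config R K) :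
  measurable_fun setT f -> measurable_fun setT g ->
  measurable_fun setT (fun x => addc (f x) (g x)).
Proof.
move=> mf mg; apply: measurable_mkC => p.
by apply: measurable_funD; exact: measurable_co.
Qed.

Lemma measurable_sclc d (T : measurableType d) K (a : T -> R) (g : T -> Config R K) :
  measurable_fun setT a -> measurable_fun setT g ->
  measurable_fun setT (fun x => sclc (a x) (g x)).
Proof.
move=> mf mg; apply: measurable_mkC => p.
by apply: measurable_funM => //; exact: measurable_co.
Qed.

Lemma measurable_dot d (T : measurableType d) K (f g : T -> Config R K) :
  measurable_fun setT f -> measurable_fun setT g ->
  measurable_fun setT (fun x => dot (f x) (g x)).
Proof.
move=> mf mg; apply: measurable_sum => p.
by apply: measurable_funM; exact: measurable_co.
Qed.

Lemma dotC K (z z' : Config R K) : dot z z' = dot z' z.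
Proof. by apply: eq_bigr => p _; rewrite mulrC. Qed.
Lemma dotDr K (s z z' : Config R K) : dot s (addc z z') = dot s z + dot s z'.
Proof. by rewrite -big_split; apply: eq_bigr => p _; rewrite co_addc mulrDr. Qed.
Lemma dotZr K (s z : Config R K) a : dot s (sclc a z) = a * dot s z.
Proof. by rewrite mulr_sumr; apply: eq_bigr => p _; rewrite co_sclc mulrCA. Qed.
Lemma dotDl K (s z z' : Config R K) : dot (addc z z') s = dot z s + dot z' s.
Proof. by rewrite dotC dotDr !(dotC s). Qed.
Lemma dotZl K (s z : Config R K) a : dot (sclc a z) s = a * dot z s.
Proof. by rewrite dotC dotZr dotC. Qed.
Lemma dot_cat M N (v v' : Config R M) (w w' : Config R N) :
  dot (catc v w) (catc v' w') = dot v v' + dot w w'.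
Proof.
rewrite /dot sum_split; congr (_ + _); apply: eq_bigr => -[i l] _ /=.
  by rewrite !co_catl.
by rewrite !co_catr.
Qed.

Lemma addc_cat M N (v v' : Config R M) (w w' : Config R N) :
  addc (catc v w) (catc v' w') = catc (addc v v') (addc w w').
Proof.
apply: co_inj => -[i l]; rewrite co_addc -(splitK i).
case: (fintype.split i) => j /=; rewrite ?co_catl ?co_catr co_addc//.
Qed.
Lemma sclc_cat M N a (v : Config R M) (w : Config R N) :
  sclc a (catc v w) = catc (sclc a v) (sclc a w).
Proof.
apply: co_inj => -[i l]; rewrite co_sclc -(splitK i).
case: (fintype.split i) => j /=; rewrite ?co_catl ?co_catr co_sclc//.
Qed.
Lemma addcA K (x y z : Config R K) : addc x (addc y z) = addc (addc x y) z.
Proof. by apply: co_inj => p; rewrite !co_addc addrA. Qed.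
Lemma addcC K (x y : Config R K) : addc x y = addc y x.
Proof. by apply: co_inj => p; rewrite !co_addc addrC. Qed.
Lemma sclcD K a (x y : Config R K) : sclc a (addc x y) = addc (sclc a x) (sclc a y).
Proof. by apply: co_inj => p; rewrite !(co_addc, co_sclc) mulrDr. Qed.

End coordinates.

Section mean_functional_closure.
Context d (T : measurableType d) (R : realType).
Local Open Scope ereal_scope.

(** Common source of the measures below: the weight [w] and the map [G] cover the Gaussian density,
    affine images of Lebesgue measure, the angular density and the jump rates. *)
Lemma mean_functional_integral d' (U : measurableType d')
  (P : {measure set U -> \bar R}) (w : U -> R) (G : U -> T) :
  measurable_fun setT w -> (forall u, 0 <= w u)%R -> measurable_fun setT G ->
  mean_functional (fun F : T -> \bar R => \int[P]_u (F (G u) * (w u)%:E)).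
Proof.
move=> mw w0 mG.
have mFG F : nnm F -> measurable_fun setT (fun u => F (G u) * (w u)%:E).
  by move=> [mF _]; apply: emeasurable_funM; [exact: (measurableT_comp mF)|exact/measurable_EFinP].
have FG0 F : nnm F -> forall u, setT u -> 0 <= F (G u) * (w u)%:E.
  by move=> [_ F0] u _; rewrite mule_ge0 ?lee_fin.
split.
- by move=> F nF; apply: integral_ge0 => u _; exact: FG0.
- move=> F F' nF nF'; rewrite -ge0_integralD//; [|exact: FG0|exact: mFG|exact: FG0|exact: mFG].
  by apply: eq_integral => u _; rewrite ge0_muleDl// ?nF.2 ?nF'.2.
- move=> c F c0 nF; rewrite -ge0_integralZl//; [|exact: mFG|exact: FG0].
  by apply: eq_integral => u _; rewrite muleA.
- move=> f g nf fnd fg.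
  have fgw u : f n (G u) * (w u)%:E @[n --> \oo] --> g (G u) * (w u)%:E.
    by apply: cvgeZr => //; exact: fg.
  rewrite (_ : (fun u => g (G u) * (w u)%:E) = (fun u => limn (fun n => f n (G u) * (w u)%:E))); last first.
    by apply/funext => u; apply/esym/cvg_lim.
  apply: cvg_monotone_convergence => //.
  - by move=> n; exact: mFG.
  - by move=> n u _; exact: FG0.
  - by move=> u _ m n mn; rewrite lee_wpmul2r ?lee_fin// fnd.
Qed.

End mean_functional_closure.

(** * Gaussian measures and their symmetries *)

Section gaussian.
Variable R : realType.
Local Notation leb := (@leb R).

Lemma measurable_gauss1 : measurable_fun setT (fun x : R => (expR (- pi * x ^+ 2))).
Proof.
apply: measurableT_comp => //; apply: measurable_funM => //.
Qed.

Lemma integral_gauss1 : (\int[leb]_x (expR (- pi * x ^+ 2))%:E = 1)%E.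
Proof.
(* Standard deviation for which the normal density is exactly [exp (- pi x ^ 2)], with peak value
   1. *)
pose s : R := (Num.sqrt (2 * pi))^-1.
have pi0 := pi_gt0 R; have pn0 : (pi : R) != 0 by rewrite gt_eqF.
have s2 : s ^+ 2 = (2 * pi)^-1 by rewrite /s exprVn sqr_sqrtr// mulr_ge0// ltW.
have s0 : s != 0 by rewrite invr_neq0// gt_eqF// sqrtr_gt0 mulr_gt0.
rewrite -(integral_normal_pdf 0 s); apply: eq_integral => x _.
rewrite normal_pdfE// /normal_peak /normal_fun s2 subr0; congr (_%:E).
rewrite [X in (Num.sqrt X)^-1](_ : _ = 1); last first.
  by rewrite -mulr_natr; move: (pi : R) pn0 => p p0; field.
rewrite [Num.ExtraDef.sqrtr 1]sqrtr1 invr1 mul1r; congr expR.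
by rewrite -mulr_natr; move: (pi : R) pn0 => p p0; field.
Qed.

Lemma gauss1_ex : {P : probability R R |
  forall F : R -> \bar R, nnm F ->
  (\int[leb]_x (F x * (expR (- pi * x ^+ 2))%:E) = \int[P]_x F x)%E}.
Proof.
apply: mean_probabilityE.
  apply: (@mean_functional_integral _ R R _ (measurableTypeR R)
    lebesgue_measure (fun x : R => expR (- pi * x ^+ 2)) id) => //.
  exact: measurable_gauss1.
by rewrite -[RHS]integral_gauss1; apply: eq_integral => x _; rewrite mul1e.
Qed.

Definition gauss1 : probability R R := sval gauss1_ex.
Lemma gauss1E (F : R -> \bar R) : nnm F ->
  (\int[leb]_x (F x * (expR (- pi * x ^+ 2))%:E) = \int[gauss1]_x F x)%E.
Proof. exact: (svalP gauss1_ex). Qed.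

End gaussian.

Section gaussian_config.
Variable R : realType.
Local Notation g1 := (gauss1 R).

Definition trip (p : R * (R * R)) : V3 R := [tuple p.1; p.2.1; p.2.2].
Lemma measurable_trip : measurable_fun setT trip.
Proof.
have m1 : measurable_fun setT (fun p : R * (R * R) => p.1) by exact: measurable_fst.
have m2 : measurable_fun setT (fun p : R * (R * R) => p.2.1).
  exact: (measurableT_comp measurable_fst measurable_snd).
have m3 : measurable_fun setT (fun p : R * (R * R) => p.2.2).
  exact: (measurableT_comp measurable_snd measurable_snd).
by do 3 apply: measurable_cons => //.
Qed.

Definition gauss3 : probability (V3 R) R :=
  push_probability (prodP g1 (prodP g1 g1)) measurable_trip.

Definition consc K (p : V3 R * Config R K) : Config R K.+1 := [tuple of p.1 :: p.2].
Lemma measurable_consc K : measurable_fun setT (@consc K).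
Proof. exact: measurable_cons. Qed.

Fixpoint gam K : probability (Config R K) R :=
  match K with
  | 0 => dirac [tuple]
  | K'.+1 => push_probability (prodP gauss3 (gam K')) (@measurable_consc K')
  end.

Lemma integral_gauss3 (F : V3 R -> \bar R) : nnm F ->
  (\int[gauss3]_a F a = \int[g1]_x \int[g1]_y \int[g1]_z F [tuple x; y; z])%E.
Proof.
move=> [mF F0]; rewrite integral_push//.
have mT := measurableT_comp mF measurable_trip.
rewrite (integral_prodP (f := F \o trip)); last by split=> // ?; exact: F0.
apply: eq_integral => x _.
have mTx := measurableT_comp mT (measurable_pair1 x).
by rewrite (integral_prodP (f := fun q => F (trip (x, q)))); last by split.
Qed.

Lemma integral_gamS K (F : Config R K.+1 -> \bar R) : nnm F ->
  (\int[gam K.+1]_z F z = \int[gauss3]_a \int[gam K]_t F [tuple of a :: t])%E.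
Proof.
move=> [mF F0]; rewrite integral_push//.
have mT := measurableT_comp mF (@measurable_consc K).
by rewrite (integral_prodP (f := F \o @consc K)); last by split=> // ?; exact: F0.
Qed.

Lemma integral_gam0 (F : Config R 0 -> \bar R) : nnm F ->
  (\int[gam 0]_z F z = F [tuple])%E.
Proof. by move=> [mF F0]; rewrite /= integral_dirac//= diracT mul1e. Qed.

Definition gauss_v3 (a : V3 R) : R :=
  expR (- pi * tnth a 0 ^+ 2) * expR (- pi * tnth a 1 ^+ 2) * expR (- pi * tnth a (inord 2) ^+ 2).

Lemma gauss_consc K (a : V3 R) (t : Config R K) :
  gauss ([tuple of a :: t] : Config R K.+1) = gauss_v3 a * gauss t.
Proof.
rewrite /gauss /gauss_v3 -!expRD; congr expR.
rewrite /sqnorm big_ord_recl tnth0 mulrDr; congr (_ + _).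
  rewrite !big_ord_recr big_ord0/= add0r !mulrDr /comp.
  congr (_ * tnth a _ ^+ 2 + _ * tnth a _ ^+ 2 + _ * tnth a _ ^+ 2); apply/val_inj => //=.
  by rewrite inordK.
by congr (_ * _); apply: eq_bigr => i _; rewrite tnthS.
Qed.

Lemma gauss_v3_ge0 a : 0 <= gauss_v3 a.
Proof. by rewrite !mulr_ge0// expR_ge0. Qed.

Lemma int3_gauss3 (F : V3 R -> \bar R) : nnm F ->
  (int3 (fun a => F a * (gauss_v3 a)%:E) = \int[gauss3]_a F a)%E.
Proof.
move=> [mF F0]; rewrite integral_gauss3// /int3.
have e0 (x : R) : (0 <= (expR (- pi * x ^+ 2))%:E)%E by rewrite lee_fin expR_ge0.
have mF3 : measurable_fun setT (fun p : R * R * R => F [tuple p.1.1; p.1.2; p.2]).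
  rewrite (_ : (fun p => _) = F \o trip \o (fun p : R * R * R => (p.1.1, (p.1.2, p.2))))//.
  apply: (measurableT_comp (measurableT_comp mF measurable_trip)).
  apply: measurable_fun_pair; first exact: (measurableT_comp measurable_fst measurable_fst).
  apply: measurable_fun_pair => //.
  exact: (measurableT_comp measurable_snd measurable_fst).
have mF2 : measurable_fun setT (fun p : R * R => \int[g1]_z F [tuple p.1; p.2; z])%E.
  by apply: (measurable_integral2 (fun p z => F [tuple p.1; p.2; z])).
have mF1 : measurable_fun setT (fun x => \int[g1]_y \int[g1]_z F [tuple x; y; z])%E.
  apply: (measurable_integral2 (fun x y => \int[g1]_z F [tuple x; y; z])%E) => //.
  by move=> x y; exact: integral_ge0.
rewrite -gauss1E; last by split=> // x; do 2 (apply: integral_ge0 => ? _).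
apply: eq_integral => x _.
rewrite -gauss1E; last first.
  split=> [|y]; last by apply: integral_ge0.
  exact: (measurableT_comp mF2 (measurable_pair1 x)).
rewrite -ge0_integralZr//; last first.
  - by move=> y _; rewrite mule_ge0// integral_ge0.
  - apply: emeasurable_funM; last by apply/measurable_EFinP; exact: measurable_gauss1.
    exact: (measurableT_comp mF2 (measurable_pair1 x)).
apply: eq_integral => y _.
have mF1' : measurable_fun setT (fun z => F [tuple x; y; z]).
  exact: (measurableT_comp mF3 (measurable_pair1 (x, y))).
rewrite -gauss1E// -!ge0_integralZr//; last first.
  - by move=> z _; rewrite mule_ge0.
  - apply: emeasurable_funM => //; by apply/measurable_EFinP; exact: measurable_gauss1.
  - by move=> z _; rewrite !mule_ge0.
  - apply: emeasurable_funM => //; apply: emeasurable_funM => //.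
    by apply/measurable_EFinP; exact: measurable_gauss1.
apply: eq_integral => z _; rewrite /gauss_v3.
rewrite !(tnth_nth 0)/= inordK//= -!muleA -!EFinM; congr (_ * _%:E)%E; ring.
Qed.

(** Bridge from the iterated integrals of the statement to the probability [gam]; the Gaussian
    factor is distributed one particle at a time. *)
Lemma intC_gam K (F : Config R K -> \bar R) : nnm F ->
  (intC (fun z => F z * (gauss z)%:E) = \int[gam K]_z F z)%E.
Proof.
elim: K F => [|K IH] F nF.
  rewrite integral_gam0//= /gauss /sqnorm big_ord0 mulr0 expR0 mule1//.
rewrite integral_gamS//.
have mc : measurable_fun setT (fun p : V3 R * Config R K => F [tuple of p.1 :: p.2]).
  by apply: measurableT_comp => //; [exact: nF.1|exact: measurable_consc].
rewrite -int3_gauss3; last first.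
  split=> [|a]; last by apply: integral_ge0 => t _; exact: nF.2.
  apply: (measurable_integral2 (fun a t => F (consc (a, t)))) => // a t; exact: nF.2.
rewrite /=; congr int3; apply/funext => a.
have mFa : measurable_fun setT (fun t : Config R K => F [tuple of a :: t]).
  exact: (measurableT_comp mc (measurable_pair1 a)).
rewrite -ge0_integralZr//; [|by move=> t _; exact: nF.2|by rewrite lee_fin gauss_v3_ge0].
rewrite -IH; last first.
  split=> [|t]; last by rewrite mule_ge0 ?nF.2// lee_fin gauss_v3_ge0.
  by apply: emeasurable_funM => //; apply/measurable_EFinP.
by congr intC; apply/funext => t; rewrite gauss_consc EFinM muleA.
Qed.

Lemma integral_gam_cat M N (F : Config R (M + N) -> \bar R) : nnm F ->
  (\int[gam (M + N)]_z F z = \int[gam M]_v \int[gam N]_w F (catc v w))%E.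
Proof.
elim: M F => [|M IH] F nF.
  rewrite integral_gam0; last first.
    split=> [|v]; last by apply: integral_ge0 => w _; exact: nF.2.
    apply: (measurable_integral2 (fun v w => F (catc v w))) => [|v w]; last exact: nF.2.
    apply: (measurableT_comp nF.1); exact: measurable_catc.
  by apply: eq_integral => w _; congr F; apply: val_inj.
rewrite [LHS](@integral_gamS (M + N))// integral_gamS; last first.
  split=> [|v]; last by apply: integral_ge0 => w _; exact: nF.2.
  apply: (measurable_integral2 (fun v w => F (catc v w))) => [|v w]; last exact: nF.2.
  apply: (measurableT_comp nF.1); exact: measurable_catc.
apply: eq_integral => a _.
rewrite IH; last first.
  split=> [|t]; last exact: nF.2.
  apply: (measurableT_comp nF.1); exact: (measurable_cons).
apply: eq_integral => v _; apply: eq_integral => w _; congr F; exact: val_inj.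
Qed.

End gaussian_config.

(** * Affine changes of variable *)

Section affine.
Variable R : realType.
Local Notation RR := (measurableTypeR R).

(** The left side is an integral against some measure [m]; it suffices that [m] gives half-open
    intervals their length. For [a < 0] the preimage is half-open on the other side, with the same
    length. *)
Lemma integral_lebesgue_affine (a b : R) (F : R -> \bar R) : a != 0 -> nnm F ->
  (\int[lebesgue_measure]_(x in [set: R]) (F (a * x + b)%R * `|a|%:E) =
   \int[lebesgue_measure]_(x in [set: R]) F x)%E.
Proof.
move=> a0 nF.
pose f : RR -> RR := fun x => a * x + b.
have mf : measurable_fun setT f by apply: measurable_funD => //; apply: measurable_funM.
have H := @mean_functional_integral _ RR R _ RR (@lebesgue_measure R) (fun _ => `|a|) f
  (measurable_cst _) (fun=> normr_ge0 a) mf.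
have [m mE] := mean_functionalE H.
rewrite [LHS]mE//; apply: eq_measure_integral => A mA _.
apply/esym/lebesgue_measure_unique => //= _ [[x y]] _ <-;
  rewrite -[(x, y).1]/x -[(x, y).2]/y.
have ne : nnm (fun u : RR => (\1_(`]x, y]%classic) u)%:E).
  by split=> [|u]; [apply/measurable_EFinP|rewrite lee_fin].
rewrite -[in RHS](setIT `]x, y]%classic) -(integral_indic m measurableT)//.
have mfA : measurable (f @^-1` `]x, y]%classic).
  by rewrite -[X in measurable X]setTI; exact: mf.
rewrite -mE// (eq_integral (fun u => (\1_(f @^-1` `]x, y]) u)%:E * `|a|%:E)%E)//.
rewrite ge0_integralZr//; last by apply/measurable_EFinP.
rewrite integral_indic//.
rewrite setIT lebesgue_measure_itv/= lte_fin; have [agt|alt] : 0 < a \/ a < 0.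
  by move: a0; rewrite neq_lt => /orP[]; [right|left].
- have fE : f @^-1` `]x, y] = `](x - b) / a, (y - b) / a]%classic.
    apply/seteqP; split=> u /=; rewrite /f !in_itv/= ltr_pdivrMr// ler_pdivlMr//;
    by rewrite mulrC ltrBlDr lerBrDr.
  have -> : lebesgue_measure (f @^-1` `]x, y]) =
    (if ((x - b) / a)%:E < ((y - b) / a)%:E then ((y - b) / a)%:E - ((x - b) / a)%:E else 0)%E.
    by rewrite fE; exact: lebesgue_measure_itv.
  rewrite lte_fin ltr_pM2r ?invr_gt0// ltrD2r.
  case: ifP => _; last by rewrite mul0e.
  by rewrite -!EFinB -EFinM gtr0_norm//; congr (_%:E); field; rewrite gt_eqF.
- have fE : f @^-1` `]x, y] = `[(y - b) / a, (x - b) / a[%classic.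
    apply/seteqP; split=> u /=; rewrite /f !in_itv/= ler_ndivrMr// ltr_ndivlMr//;
    by rewrite mulrC lerBrDr ltrBlDr andbC.
  have -> : lebesgue_measure (f @^-1` `]x, y]) =
    (if ((y - b) / a)%:E < ((x - b) / a)%:E then ((x - b) / a)%:E - ((y - b) / a)%:E else 0)%E.
    by rewrite fE; exact: lebesgue_measure_itv.
  rewrite lte_fin ltr_nM2r ?invr_lt0// ltrD2r.
  case: ifP => _; last by rewrite mul0e.
  by rewrite -!EFinB -EFinM ltr0_norm//; congr (_%:E); field; rewrite lt_eqF.
Qed.

Local Notation g1 := (gauss1 R).
Definition e1 (x : R) : R := expR (- pi * x ^+ 2).
Lemma e1_gt0 x : 0 < e1 x. Proof. exact: expR_gt0. Qed.
Lemma measurable_e1 : measurable_fun setT e1.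
Proof. exact: measurable_gauss1. Qed.

Lemma measurable_e1V : measurable_fun setT (fun x => (e1 x)^-1).
Proof.
rewrite (_ : (fun x => _) = (fun x => expR (pi * x ^+ 2))); last first.
  by apply/funext => x; rewrite /e1 mulNr expRN invrK.
by apply: measurableT_comp => //; apply: measurable_funM => //; apply: measurable_funX.
Qed.

(** The Gaussian is not invariant under affine maps; the quotient of densities records the
    correction. In a rotation, the corrections of the two successive substitutions cancel. *)
Lemma gauss1_affine (a b : R) (F : R -> \bar R) : a != 0 -> nnm F ->
  (\int[g1]_x (F (a * x + b)%R * (e1 (a * x + b) * (e1 x)^-1)%:E) =
   (`|a|^-1)%:E * \int[g1]_x F x)%E.
Proof.
move=> a0 [mF F0].
have maf : measurable_fun setT (fun x : R => a * x + b).
  by apply: measurable_funD => //; apply: measurable_funM.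
have mFe : measurable_fun setT (fun x => F x * (e1 x)%:E)%E.
  by apply: emeasurable_funM => //; apply/measurable_EFinP; exact: measurable_e1.
have nFe : nnm (fun x => F x * (e1 x)%:E)%E.
  by split=> // x; rewrite mule_ge0// lee_fin ltW ?e1_gt0.
rewrite -gauss1E; last first.
  split=> [|x]; last by rewrite mule_ge0// lee_fin mulr_ge0 ?invr_ge0 ?ltW ?e1_gt0.
  apply: emeasurable_funM; first exact: (measurableT_comp mF).
  apply/measurable_EFinP; apply: measurable_funM; last exact: measurable_e1V.
  exact: (measurableT_comp measurable_e1).
rewrite -gauss1E// -(integral_lebesgue_affine b a0 nFe) ge0_integralZr//; last first.
- by move=> x _; exact: nFe.2.
- exact: (measurableT_comp nFe.1 maf).
rewrite muleCA -EFinM mulVf ?normr_eq0// mule1; apply: eq_integral => x _.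
rewrite -muleA -EFinM; congr (_ * _%:E)%E.
by rewrite -mulrA mulVf ?mulr1// gt_eqF ?e1_gt0.
Qed.

End affine.

(** * Rotation invariance of the planar Gaussian *)

Section plane_rotation.
Variable R : realType.
Local Notation g1 := (gauss1 R).

(* Substitute u = c x + s y for x, then recover the rotated second coordinate from y:
   two one-dimensional affine changes of variable, each requiring c <> 0. *)
Lemma gauss1_rot_c (c s : R) (F : R -> R -> \bar R) : c != 0 -> c ^+ 2 + s ^+ 2 = 1 ->
  nnm (fun p : R * R => F p.1 p.2) ->
  (\int[g1]_x \int[g1]_y F (c * x + s * y)%R (- s * x + c * y)%R =
   \int[g1]_x \int[g1]_y F x y)%E.
Proof.
move=> c0 cs [mF F0].
have F0' x y : (0 <= F x y)%E by exact: (F0 (x, y)).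
have mR (f g : R * R -> R) : measurable_fun setT f -> measurable_fun setT g ->
  measurable_fun setT (fun p => F (f p) (g p)).
  by move=> mf mg; exact: (measurableT_comp mF (measurable_fun_pair mf mg)).
have mlin (a b : R) : measurable_fun setT (fun p : R * R => a * p.1 + b * p.2).
  by apply: measurable_funD; apply: measurable_funM.
pose G x y := F (c * x + s * y) (- s * x + c * y).
have mG : measurable_fun setT (fun p : R * R => G p.1 p.2) by apply: mR; exact: mlin.
etransitivity; first exact: (tonelli G mG (fun _ _ => F0' _ _)).
pose v u y := - (s / c) * u + c^-1 * y.
have me (a b : R) : measurable_fun setT (fun p : R * R => e1 (a * p.1 + b * p.2) * (e1 p.2)^-1).
  apply: measurable_funM; first exact: (measurableT_comp (@measurable_e1 R)).
  exact: (measurableT_comp (@measurable_e1V R)).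
pose H u y := (F u (v u y) * (e1 (v u y) * (e1 y)^-1)%:E)%E.
have H0 u y : (0 <= H u y)%E.
  by rewrite mule_ge0// lee_fin mulr_ge0 ?invr_ge0 ?ltW ?e1_gt0.
have mH : measurable_fun setT (fun p : R * R => H p.1 p.2).
  by apply: emeasurable_funM; [by apply: mR => //; exact: mlin|apply/measurable_EFinP; exact: me].
transitivity (\int[g1]_y (`|c|^-1%:E * \int[g1]_u H u y))%E.
  apply: eq_integral => y _.
  rewrite -(gauss1_affine (s * y) c0); last first.
    split=> // ; exact: (measurableT_comp mH (measurable_pair2 y)).
  apply: eq_integral => x _; rewrite /H.
  have vE : v (c * x + s * y) y = - s * x + c * y.
    rewrite /v; transitivity (- s * x + (1 - s ^+ 2) / c * y); first by field.
    by rewrite -cs; field.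
  rewrite vE -[LHS]mule1 -muleA -EFinM; congr (_ * _%:E)%E.
  (* A rotation preserves [x ^ 2 + y ^ 2], so the two density quotients multiply to 1. *)
  have ee : e1 (- s * x + c * y) * e1 (c * x + s * y) = e1 x * e1 y.
    rewrite /e1 -!expRD; congr expR.
    rewrite -!mulrDr; congr (_ * _).
    by transitivity ((c ^+ 2 + s ^+ 2) * (x ^+ 2 + y ^+ 2)); [ring|rewrite cs mul1r].
  by rewrite mulrACA ee -invfM (mulrC (e1 y)) mulfV// mulf_neq0// gt_eqF ?e1_gt0.
rewrite ge0_integralZl//; last first.
- by move=> y _; exact: integral_ge0.
- apply: (measurable_integral2 (fun y u => H u y)) => //.
  exact: (measurableT_comp mH (@measurable_swap _ _ _ _)).
rewrite -(tonelli H)// -ge0_integralZl//; last first.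
- by move=> u _; exact: integral_ge0.
- exact: (measurable_integral2 H).
apply: eq_integral => u _.
have nFu : nnm (F u).
  by split=> //; exact: (measurableT_comp mF (measurable_pair1 u)).
have ci0 : c^-1 != 0 by rewrite invr_neq0.
have := gauss1_affine (- (s / c) * u) ci0 nFu.
rewrite normfV invrK => E1.
transitivity (`|c|^-1%:E * (`|c|%:E * \int[g1]_x F u x))%E.
  rewrite -E1; apply: f_equal; apply: eq_integral => y _.
  by rewrite /H /v [(- _ * _ + _)%R]addrC.
by rewrite muleA -EFinM mulVf ?mul1e// normr_eq0.
Qed.

Lemma gauss1_rot (c s : R) (F : R -> R -> \bar R) : c ^+ 2 + s ^+ 2 = 1 ->
  nnm (fun p : R * R => F p.1 p.2) ->
  (\int[g1]_x \int[g1]_y F (c * x + s * y)%R (- s * x + c * y)%R =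
   \int[g1]_x \int[g1]_y F x y)%E.
Proof.
move=> cs nF; have [c0|c0] := eqVneq c 0; last exact: gauss1_rot_c.
(* a quarter turn is the square of an eighth of a turn *)
have s2 : s ^+ 2 = 1 by rewrite -cs c0 expr0n/= add0r.
pose k : R := (Num.sqrt 2)^-1.
have k2 : k ^+ 2 = 2^-1 by rewrite /k exprVn sqr_sqrtr.
have k0 : k != 0 by rewrite invr_neq0// gt_eqF// sqrtr_gt0.
have ks : k ^+ 2 + (k * s) ^+ 2 = 1 by rewrite exprMn s2 k2; field.
rewrite -[RHS](gauss1_rot_c k0 ks nF).
rewrite -[RHS](gauss1_rot_c (F := fun x y => F (k * x + k * s * y) (- (k * s) * x + k * y)) k0 ks).
  apply: eq_integral => x _; apply: eq_integral => y _.
  have kk : k * k = 2^-1 by rewrite -expr2.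
  have ss : s * s = 1 by rewrite -expr2.
  rewrite c0; congr F.
    by transitivity (k * k * (1 - s * s) * x + 2 * (k * k) * s * y);
      [rewrite kk ss; field|ring].
  by transitivity (- 2 * (k * k) * s * x + k * k * (1 - s * s) * y);
      [rewrite kk ss; field|ring].
split=> [|p]; last exact: (nF.2 (_, _)).
apply: (measurableT_comp nF.1 (measurable_fun_pair _ _)) => /=;
  by apply: measurable_funD; apply: measurable_funM.
Qed.

End plane_rotation.

Lemma integral_prob_cst d (T : measurableType d) (R : realType) (P : probability T R)
  (r : \bar R) : (\int[P]_x r = r)%E.
Proof. by rewrite integral_cst// [X in (_ * X)%E]probability_setT mule1. Qed.

(** * Stability of Gaussian measures under normalized combinations *)

Section stability.
Context d1 d2 (T1 : measurableType d1) (T2 : measurableType d2) (R : realType).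
Variables (P1 : probability T1 R) (P2 : probability T2 R).

(** For independent [x] and [y] of law [P], the variable [l (x, y)] again has law [P]. With a
    normalized linear combination this is the 2-stability of the Gaussian. *)
Definition stable_under d (T : measurableType d) (P : probability T R) (l : T * T -> T) :=
  measurable_fun setT l /\ forall F, nnm F ->
  (\int[P]_x \int[P]_y F (l (x, y)) = \int[P]_x F x)%E.

(** Reordering the integrals from [x1 x2 y1 y2] to [x1 y1 x2 y2] groups the two copies of each
    factor, where stability is known. *)
Lemma stable_prod (l1 : T1 * T1 -> T1) (l2 : T2 * T2 -> T2) (F : T1 * T2 -> \bar R) :
  stable_under P1 l1 -> stable_under P2 l2 -> nnm F ->
  (\int[P1]_x1 \int[P2]_x2 \int[P1]_y1 \int[P2]_y2 F (l1 (x1, y1), l2 (x2, y2)) =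
   \int[P1]_x1 \int[P2]_x2 F (x1, x2))%E.
Proof.
move=> [ml1 s1] [ml2 s2] [mF F0].
have mG : measurable_fun setT (fun p : T1 * T2 * T1 * T2 =>
    F (l1 (p.1.1.1, p.1.2), l2 (p.1.1.2, p.2))).
  have q1 : measurable_fun setT (fun p : T1 * T2 * T1 * T2 => p.1.1.1).
    by apply: measurableT_comp => //; apply: measurableT_comp.
  have q2 : measurable_fun setT (fun p : T1 * T2 * T1 * T2 => p.1.1.2).
    by apply: measurableT_comp => //; apply: measurableT_comp.
  have q3 : measurable_fun setT (fun p : T1 * T2 * T1 * T2 => p.1.2).
    by apply: measurableT_comp.
  apply: (measurableT_comp mF); apply: measurable_fun_pair.
    exact: (measurableT_comp ml1 (measurable_fun_pair q1 q3)).
  exact: (measurableT_comp ml2 (measurable_fun_pair q2 measurable_snd)).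
have mG1 : measurable_fun setT (fun p : T1 * T2 * T1 => \int[P2]_y2
    F (l1 (p.1.1, p.2), l2 (p.1.2, y2)))%E.
  exact: (measurable_integral2 (fun p y2 => F (l1 (p.1.1, p.2), l2 (p.1.2, y2)))).
transitivity (\int[P1]_x1 \int[P1]_y1 \int[P2]_x2 \int[P2]_y2
    F (l1 (x1, y1), l2 (x2, y2)))%E.
  apply: eq_integral => x1 _.
  apply: (tonelli (fun x2 y1 => \int[P2]_y2 F (l1 (x1, y1), l2 (x2, y2))))%E.
    have q : measurable_fun setT (fun p : T2 * T1 => (x1, p.1, p.2)).
      by apply: measurable_fun_pair => //; apply: measurable_fun_pair.
    exact: (measurableT_comp mG1 q).
  by move=> x2 y1; exact: integral_ge0.
have mH : measurable_fun setT (fun x1 => \int[P2]_x2 F (x1, x2))%E.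
  apply: (measurable_integral2 (fun x1 x2 => F (x1, x2))) => //.
  by under eq_fun do rewrite -surjective_pairing.
rewrite -(s1 (fun x1 => \int[P2]_x2 F (x1, x2)))%E; last first.
  by split=> // x; exact: integral_ge0.
apply: eq_integral => x1 _; apply: eq_integral => y1 _.
rewrite (s2 (fun z => F (l1 (x1, y1), z)))//; split=> //.
exact: (measurableT_comp mF (measurable_pair1 _)).
Qed.
End stability.

Section gaussian_stability.
Variable R : realType.
Local Notation g1 := (gauss1 R).
Local Notation g3 := (gauss3 R).
Variables (s c : R) (sc : s ^+ 2 + c ^+ 2 = 1).

Let l1 (p : R * R) : R := s * p.1 + c * p.2.
Let ml1 : measurable_fun setT l1.
Proof. by apply: measurable_funD; apply: measurable_funM. Qed.

Lemma gauss1_stable : stable_under g1 l1.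
Proof.
split=> // F [mF F0].
have := gauss1_rot (F := fun u _ => F u) sc.
rewrite /l1 => ->; last first.
  by split=> //; exact: (measurableT_comp mF measurable_fst).
by apply: eq_integral => x _; rewrite integral_prob_cst.
Qed.

Let lp (p : (R * R) * (R * R)) : R * R := (l1 (p.1.1, p.2.1), l1 (p.1.2, p.2.2)).
Let l3 (p : V3 R * V3 R) : V3 R := [tuple l1 (tnth p.1 i, tnth p.2 i) | i < 3].

Let ml3 : measurable_fun setT l3.
Proof.
apply/measurable_fun_tnthP => i.
rewrite (_ : _ \o _ = fun p => l1 (tnth p.1 i, tnth p.2 i)); last first.
  by apply/funext => p /=; rewrite tnth_mktuple.
apply: (measurableT_comp ml1); apply: measurable_fun_pair.
  exact: (measurableT_comp (measurable_tnth i) measurable_fst).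
exact: (measurableT_comp (measurable_tnth i) measurable_snd).
Qed.

Lemma gauss11_stable : stable_under (prodP g1 g1) lp.
Proof.
have mlp : measurable_fun setT lp.
  apply: measurable_fun_pair; apply: (measurableT_comp ml1); apply: measurable_fun_pair.
  - exact: (measurableT_comp measurable_fst measurable_fst).
  - exact: (measurableT_comp measurable_fst measurable_snd).
  - exact: (measurableT_comp measurable_snd measurable_fst).
  - exact: (measurableT_comp measurable_snd measurable_snd).
split=> // F [mF F0].
have mFl := measurableT_comp mF mlp.
have nFl : nnm (fun x => \int[prodP g1 g1]_y F (lp (x, y)))%E.
  split=> [|x]; last exact: integral_ge0.
  apply: (measurable_integral2 (fun x y => F (lp (x, y)))) => //.
rewrite (integral_prodP nFl) (integral_prodP (conj mF F0)).
rewrite -(stable_prod gauss1_stable gauss1_stable (conj mF F0)).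
apply: eq_integral => x1 _; apply: eq_integral => x2 _.
rewrite integral_prodP//; split=> //.
exact: (measurableT_comp mFl (measurable_pair1 (x1, x2))).
Qed.

Lemma gauss3_stable : stable_under g3 l3.
Proof.
split=> // F [mF F0].
have mFt := measurableT_comp mF (@measurable_trip R).
have mFl := measurableT_comp mF ml3.
have nFl : nnm (fun x => \int[g3]_y F (l3 (x, y)))%E.
  split=> [|x]; last exact: integral_ge0.
  apply: (measurable_integral2 (fun x y => F (l3 (x, y)))) => //.
have gE G : nnm G -> (\int[g3]_x G x = \int[g1]_x \int[prodP g1 g1]_q G (trip (x, q)))%E.
  move=> [mG G0]; rewrite integral_push// (integral_prodP (f := G \o @trip R))//.
  by split=> [|?]; [exact: (measurableT_comp mG (@measurable_trip R))|exact: G0].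
rewrite (gE _ nFl) (gE _ (conj mF F0)).
have nFt : nnm (F \o @trip R) := conj mFt (fun=> F0 _).
rewrite -(stable_prod gauss1_stable gauss11_stable nFt).
apply: eq_integral => x _; apply: eq_integral => q _.
rewrite gE; last first.
  by split=> //; exact: (measurableT_comp mFl (measurable_pair1 _)).
apply: eq_integral => y _; apply: eq_integral => r _; congr F.
apply: eq_from_tnth => i; rewrite tnth_mktuple.
by case: i => [[|[|[|]]]]// Hi; rewrite !(tnth_nth 0).
Qed.

Lemma gam_stable K : stable_under (gam R K) (fun p => addc (sclc s p.1) (sclc c p.2)).
Proof.
have ml k : measurable_fun setT (fun p : Config R k * Config R k => addc (sclc s p.1) (sclc c p.2)).
  by apply: measurable_addc; apply: measurable_sclc.
split; first exact: ml.
elim: K => [|K IH] F nF.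
  have E (x : Config R 0) : F x = F [tuple] by congr F; exact: tuple0.
  under eq_integral do under eq_integral do rewrite E.
  under [RHS]eq_integral do rewrite E.
  by under eq_integral do rewrite integral_prob_cst.
have mFl := measurableT_comp nF.1 (ml K.+1).
rewrite integral_gamS; last first.
  split=> [|x]; last by apply: integral_ge0 => y _; exact: nF.2.
  apply: (measurable_integral2 (fun x y => F (addc (sclc s x) (sclc c y)))) => // x y; exact: nF.2.
rewrite (integral_gamS nF).
have nFc : nnm (F \o @consc R K).
  by split=> [|?]; [exact: (measurableT_comp nF.1 (@measurable_consc R K))|exact: nF.2].
rewrite -(stable_prod gauss3_stable (conj (ml K) IH) nFc).
apply: eq_integral => a _; apply: eq_integral => t _.
rewrite integral_gamS; last first.
  split=> [|y]; last exact: nF.2.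
  exact: (measurableT_comp mFl (measurable_pair1 _)).
apply: eq_integral => b _; apply: eq_integral => u _; congr F.
apply: eq_from_tnth => i; apply: eq_from_tnth => l.
rewrite !tnth_mktuple/= /co/= !tnth_mktuple/= /co/=.
case: (unliftP ord0 i) => [j ->|->]; rewrite ?tnth0 ?tnthS.
  by rewrite !tnth_mktuple/= /co/= !tnth_mktuple.
by rewrite !tnth_mktuple.
Qed.

End gaussian_stability.

Section measurability.
Context d (T : measurableType d) (R : realType).

Lemma measurable_trip3 (f g h : T -> R) : measurable_fun setT f ->
  measurable_fun setT g -> measurable_fun setT h ->
  measurable_fun setT (fun x => [tuple f x; g x; h x] : V3 R).
Proof.
move=> mf mg mh.
exact: (measurableT_comp (@measurable_trip R) (measurable_fun_pair mf (measurable_fun_pair mg mh))).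
Qed.

Lemma measurable_lin2 (a b : R) (f g : T -> R) : measurable_fun setT f ->
  measurable_fun setT g -> measurable_fun setT (fun x => a * f x + b * g x).
Proof. by move=> mf mg; apply: measurable_funD; apply: measurable_funM. Qed.

Lemma nnm_comp d' (U : measurableType d') (F : U -> \bar R) (f : T -> U) :
  nnm F -> measurable_fun setT f -> nnm (F \o f).
Proof. by move=> [mF F0] mf; split=> [|x]; [exact: measurableT_comp|exact: F0]. Qed.

Lemma nnm_integral d' (U : measurableType d') (P : probability U R) (f : T -> U -> \bar R) :
  nnm (fun p : T * U => f p.1 p.2) -> nnm (fun x => \int[P]_u f x u)%E.
Proof.
move=> [mf f0]; split=> [|x]; last by apply: integral_ge0 => u _; exact: (f0 (x, u)).
by apply: (measurable_integral2 f) => // x u; exact: (f0 (x, u)).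
Qed.

Lemma tonelliP d' (U : measurableType d') (P : probability T R) (Q : probability U R)
  (f : T -> U -> \bar R) : nnm (fun p : T * U => f p.1 p.2) ->
  (\int[P]_x \int[Q]_y f x y = \int[Q]_y \int[P]_x f x y)%E.
Proof. by move=> [mf f0]; apply: tonelli => // x y; exact: (f0 (x, y)). Qed.

End measurability.
Arguments tonelliP {d T R d' U P Q} f.

(** * Rotations and collisions of two Gaussian velocities *)

Section gauss3_rotation.
Variable R : realType.
Local Notation g1 := (gauss1 R).
Local Notation g3 := (gauss3 R).

(** Coordinates through [nth], which reduce by computation on explicit triples; the default 0 is
    never reached for indices below 3. *)
Definition cr (a : V3 R) i : R := nth 0 a i.
Lemma measurable_cr d (T : measurableType d) (f : T -> V3 R) i : (i < 3)%N ->
  measurable_fun setT f -> measurable_fun setT (fun x => cr (f x) i).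
Proof.
move=> i3 mf; rewrite (_ : (fun x => _) = (fun x => tnth (f x) (Ordinal i3))).
  exact: (measurableT_comp (measurable_tnth (Ordinal i3)) mf).
by apply/funext => x; rewrite (tnth_nth 0).
Qed.

Lemma v3P (a b : V3 R) : cr a 0 = cr b 0 -> cr a 1 = cr b 1 -> cr a 2 = cr b 2 -> a = b.
Proof.
move=> h0 h1 h2; apply: eq_from_tnth => -[[|[|[|]]]// Hi]; by rewrite !(tnth_nth 0).
Qed.

Definition rotz (c s : R) (a : V3 R) : V3 R :=
  [tuple c * cr a 0 + s * cr a 1; - s * cr a 0 + c * cr a 1; cr a 2].
Definition roty (c s : R) (a : V3 R) : V3 R :=
  [tuple c * cr a 0 + s * cr a 2; cr a 1; - s * cr a 0 + c * cr a 2].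

Lemma measurable_rotz c s : measurable_fun setT (rotz c s).
Proof. by apply: measurable_trip3; do ?apply: measurable_lin2; exact: measurable_cr. Qed.
Lemma measurable_roty c s : measurable_fun setT (roty c s).
Proof. by apply: measurable_trip3; do ?apply: measurable_lin2; exact: measurable_cr. Qed.

Lemma nnm_gauss3_slice (F : V3 R -> \bar R) : nnm F ->
  nnm (fun p : R * R => \int[g1]_z F [tuple p.1; p.2; z])%E /\
  nnm (fun p : R * R => \int[g1]_y F [tuple p.1; y; p.2])%E.
Proof.
move=> nF; split; apply: (@nnm_integral _ _ _ _ _ g1); apply: (nnm_comp nF);
  apply: measurable_trip3 => //; apply: measurableT_comp => //.
Qed.

Lemma gauss3_rotz c s F : c ^+ 2 + s ^+ 2 = 1 -> nnm F ->
  (\int[g3]_a F (rotz c s a) = \int[g3]_a F a)%E.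
Proof.
move=> cs nF; have nFr := nnm_comp nF (measurable_rotz c s).
rewrite (integral_gauss3 nF) (integral_gauss3 nFr).
exact: (gauss1_rot (F := fun x y => \int[g1]_z F [tuple x; y; z])%E cs (nnm_gauss3_slice nF).1).
Qed.

Lemma gauss3_roty c s F : c ^+ 2 + s ^+ 2 = 1 -> nnm F ->
  (\int[g3]_a F (roty c s a) = \int[g3]_a F a)%E.
Proof.
move=> cs nF; have nFr := nnm_comp nF (measurable_roty c s).
have sw G : nnm G -> (\int[g3]_a G a = \int[g1]_x \int[g1]_z \int[g1]_y G [tuple x; y; z])%E.
  move=> nG; rewrite (integral_gauss3 nG); apply: eq_integral => x _.
  apply: (tonelliP (fun y z => G [tuple x; y; z])); apply: (nnm_comp nG).
  exact: measurable_trip3.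
rewrite (sw _ nF) (sw _ nFr).
exact: (gauss1_rot (F := fun x z => \int[g1]_y F [tuple x; y; z])%E cs (nnm_gauss3_slice nF).2).
Qed.

Definition upd3 (a : V3 R) (z : R) : V3 R := [tuple cr a 0; cr a 1; z].
Lemma measurable_upd3 d (T : measurableType d) (f : T -> V3 R) (g : T -> R) :
  measurable_fun setT f -> measurable_fun setT g ->
  measurable_fun setT (fun x => upd3 (f x) (g x)).
Proof. by move=> mf mg; apply: measurable_trip3 => //; exact: measurable_cr. Qed.

Lemma gauss3_resample F : nnm F ->
  (\int[g3]_a \int[g1]_z F (upd3 a z) = \int[g3]_a F a)%E.
Proof.
move=> nF; rewrite (integral_gauss3 nF).
have nU : nnm (fun a => \int[g1]_z F (upd3 a z))%E.
  by apply: nnm_integral; apply: (nnm_comp nF); exact: measurable_upd3.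
rewrite (integral_gauss3 nU); apply: eq_integral => x _; apply: eq_integral => y _.
by rewrite /upd3 /cr/= integral_prob_cst.
Qed.

(** Both third coordinates are first resampled; the two fresh variables are independent with the
    same law, and Tonelli exchanges them. *)
Lemma gauss3_swap (G : V3 R * V3 R -> \bar R) : nnm G ->
  (\int[g3]_a \int[g3]_b G (upd3 a (cr b 2), upd3 b (cr a 2)) =
   \int[g3]_a \int[g3]_b G (a, b))%E.
Proof.
move=> nG.
have res (H : V3 R * V3 R -> \bar R) : nnm H ->
  (\int[g3]_a \int[g3]_b H (a, b) =
   \int[g3]_a \int[g3]_b \int[g1]_z \int[g1]_z' H (upd3 a z, upd3 b z'))%E.
  move=> nH.
  have mi : measurable_fun setT (fun p : V3 R * V3 R * R => (upd3 p.1.1 p.2, p.1.2)).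
    apply: measurable_fun_pair; last by apply: measurableT_comp.
    by apply: measurable_upd3 => //; apply: measurableT_comp.
  have n1 : nnm (fun a => \int[g3]_b H (a, b))%E.
    apply: nnm_integral; rewrite (_ : (fun p => _) = H)//.
    by apply/funext => -[].
  rewrite -(gauss3_resample n1); apply: eq_integral => a _.
  have n2 : nnm (fun p : R * V3 R => H (upd3 a p.1, p.2)).
    apply: (nnm_comp nH); apply: measurable_fun_pair => //.
    exact: measurable_upd3.
  rewrite (tonelliP (fun z b => H (upd3 a z, b)) n2).
  have n3 : nnm (fun b => \int[g1]_z H (upd3 a z, b))%E.
    apply: (@nnm_integral _ _ _ _ _ g1 (fun b z => H (upd3 a z, b))); apply: (nnm_comp nH).
    apply: measurable_fun_pair => //.
    exact: measurable_upd3.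
  rewrite -(gauss3_resample n3); apply: eq_integral => b _.
  apply: (tonelliP (fun z' z => H (upd3 a z, upd3 b z'))).
  by apply: (nnm_comp nH); apply: measurable_fun_pair; exact: measurable_upd3.
have ms : measurable_fun setT (fun p : V3 R * V3 R => (upd3 p.1 (cr p.2 2), upd3 p.2 (cr p.1 2))).
  by apply: measurable_fun_pair; apply: measurable_upd3 => //; exact: measurable_cr.
rewrite (res _ nG) (res _ (nnm_comp nG ms)).
apply: eq_integral => a _; apply: eq_integral => b _ /=.
apply: (tonelliP (fun z z' => G (upd3 a z', upd3 b z))).
by apply: (nnm_comp nG); apply: measurable_fun_pair; exact: measurable_upd3.
Qed.

(** A rotation that sends the third axis to [sph_pt th ph]. *)
Definition sphrot (th ph : R) (a : V3 R) : V3 R :=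
  rotz (cos ph) (- sin ph) (roty (cos th) (sin th) a).
Lemma measurable_sphrot th ph : measurable_fun setT (sphrot th ph).
Proof. exact: (measurableT_comp (measurable_rotz _ _) (measurable_roty _ _)). Qed.

Lemma gauss3_sphrot th ph F : nnm F ->
  (\int[g3]_a F (sphrot th ph a) = \int[g3]_a F a)%E.
Proof.
move=> nF; rewrite -(@gauss3_rotz (cos ph) (- sin ph) F) ?sqrrN ?cos2Dsin2//.
exact: (gauss3_roty (cos2Dsin2 th) (nnm_comp nF (measurable_rotz (cos ph) (- sin ph)))).
Qed.

Definition dot3 (w x : V3 R) : R := cr w 0 * cr x 0 + cr w 1 * cr x 1 + cr w 2 * cr x 2.

Lemma proj_partE (w x y : V3 R) (l : nat) : (l < 3)%N ->
  cr (proj_part w x y) l = cr x l + cr w l * (dot3 w y - dot3 w x).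
Proof.
move=> l3; rewrite /cr -(tnth_nth 0 _ (Ordinal l3)) tnth_mktuple.
rewrite !big_ord_recr big_ord0/= /Defs.comp !(tnth_nth 0)/= /dot3 /cr.
by case: l l3 => [|[|[|]]]//= _; ring.
Qed.

Lemma proj_part_sphrot th ph (x y : V3 R) :
  proj_part (sph_pt th ph) (sphrot th ph x) (sphrot th ph y) = sphrot th ph (upd3 x (cr y 2)).
Proof.
have c1 := cos2Dsin2 th; have c2 := cos2Dsin2 ph.
have e a : dot3 (sph_pt th ph) (sphrot th ph a) = cr a 2.
  transitivity ((sin th * cr a 0 * cos th + sin th ^+ 2 * cr a 2) * (cos ph ^+ 2 + sin ph ^+ 2)
    + cos th ^+ 2 * cr a 2 - sin th * cr a 0 * cos th).
    by rewrite /dot3 /sph_pt /sphrot /rotz /roty /= /cr/= -/(cr _ _); ring.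
  by rewrite c2 mulr1 -[RHS]mul1r -c1; ring.
apply: v3P; rewrite proj_partE// !e /sphrot /rotz /roty /sph_pt /upd3 /cr/=.
- ring.
- ring.
- ring.
Qed.

Lemma measurable_dot3 d (T : measurableType d) (f g : T -> V3 R) :
  measurable_fun setT f -> measurable_fun setT g ->
  measurable_fun setT (fun x => dot3 (f x) (g x)).
Proof.
move=> mf mg; apply: measurable_funD; [apply: measurable_funD|];
  by apply: measurable_funM; exact: measurable_cr.
Qed.

Lemma measurable_proj_part d (T : measurableType d) (f g h : T -> V3 R) :
  measurable_fun setT f -> measurable_fun setT g -> measurable_fun setT h ->
  measurable_fun setT (fun x => proj_part (f x) (g x) (h x)).
Proof.
move=> mf mg mh; apply/measurable_fun_tnthP => -[l l3].
rewrite (_ : _ \o _ = fun x => cr (g x) l + cr (f x) l * (dot3 (f x) (h x) - dot3 (f x) (g x))).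
  apply: measurable_funD; first exact: measurable_cr.
  apply: measurable_funM; first exact: measurable_cr.
  by apply: measurable_funB; exact: measurable_dot3.
by apply/funext => x /=; rewrite (tnth_nth 0)/= -proj_partE.
Qed.

(** In the frame turned by [sphrot th ph] a collision along [sph_pt th ph] merely exchanges third
    coordinates, so [gauss3_swap] applies. *)
Lemma gauss3_collision th ph (G : V3 R * V3 R -> \bar R) : nnm G ->
  (\int[g3]_a \int[g3]_b G (proj_part (sph_pt th ph) a b, proj_part (sph_pt th ph) b a) =
   \int[g3]_a \int[g3]_b G (a, b))%E.
Proof.
move=> nG; pose w := sph_pt th ph; pose q := sphrot th ph.
have mq := measurable_sphrot th ph.
have rot (H : V3 R * V3 R -> \bar R) : nnm H ->
  (\int[g3]_a \int[g3]_b H (a, b) = \int[g3]_a \int[g3]_b H (q a, q b))%E.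
  move=> nH.
  have n1 : nnm (fun a => \int[g3]_b H (a, b))%E.
    apply: nnm_integral; rewrite (_ : (fun p => _) = H)//.
    by apply/funext => -[].
  rewrite -(gauss3_sphrot th ph n1); apply: eq_integral => a _.
  rewrite -(gauss3_sphrot th ph (F := fun b => H (q a, b)))//.
  exact: (nnm_comp nH (measurable_pair1 _)).
have mp : measurable_fun setT (fun p : V3 R * V3 R => (proj_part w p.1 p.2, proj_part w p.2 p.1)).
  by apply: measurable_fun_pair; exact: measurable_proj_part.
rewrite (rot _ (nnm_comp nG mp)) (rot _ nG)/=.
have mqq : measurable_fun setT (fun p : V3 R * V3 R => (q p.1, q p.2)).
  by apply: measurable_fun_pair; apply: measurableT_comp.
rewrite -(gauss3_swap (nnm_comp nG mqq)).
apply: eq_integral => a _; apply: eq_integral => b _.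
by rewrite /= !proj_part_sphrot.
Qed.

End gauss3_rotation.

Section gaussian_collision.
Variable R : realType.
Local Notation g1 := (gauss1 R).
Local Notation g3 := (gauss3 R).
Local Notation gam := (gam R).

Definition updc K (z : Config R K) (i : 'I_K) (a : V3 R) : Config R K :=
  [tuple if k == i then a else tnth z k | k < K].

Lemma measurable_updc d (T : measurableType d) K i (f : T -> Config R K) (g : T -> V3 R) :
  measurable_fun setT f -> measurable_fun setT g ->
  measurable_fun setT (fun x => updc (f x) i (g x)).
Proof.
move=> mf mg; apply/measurable_fun_tnthP => k.
rewrite (_ : _ \o _ = if k == i then g else fun x => tnth (f x) k).
  by case: ifP => // _; exact: (measurableT_comp (measurable_tnth k) mf).
by apply/funext => x /=; rewrite tnth_mktuple; case: ifP.
Qed.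

Lemma gam_resample K i F : nnm F ->
  (\int[gam K]_z \int[g3]_a F (updc z i a) = \int[gam K]_z F z)%E.
Proof.
elim: K i F => [[]//|K IH] i F nF.
have nU : nnm (fun z => \int[g3]_a F (updc z i a))%E.
  by apply: nnm_integral; apply: (nnm_comp nF); exact: measurable_updc.
rewrite (integral_gamS nF) (integral_gamS nU).
case: (unliftP ord0 i) => [j ->|->].
  apply: eq_integral => a0 _.
  have mc : measurable_fun setT (fun t : Config R K => [tuple of a0 :: t] : Config R K.+1).
    by apply: measurable_cons => //; exact: measurable_cst.
  rewrite -(IH j _ (nnm_comp nF mc)).
  apply: eq_integral => t _; apply: eq_integral => a _ /=; congr F.
  apply: eq_from_tnth => k; case: (unliftP ord0 k) => [k' ->|->].
    rewrite tnth_mktuple !tnthS !tnth_mktuple.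
    by rewrite (inj_eq (@lift_inj _ _)); case: ifP.
  by rewrite tnth_mktuple !tnth0.
transitivity (\int[g3]_a0 \int[gam K]_t \int[g3]_a F [tuple of a :: t])%E.
  apply: eq_integral => a0 _; apply: eq_integral => t _; apply: eq_integral => a _.
  congr F; apply: eq_from_tnth => k; case: (unliftP ord0 k) => [k' ->|->].
    by rewrite tnth_mktuple !tnthS.
  by rewrite tnth_mktuple !tnth0.
rewrite integral_prob_cst.
apply: (tonelliP (fun t a => F (consc (a, t)))).
apply: (nnm_comp nF).
exact: (measurable_cons measurable_snd measurable_fst).
Qed.

Lemma measurable_rcoll d (T : measurableType d) K (i j : 'I_K) (w : T -> V3 R)
  (z : T -> Config R K) : measurable_fun setT w -> measurable_fun setT z ->
  measurable_fun setT (fun x => rcoll i j (w x) (z x)).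
Proof.
move=> mw mz; apply/measurable_fun_tnthP => k.
have mt k' : measurable_fun setT (fun x => tnth (z x) k').
  exact: (measurableT_comp (measurable_tnth k') mz).
rewrite (_ : _ \o _ = fun x => if k == i then proj_part (w x) (tnth (z x) i) (tnth (z x) j)
  else if k == j then proj_part (w x) (tnth (z x) j) (tnth (z x) i) else tnth (z x) k).
  by case: (k == i); [|case: (k == j) => //]; exact: measurable_proj_part.
by apply/funext => x /=; rewrite tnth_mktuple.
Qed.

(** Resampling particles [j] and [i] exposes the colliding velocities as two independent [gauss3]
    variables, wherever the indices stand in the tuple. *)
Lemma gam_collision K (i j : 'I_K) th ph F : i != j -> nnm F ->
  (\int[gam K]_z F (rcoll i j (sph_pt th ph) z) = \int[gam K]_z F z)%E.
Proof.
move=> ij nF; pose w := sph_pt th ph.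
have nFr : nnm (fun z => F (rcoll i j w z)).
  by apply: (nnm_comp nF); exact: measurable_rcoll.
have two H : nnm H -> (\int[gam K]_z H z =
    \int[gam K]_z \int[g3]_b \int[g3]_a H (updc (updc z j b) i a))%E.
  move=> nH; rewrite -(gam_resample i nH).
  rewrite -(gam_resample j) //.
  by apply: nnm_integral; apply: (nnm_comp nH); exact: measurable_updc.
rewrite (two _ nF) (two _ nFr); apply: eq_integral => z _.
rewrite -(gauss3_collision th ph (G := fun p => F (updc (updc z j p.1) i p.2))).
  apply: eq_integral => b _; apply: eq_integral => a _ /=; congr F.
  apply: eq_from_tnth => k; rewrite !tnth_mktuple !eqxx.
  rewrite (eq_sym j i) (negbTE ij).
  by case: (k == i) => //; case: (k == j).
apply: (nnm_comp nF); apply: measurable_updc => //; apply: measurable_updc => //.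
Qed.

Lemma gauss1_comb (al be : R) F : nnm F ->
  (\int[g1]_x \int[g1]_y F (al * x + be * y)%R =
   \int[g1]_x F (Num.sqrt (al ^+ 2 + be ^+ 2) * x)%R)%E.
Proof.
move=> nF; set r := Num.sqrt _.
have r2 : r ^+ 2 = al ^+ 2 + be ^+ 2 by rewrite sqr_sqrtr// addr_ge0// sqr_ge0.
have [r0|r0] := eqVneq r 0.
  have : al ^+ 2 + be ^+ 2 == 0 by rewrite -r2 r0 expr0n.
  rewrite paddr_eq0 ?sqr_ge0// !sqrf_eq0 => /andP[/eqP -> /eqP ->].
  rewrite r0; under eq_integral do under eq_integral do rewrite !mul0r addr0.
  under [RHS]eq_integral do rewrite mul0r.
  by under eq_integral do rewrite integral_prob_cst.
have cs : (al / r) ^+ 2 + (be / r) ^+ 2 = 1.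
  by rewrite !expr_div_n -mulrDl -r2 mulfV// sqrf_eq0.
have nFr : nnm (fun x => F (r * x)).
  by apply: (nnm_comp nF); exact: measurable_funM.
rewrite -((gauss1_stable cs).2 _ nFr).
apply: eq_integral => x _; apply: eq_integral => y _; congr F.
by rewrite /=; field.
Qed.

Lemma gauss3_dot3 (v : V3 R) F : nnm F ->
  (\int[g3]_a F (dot3 v a) = \int[g1]_x F (Num.sqrt (dot3 v v) * x)%R)%E.
Proof.
move=> nF; pose r := Num.sqrt (cr v 1 ^+ 2 + cr v 2 ^+ 2).
have r2 : r ^+ 2 = cr v 1 ^+ 2 + cr v 2 ^+ 2 by rewrite sqr_sqrtr// addr_ge0// sqr_ge0.
have nd : nnm (fun a => F (dot3 v a)).
  by apply: (nnm_comp nF); exact: measurable_dot3.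
rewrite (integral_gauss3 nd).
have -> : dot3 v v = cr v 0 ^+ 2 + r ^+ 2 by rewrite r2 /dot3; ring.
rewrite -(gauss1_comb _ _ nF); apply: eq_integral => x _.
have nt : nnm (fun y => F (cr v 0 * x + y)).
  by apply: (nnm_comp nF); exact: measurable_funD.
rewrite -(gauss1_comb _ _ nt); apply: eq_integral => y _; apply: eq_integral => z _.
by rewrite /dot3 /cr/= addrA.
Qed.

Lemma dot_cons K (a v : V3 R) (t u : Config R K) :
  dot ([tuple of v :: u] : Config R K.+1) [tuple of a :: t] = dot3 v a + dot u t.
Proof.
transitivity (\sum_(i < K.+1) \sum_(l < 3)
    co ([tuple of v :: u] : Config R K.+1) (i, l) * co ([tuple of a :: t] : Config R K.+1) (i, l)).
  by rewrite pair_bigA; apply: eq_bigr => -[].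
rewrite big_ord_recl; congr (_ + _).
  by rewrite !big_ord_recr big_ord0/= add0r /co/= !tnth0 !(tnth_nth 0).
by rewrite pair_bigA; apply: eq_bigr => -[i l] _; rewrite /co/= !tnthS.
Qed.

(** One-dimensional reduction behind the moment estimates: the blocks of [V] are absorbed one at a
    time, each time replacing two Gaussian terms by one. *)
Lemma gam_dot K (V : Config R K) F : nnm F ->
  (\int[gam K]_z F (dot V z) = \int[g1]_x F (Num.sqrt (sqnorm V) * x)%R)%E.
Proof.
elim: K V F => [|K IH] V F nF.
  rewrite (_ : sqnorm V = 0); last by rewrite /sqnorm big_ord0.
  under [RHS]eq_integral do rewrite sqrtr0 mul0r.
  rewrite integral_prob_cst.
  have dV z : dot V z = 0.
    by rewrite /dot -(pair_bigA _ (fun i l => co V (i, l) * co z (i, l)))/= big_ord0.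
  by under eq_integral do rewrite dV; rewrite integral_prob_cst.
case/tupleP: V => v V'.
have nd : nnm (fun z => F (dot ([tuple of v :: V'] : Config R K.+1) z)).
  by apply: (nnm_comp nF); exact: measurable_dot.
rewrite (integral_gamS nd).
pose r := Num.sqrt (sqnorm V'); pose q := Num.sqrt (dot3 v v).
have q0 : 0 <= dot3 v v by rewrite !addr_ge0// -expr2 sqr_ge0.
have -> : sqnorm ([tuple of v :: V'] : Config R K.+1) = q ^+ 2 + r ^+ 2.
  by rewrite !sqr_sqrtr ?sqnorm_ge0// sqnorm_dot dot_cons -sqnorm_dot.
transitivity (\int[g3]_a \int[g1]_x F (dot3 v a + r * x)%R)%E.
  apply: eq_integral => a _.
  under eq_integral do rewrite dot_cons.
  have nt : nnm (fun y => F (dot3 v a + y)).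
    by apply: (nnm_comp nF); exact: measurable_funD.
  exact: (IH V' _ nt).
have nt : nnm (fun p : R * R => F (p.2 + r * p.1)).
  by apply: (nnm_comp nF); apply: measurable_funD => //; exact: measurable_funM.
rewrite (tonelliP (fun a x => F (dot3 v a + r * x))); last first.
  apply: (nnm_comp nF); apply: measurable_funD; last exact: measurable_funM.
  by apply: measurable_dot3 => //; exact: measurable_cst.
have nx (x : R) : nnm (fun y : R => F (y + r * x)).
  by apply: (nnm_comp nF); exact: measurable_funD.
under eq_integral do rewrite (gauss3_dot3 v (nx _)).
rewrite addrC -(gauss1_comb _ _ nF); apply: eq_integral => x _; apply: eq_integral => y _.
by rewrite addrC.
Qed.

End gaussian_collision.

Lemma mean_le d (T : measurableType d) (R : realType) (Phi : (T -> \bar R) -> \bar R) f g :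
  mean_functional Phi -> nnm f -> nnm g -> (forall x, f x <= g x)%E -> (Phi f <= Phi g)%E.
Proof.
move=> PhiP nf ng fg; have [m mE] := mean_functionalE PhiP.
rewrite !mE//; apply: ge0_le_integral => //.
- by move=> x _; exact: nf.2.
- exact: nf.1.
- exact: ng.1.
Qed.

(** * Exponentials of jump operators *)

Section nnm_closure.
Context d (T : measurableType d) (R : realType).
Local Open Scope ereal_scope.

Lemma nnmD (f g : T -> \bar R) : nnm f -> nnm g -> nnm (fun x => f x + g x).
Proof.
move=> nf ng; split=> [|x]; last by rewrite adde_ge0 ?nf.2 ?ng.2.
by apply: emeasurable_funD; [exact: nf.1|exact: ng.1].
Qed.

Lemma nnmZ (c : R) (f : T -> \bar R) : (0 <= c)%R -> nnm f -> nnm (fun x => c%:E * f x).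
Proof.
move=> c0 nf; split=> [|x]; last by rewrite mule_ge0 ?lee_fin ?nf.2.
by apply: emeasurable_funM => //; exact: nf.1.
Qed.

Lemma nnm_sum (I : Type) (s : seq I) (f : I -> T -> \bar R) : (forall i, nnm (f i)) ->
  nnm (fun x => \sum_(i <- s) f i x).
Proof.
move=> nf; split=> [|x]; last by apply: sume_ge0 => i _; exact: (nf i).2.
by apply: emeasurable_sum => i; exact: (nf i).1.
Qed.

Lemma nnm_cst (c : R) : (0 <= c)%R -> nnm (fun _ : T => c%:E).
Proof. by move=> c0; split=> [|x]; [exact: measurable_cst|rewrite lee_fin]. Qed.

Lemma nnm_lim (f : nat -> T -> \bar R) g : (forall n, nnm (f n)) ->
  (forall x, f n x @[n --> \oo] --> g x) -> nnm g.
Proof.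
move=> nf fg; split=> [|x].
  by apply: (emeasurable_fun_cvg f) => // n; exact: (nf n).1.
rewrite -(cvg_lim _ (fg x))//; apply: lime_ge; first by apply/cvg_ex; exists (g x).
by apply: nearW => n; exact: (nf n).2.
Qed.

End nnm_closure.

Section jump.
Context (R : realType) d dU (Z : measurableType d) (U : measurableType dU).
Variables (P : probability U R) (I : finType) (rp : I -> R) (act : I -> U -> Z -> Z).
Hypothesis rp0 : forall i, 0 <= rp i.
Hypothesis mact : forall i, measurable_fun setT (fun p : U * Z => act i p.1 p.2).

Local Open Scope ereal_scope.

(** The gain part of a jump generator, without its loss term. It is kept abstract because it acts
    both on configurations ([jumpC]) and on matrices ([jumpM]). *)
Definition jump (Psi : Z -> \bar R) (z : Z) : \bar R :=
  \sum_i (rp i)%:E * \int[P]_u Psi (act i u z).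

Lemma nnm_act (Psi : Z -> \bar R) i z : nnm Psi -> nnm (fun u => Psi (act i u z)).
Proof.
move=> nPsi; apply: (nnm_comp nPsi).
exact: (measurableT_comp (mact i) (measurable_pair2 z)).
Qed.

(** The parameter in [T] provides the joint measurability needed to exchange [jump] and its iterates
    with an integral over [T]. *)
Lemma nnm_jump_param d' (T : measurableType d') (Psi : T -> Z -> \bar R) :
  nnm (fun p : T * Z => Psi p.1 p.2) -> nnm (fun p : T * Z => jump (Psi p.1) p.2).
Proof.
move=> nPsi; apply: nnm_sum => i; apply: nnmZ => //.
apply: (@nnm_integral _ _ _ _ _ P (fun (p : T * Z) u => Psi p.1 (act i u p.2))).
apply: (nnm_comp nPsi (f := fun q : T * Z * U => (q.1.1, act i q.2 q.1.2))).
have mq : measurable_fun setT (fun q : T * Z * U => (q.2, q.1.2)).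
  by apply: measurable_fun_pair => //; apply: measurableT_comp.
apply: measurable_fun_pair; first by apply: measurableT_comp.
exact: (measurableT_comp (mact i) mq).
Qed.

Lemma nnm_jump (Psi : Z -> \bar R) : nnm Psi -> nnm (jump Psi).
Proof.
move=> nPsi.
have nP : nnm (fun p : unit * Z => Psi p.2) := nnm_comp nPsi measurable_snd.
have nJ := nnm_jump_param (Psi := fun _ => Psi) nP.
exact: (nnm_comp nJ (measurable_pair1 tt)).
Qed.

Lemma nnm_iter_jump n (Psi : Z -> \bar R) : nnm Psi -> nnm (iter n jump Psi).
Proof. by move=> nPsi; elim: n => // n IH; exact: nnm_jump. Qed.

Lemma nnm_iter_jump_param d' (T : measurableType d') n (Psi : T -> Z -> \bar R) :
  nnm (fun p : T * Z => Psi p.1 p.2) -> nnm (fun p : T * Z => iter n jump (Psi p.1) p.2).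
Proof.
move=> nPsi; elim: n => // n IH.
exact: (nnm_jump_param (Psi := fun t => iter n jump (Psi t)) IH).
Qed.

Lemma mean_functional_sum (J : Type) (s : seq J) (Phi : J -> (Z -> \bar R) -> \bar R) :
  (forall j, mean_functional (Phi j)) ->
  mean_functional (fun f => \sum_(j <- s) Phi j f).
Proof.
move=> PhiP; split.
- by move=> f nf; apply: sume_ge0 => j _; exact: (mean_ge0 (PhiP j)).
- by move=> f g nf ng; rewrite -big_split; apply: eq_bigr => j _; exact: (meanD (PhiP j)).
- move=> c f c0 nf; rewrite ge0_sume_distrr; last by move=> j _; exact: (mean_ge0 (PhiP j)).
  by apply: eq_bigr => j _; exact: (meanZ (PhiP j)).
- move=> f g nf fnd fg; have ng := nnm_lim nf fg.
  elim: s => [|j s IH].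
    by under eq_fun do rewrite big_nil; rewrite big_nil; exact: cvg_cst.
  under eq_fun do rewrite big_cons; rewrite big_cons.
  apply: cvgeD => //; last exact: (mean_lim (PhiP j) nf fnd fg).
  apply: ge0_adde_def; rewrite inE; first exact: (mean_ge0 (PhiP j)).
  by apply: sume_ge0 => k _; exact: (mean_ge0 (PhiP k)).
Qed.

Lemma mean_functional_jump z : mean_functional (jump ^~ z).
Proof.
apply: mean_functional_sum => i.
have H := @mean_functional_integral _ Z R _ U P (fun _ => rp i) (fun u => act i u z)
  (measurable_cst _) (fun=> rp0 i) (measurableT_comp (mact i) (measurable_pair2 z)).
have E f : nnm f -> (rp i)%:E * \int[P]_u f (act i u z) = \int[P]_u (f (act i u z) * (rp i)%:E).
  move=> nf; have nfa := nnm_act i z nf.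
  rewrite muleC ge0_integralZr ?lee_fin//; first exact: nfa.1.
  by move=> u _; exact: nf.2.
split.
- by move=> f nf; rewrite E//; exact: (mean_ge0 H).
- by move=> f g nf ng; rewrite (E _ (nnmD nf ng)) (E _ nf) (E _ ng); exact: (meanD H).
- by move=> c f c0 nf; rewrite (E _ (nnmZ c0 nf)) (E _ nf); exact: (meanZ H).
- move=> f g nf fnd fg; rewrite E; last exact: (nnm_lim nf fg).
  under eq_fun do rewrite (E _ (nf _)).
  exact: (mean_lim H nf fnd fg).
Qed.

Lemma mean_functional_iter_jump n z : mean_functional (fun f => iter n jump f z).
Proof.
elim: n z => [|n IH] z.
  split => //=.
  - by move=> f nf; exact: nf.2.
have Jz := mean_functional_jump z.
have ni f : nnm f -> nnm (iter n jump f) by exact: nnm_iter_jump.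
split => /=.
- by move=> f nf; exact: (mean_ge0 Jz (ni f nf)).
- move=> f g nf ng; rewrite -(meanD Jz (ni f nf) (ni g ng)); congr (jump _ z).
  by apply/funext => y; exact: (meanD (IH y)).
- move=> c f c0 nf; rewrite -(meanZ Jz c0 (ni f nf)); congr (jump _ z).
  by apply/funext => y; exact: (meanZ (IH y)).
- move=> f g nf fnd fg; have ng := nnm_lim nf fg.
  apply: (mean_lim Jz).
  + by move=> k; exact: ni.
  (* Monotone convergence for the outer jump requires the inner iterates to increase with their
     argument. *)
  + by move=> y k l kl; apply: (mean_le (IH y)) => // x; exact: fnd.
  + by move=> y; exact: (mean_lim (IH y) nf fnd fg).
Qed.

Lemma iter_jump_cst n z : iter n jump (fun=> 1) z = ((\sum_i rp i) ^+ n)%:E.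
Proof.
elim: n z => [|n IH] z //=.
transitivity (\sum_i (rp i * (\sum_i rp i) ^+ n)%:E)%E.
  apply: eq_bigr => i _; under eq_integral do rewrite IH.
  by rewrite integral_prob_cst EFinM.
by rewrite sumEFin -mulr_suml -exprS.
Qed.

(** Comparison along trajectories: [Q] is any predicate preserved by the jumps of positive rate, and
    only values on [Q] are visited. Later [Q] is [Good]. *)
Lemma iter_jump_le (Q : Z -> Prop) n (Psi1 Psi2 : Z -> \bar R) :
  (forall i u z, (0 < rp i)%R -> Q z -> Q (act i u z)) ->
  nnm Psi1 -> nnm Psi2 -> (forall z, Q z -> Psi1 z <= Psi2 z) ->
  forall z, Q z -> iter n jump Psi1 z <= iter n jump Psi2 z.
Proof.
move=> Qact n1 n2 le12; elim: n => //= n IH z Qz.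
apply: lee_sum => i _; have [r0|] := boolP (0 < rp i)%R; last first.
  rewrite lt_neqAle rp0 andbT negbK => /eqP <-; rewrite !mul0e//.
apply: lee_wpmul2l; first by rewrite lee_fin.
have i1 := nnm_act i z (nnm_iter_jump n n1); have i2 := nnm_act i z (nnm_iter_jump n n2).
apply: ge0_le_integral => //.
- by move=> u _; exact: i1.2.
- exact: i1.1.
- exact: i2.1.
- by move=> u _; apply: IH; exact: Qact.
Qed.

Lemma jump_integral d' (T : measurableType d') (Q : probability T R)
  (Psi : T -> Z -> \bar R) z : nnm (fun p : T * Z => Psi p.1 p.2) ->
  jump (fun z => \int[Q]_t Psi t z) z = \int[Q]_t jump (Psi t) z.
Proof.
move=> nPsi; rewrite /jump.
have na i : nnm (fun p : T * U => Psi p.1 (act i p.2 z)).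
  apply: (nnm_comp nPsi (f := fun q : T * U => (q.1, act i q.2 z))).
  apply: measurable_fun_pair => //.
  exact: (measurableT_comp (measurableT_comp (mact i) (measurable_pair2 z)) measurable_snd).
have nb i : nnm (fun t => \int[P]_u Psi t (act i u z)).
  exact: (@nnm_integral _ _ _ _ _ P (fun t u => Psi t (act i u z))).
rewrite ge0_integral_sum//; last 2 first.
- by move=> i; exact: (nnmZ (rp0 i) (nb i)).1.
- by move=> i t _; exact: (nnmZ (rp0 i) (nb i)).2.
apply: eq_bigr => i _.
rewrite ge0_integralZl ?lee_fin//; last 2 first.
- exact: (nb i).1.
- by move=> t _; exact: (nb i).2.
by congr (_ * _); apply/esym/(tonelliP (fun t u => Psi t (act i u z))).
Qed.

Lemma iter_jump_integral d' (T : measurableType d') (Q : probability T R) n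
  (Psi : T -> Z -> \bar R) z : nnm (fun p : T * Z => Psi p.1 p.2) ->
  iter n jump (fun z => \int[Q]_t Psi t z) z = \int[Q]_t iter n jump (Psi t) z.
Proof.
move=> nPsi; elim: n z => //= n IH z.
rewrite (_ : iter n jump _ = fun z => \int[Q]_t iter n jump (Psi t) z); last exact/funext.
by rewrite jump_integral//; exact: nnm_iter_jump_param.
Qed.

Lemma nneseries_exp (x : R) : (0 <= x)%R ->
  \sum_(n <oo) (x ^+ n / (n`!)%:R)%:E = (expR x)%:E.
Proof.
move=> x0; apply/cvg_lim => //.
rewrite [X in X @ _ --> _](_ : _ = EFin \o series (exp_coeff x)); last first.
  by apply/funext => n /=; rewrite sumEFin.
apply: cvg_EFin; first by apply: nearW.
exact: is_cvg_series_exp_coeff.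
Qed.

(** The law after [n] jumps has mass [c ^ n] by [iter_jump_cst], so the total masses are the weights
    of a Poisson variable of mean [c t] and sum to 1. *)
Lemma exp_jump_law (t : R) (z : Z) : (0 <= t)%R ->
  {nu : probability Z R | forall Psi, nnm Psi ->
    (expR (- (\sum_i rp i) * t))%:E *
    (\sum_(n <oo) (t ^+ n / (n`!)%:R)%:E * iter n jump Psi z) = \int[nu]_x Psi x}.
Proof.
move=> t0; set c := (\sum_i rp i)%R.
pose m n := sval (mean_functionalE (mean_functional_iter_jump n z)).
have mE n f : nnm f -> iter n jump f z = \int[m n]_x f x.
  exact: (svalP (mean_functionalE (mean_functional_iter_jump n z))).
have w0 n : (0 <= expR (- c * t) * (t ^+ n / (n`!)%:R))%R.
  by rewrite mulr_ge0 ?expR_ge0// divr_ge0// exprn_ge0.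
pose nu0 := mseries (fun n => mscale (NngNum (w0 n)) (m n)) 0.
have nuE f : nnm f -> (expR (- c * t))%:E *
    (\sum_(n <oo) (t ^+ n / (n`!)%:R)%:E * iter n jump f z) = \int[nu0]_x f x.
  move=> nf; rewrite ge0_integral_measure_series//; [|by move=> x _; exact: nf.2|exact: nf.1].
  rewrite -nneseriesZl; last first.
    move=> n _; rewrite mule_ge0 ?lee_fin ?divr_ge0 ?exprn_ge0//.
    exact: (nnm_iter_jump n nf).2.
  apply: eq_eseriesr => n _; rewrite ge0_integral_mscale//; [|exact: nf.1|by move=> x _; exact: nf.2].
  by rewrite mE// muleA -EFinM.
have c0 : (0 <= c)%R by apply: sumr_ge0 => i _; exact: rp0.
have nu1 : nu0 setT = 1.
  have n1 : nnm (fun _ : Z => 1 : \bar R) by exact: nnm_cst.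
  rewrite -[LHS]mul1e -(integral_cst nu0 measurableT 1) -nuE//.
  rewrite (eq_eseriesr (g := fun n => ((t * c) ^+ n / (n`!)%:R)%:E)); last first.
    by move=> n _; rewrite iter_jump_cst -EFinM exprMn mulrAC.
  by rewrite nneseries_exp ?mulr_ge0// -EFinM mulrC -expRD mulNr (mulrC c) subrr expR0.
by exists (probability_of_measure nu1) => f nf; rewrite nuE.
Qed.

End jump.

(** * The uniform measure on the sphere *)

Section derivatives.
Variable R : realType.
Implicit Types f g : R -> R.

Lemma is_derive1D f g (x a b : R) : is_derive x 1 f a -> is_derive x 1 g b ->
  is_derive x 1 (fun y => f y + g y) (a + b).
Proof. by move=> ? ?; exact: is_deriveD. Qed.

Lemma is_derive1M f g (x a b : R) : is_derive x 1 f a -> is_derive x 1 g b ->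
  is_derive x 1 (fun y => f y * g y) (f x * b + g x * a).
Proof. by move=> ? ?; exact: is_deriveM. Qed.

Lemma is_derive1_cst (x c : R) : is_derive x 1 (fun _ : R => c) 0.
Proof. exact: is_derive_cst. Qed.

Lemma is_derive1_id (x : R) : is_derive x 1 (fun y : R => y) 1.
Proof. exact: is_derive_id. Qed.

Lemma is_derive1_eq f (x a b : R) : is_derive x 1 f a -> a = b -> is_derive x 1 f b.
Proof. by move=> + <-. Qed.

Lemma is_derive1_continuous f : (forall x : R, exists d, is_derive x 1 f d) -> continuous f.
Proof.
move=> df x; have [d [dfx _]] := df x.
by apply: differentiable_continuous; apply/derivable1_diffP.
Qed.

Lemma FTC (F f : R -> R) (a b : R) : a < b -> (forall x : R, is_derive x 1 F (f x)) ->
  continuous f ->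
  (\int[lebesgue_measure]_(x in `[a, b]) (f x)%:E = (F b - F a)%:E)%E.
Proof.
move=> ab dF cf.
have cF : continuous F by apply: is_derive1_continuous => x; exists (f x).
rewrite (@continuous_FTC2 R f F)//.
- exact: continuous_subspaceT.
- split.
  + by move=> x _; case: (dF x).
  + exact/cvg_at_right_filter/cF.
  + exact/cvg_at_left_filter/cF.
- by move=> x _; rewrite derive1E; case: (dF x).
Qed.

End derivatives.

Ltac solve_derive := first
  [ notypeclasses refine (is_derive1_cst _ _)
  | notypeclasses refine (is_derive1_id _)
  | notypeclasses refine (is_derive_sin _) | notypeclasses refine (is_derive_cos _)
  | notypeclasses refine (is_derive1D _ _); [solve_derive|solve_derive]
  | notypeclasses refine (is_derive1M _ _); [solve_derive|solve_derive] ].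

Section sphere.
Variable R : realType.
Local Notation RR := (measurableTypeR R).
Local Notation lebm := (@lebesgue_measure R).

(** This form of integrand serves twice: [A = B = 0], [C = 1] gives the total mass of the sphere,
    and general coefficients give the second moment of a linear form. *)
Lemma integral_azimuth (A B C s : R) :
  (\int[lebm]_(ph in `[0%R, (2 * pi)%R]) (((A * cos ph + B * sin ph + C) ^+ 2 * s)%:E) =
   ((A ^+ 2 + B ^+ 2 + 2 * C ^+ 2) * pi * s)%:E)%E.
Proof.
have pi0 : 0 < pi :> R by exact: pi_gt0.
(* Primitive of the expanded square; [cos ^ 2] and [sin ^ 2] contribute [(x + sin x cos x) / 2] and
   [(x - sin x cos x) / 2]. *)
pose F (x : R) := s * (A * A * 2^-1 * (x + sin x * cos x) + B * B * 2^-1 * (x + (-1) * (sin x * cos x))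
  + C * C * x + A * B * (sin x * sin x) + 2 * A * C * sin x + (- (2 * B * C)) * cos x).
transitivity ((F (2 * pi) - F 0)%:E); last first.
  rewrite /F sin0 cos0 (_ : 2 * pi = pi + pi); last by ring.
  by rewrite sinD cosD sinpi cospi; congr (_%:E); field.
apply: FTC.
- by rewrite mulr_gt0.
- move=> x; rewrite /F; notypeclasses refine (is_derive1_eq _ _); first solve_derive.
  have := cos2Dsin2 x => cs.
  transitivity (s * ((A * A + B * B) * 2^-1 + A * A * 2^-1 * (cos x ^+ 2 - sin x ^+ 2)
     - B * B * 2^-1 * (cos x ^+ 2 - sin x ^+ 2) + C * C + 2 * A * B * sin x * cos x
     + 2 * A * C * cos x + 2 * B * C * sin x)); first by field.
  have -> : (A * A + B * B) * 2^-1 = (A * A + B * B) * 2^-1 * (cos x ^+ 2 + sin x ^+ 2).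
    by rewrite cs mulr1.
  by field.
- apply: is_derive1_continuous => x.
  rewrite (_ : (fun ph => _) = fun ph => (A * cos ph + B * sin ph + C) * (A * cos ph + B * sin ph + C) * s).
    by eexists; solve_derive.
  by apply/funext => y; rewrite expr2.
Qed.

Lemma integral_polar (a b : R) :
  (\int[lebm]_(th in `[0%R, (pi : R)]) ((a * sin th ^+ 3 + b * (sin th * cos th ^+ 2))%:E) =
   ((4 * a + 2 * b) / 3)%:E)%E.
Proof.
pose F (x : R) := a * ((-1) * cos x + 3^-1 * (cos x * (cos x * cos x)))
  + (- (b * 3^-1)) * (cos x * (cos x * cos x)).
transitivity ((F pi - F 0)%:E); last first.
  by rewrite /F cos0 cospi; congr (_%:E); field.
apply: FTC.
- exact: pi_gt0.
- move=> x; rewrite /F; notypeclasses refine (is_derive1_eq _ _); first solve_derive.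
  have cs := cos2Dsin2 x.
  transitivity (a * (sin x * (1 - cos x ^+ 2)) + b * (sin x * cos x ^+ 2)); first by field.
  by rewrite -cs addrAC subrr add0r; ring.
- apply: is_derive1_continuous => x.
  rewrite (_ : (fun th => _) = fun th => a * (sin th * (sin th * sin th)) + b * (sin th * (cos th * cos th))).
    by eexists; solve_derive.
  by apply/funext => y; rewrite !exprS expr0 !mulr1.
Qed.

Lemma angles_ex : {P : probability (R * R)%type R | forall h : R * R -> \bar R, nnm h ->
  ((4 * pi)^-1%:E * \int[lebm]_(th in `[0%R, (pi : R)]) \int[lebm]_(ph in `[0%R, (2 * pi)%R])
     (h (th, ph) * (sin th)%:E) = \int[P]_p h p)%E}.
Proof.
have pi0 : 0 < pi :> R by exact: pi_gt0.
pose D1 : set R := `[0%R, (pi : R)]%classic; pose D2 : set R := `[0%R, (2 * pi)%R]%classic.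
(* On [[0, pi]] the sine is nonnegative, so the absolute value changes nothing there; it makes the
   weight nonnegative on the whole plane. *)
pose w' (p : RR * RR) : R := \1_D1 p.1 * (\1_D2 p.2 * `|sin p.1|).
pose w (p : RR * RR) : R := (4 * pi)^-1 * w' p.
have m1 : measurable_fun [set: RR] (\1_D1 : RR -> R) by apply: measurable_indic; exact: measurable_itv.
have m2 : measurable_fun [set: RR] (\1_D2 : RR -> R) by apply: measurable_indic; exact: measurable_itv.
have msin : measurable_fun [set: RR] (fun x : RR => `|sin x| : R).
  apply: measurableT_comp => //.
  by apply: continuous_measurable_fun => x; exact: continuous_sin.
have mw' : measurable_fun setT w'.
  apply: measurable_funM.
    exact: (measurableT_comp m1 measurable_fst).
  apply: measurable_funM; first exact: (measurableT_comp m2 measurable_snd).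
  exact: (measurableT_comp msin measurable_fst).
have mw : measurable_fun setT w by exact: measurable_funM.
have k0 : 0 <= (4 * pi : R)^-1 by rewrite invr_ge0 mulr_ge0// ltW.
have w'0 p : 0 <= w' p by rewrite /w' !mulr_ge0 ?indic_ge0 ?normr_ge0.
have w0 p : 0 <= w p by rewrite mulr_ge0.
have mid : measurable_fun [set: RR * RR] (fun p : RR * RR => p : R * R) by exact: measurable_id.
have H := @mean_functional_integral _ (R * R)%type R _ (RR * RR)%type (lebm \x lebm)%E w
  (fun p => p) mw w0 mid.
have E (h : R * R -> \bar R) : nnm h ->
  ((4 * pi)^-1%:E * \int[lebm]_(th in D1) \int[lebm]_(ph in D2)
     (h (th, ph) * (sin th)%:E) = \int[(lebm \x lebm)]_p (h p * (w p)%:E))%E.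
  move=> nh.
  have nhw : nnm (fun p : RR * RR => h p * (w' p)%:E)%E.
    split=> [|p]; last by rewrite mule_ge0 ?nh.2 ?lee_fin.
    by apply: emeasurable_funM; [exact: nh.1|exact/measurable_EFinP].
  transitivity (\int[(lebm \x lebm)]_p ((4 * pi)^-1%:E * (h p * (w' p)%:E)))%E; last first.
    by apply: eq_integral => p _; rewrite /w EFinM muleCA.
  rewrite ge0_integralZl//; last 2 first.
  - exact: nhw.1.
  - by move=> p _; exact: nhw.2.
  apply: f_equal; rewrite (tonelli_prod _ nhw.1 nhw.2) integral_mkcond.
  apply: eq_integral => th _.
  rewrite patchE; case: ifPn => thD; last first.
    apply/esym; apply: integral0_eq => ph _.
    by rewrite /w'/= indicE (negbTE thD) mul0r mule0.
  have s0 : 0 <= sin th.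
    by have := set_mem thD; rewrite /D1/= in_itv/= => tp; exact: sin_ge0_pi.
  rewrite [LHS]integral_mkcond; apply: eq_integral => ph _.
  rewrite patchE /w'/= indicE thD mul1r indicE; case: ifPn => phD.
    by rewrite mul1r ger0_norm.
  by rewrite mul0r mule0.
have [P PE] : {P : probability (R * R)%type R | forall f, nnm f ->
    (\int[(lebm \x lebm)]_p (f p * (w p)%:E) = \int[P]_x f x)%E}.
  apply: mean_probabilityE => //.
  rewrite -E; last exact: nnm_cst.
  under eq_integral => th _.
    rewrite (_ : (\int[lebm]_(ph in D2) (1 * (sin th)%:E))%E =
      (\int[lebm]_(ph in `[0%R, (2 * pi)%R]) (((0 * cos ph + 0 * sin ph + 1) ^+ 2 * sin th)%:E))%E).
      rewrite integral_azimuth; over.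
    by apply: eq_integral => ph _; rewrite !mul0r !add0r expr1n mul1r mul1e.
  rewrite (_ : (\int[lebm]_(th in D1) _)%E = (\int[lebm]_(th in `[0%R, (pi : R)])
      ((2 * pi * sin th ^+ 3 + 2 * pi * (sin th * cos th ^+ 2))%:E))%E); last first.
    apply: eq_integral => th _; congr (_%:E).
    by transitivity (2 * pi * sin th * (cos th ^+ 2 + sin th ^+ 2)); [rewrite cos2Dsin2; ring|ring].
  rewrite integral_polar -EFinM; congr (_%:E).
  by move: (pi : R) pi0 => p p0; field; rewrite gt_eqF.
by exists P => h nh; rewrite -PE// -E.
Qed.

Definition angles : probability (R * R)%type R := sval angles_ex.

Lemma measurable_sph_pt : measurable_fun setT (fun p : R * R => sph_pt p.1 p.2).
Proof.
have ms : measurable_fun setT (@sin R).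
  by apply: continuous_measurable_fun => x; exact: continuous_sin.
have mc : measurable_fun setT (@cos R).
  by apply: continuous_measurable_fun => x; exact: continuous_cos.
have s1 := measurableT_comp ms (@measurable_fst _ _ R R).
have s2 := measurableT_comp ms (@measurable_snd _ _ R R).
have c1 := measurableT_comp mc (@measurable_fst _ _ R R).
have c2 := measurableT_comp mc (@measurable_snd _ _ R R).
exact: (measurable_trip3 (measurable_funM s1 c2) (measurable_funM s1 s2) c1).
Qed.

Lemma sphere_intE (h : V3 R -> \bar R) : nnm h ->
  sphere_int h = (\int[angles]_p h (sph_pt p.1 p.2))%E.
Proof.
move=> nh; rewrite -(svalP angles_ex (fun p => h (sph_pt p.1 p.2)))//.
exact: (nnm_comp nh measurable_sph_pt).
Qed.

(** The matrix [w w^T] averages to one third of the identity: this is the origin of the factor 1/3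
    in the exponent [mu / 3]. *)
Lemma sphere_second_moment (x : V3 R) :
  (\int[angles]_p ((dot3 (sph_pt p.1 p.2) x ^+ 2)%:E) = (dot3 x x / 3)%:E)%E.
Proof.
have pi0 : 0 < pi :> R by exact: pi_gt0.
have nd : nnm (fun w : V3 R => (dot3 w x ^+ 2)%:E).
  split=> [|w]; last by rewrite lee_fin sqr_ge0.
  apply/measurable_EFinP; apply: measurable_funX.
  by apply: measurable_dot3 => //; exact: measurable_cst.
rewrite -(sphere_intE nd) /sphere_int.
rewrite (_ : (\int[@leb R]_(th in _) _)%E = (\int[lebm]_(th in `[0%R, (pi : R)])
      ((pi * (cr x 0 ^+ 2 + cr x 1 ^+ 2) * sin th ^+ 3
        + 2 * pi * cr x 2 ^+ 2 * (sin th * cos th ^+ 2))%:E))%E); last first.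
  apply: eq_integral => th _.
  transitivity (\int[lebm]_(ph in `[0%R, (2 * pi)%R]) ((((cr x 0 * sin th) * cos ph
      + (cr x 1 * sin th) * sin ph + cr x 2 * cos th) ^+ 2 * sin th)%:E))%E.
    apply: eq_integral => ph _; rewrite -EFinM; congr (_%:E).
    by rewrite /dot3 /cr/=; ring.
  by rewrite integral_azimuth; congr (_%:E); ring.
rewrite integral_polar -EFinM; congr (_%:E); rewrite /dot3.
by move: (pi : R) pi0 => p p0; field; rewrite gt_eqF.
Qed.

End sphere.

(** * Collisions as random matrices *)

Section collisions.
Variables (R : realType) (K : nat).

Definition blk (z : Config R K) (k : 'I_K) : V3 R := tnth z k.
Definition actC (p : 'I_K * 'I_K) (u : R * R) (z : Config R K) : Config R K :=
  rcoll p.1 p.2 (sph_pt u.1 u.2) z.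

Lemma dot3_co (w x : V3 R) : dot3 w x = \sum_(l < 3) tnth w l * tnth x l.
Proof. by rewrite !big_ord_recr big_ord0/= add0r /dot3 /cr !(tnth_nth 0). Qed.

Lemma dot_blk (s z : Config R K) : dot s z = \sum_k dot3 (blk s k) (blk z k).
Proof.
rewrite /dot -(pair_bigA _ (fun i l => co s (i, l) * co z (i, l)))/=.
by apply: eq_bigr => k _; rewrite dot3_co.
Qed.

(** Minus the inner product of [z] with the vector [u] carrying [w] in block [i] and [- w] in block
    [j]. For unit [w], [u] has squared norm 2 and the collision is the reflection
    [z - (u . z) u]. *)
Definition coll_amp (i j : 'I_K) (w : V3 R) (z : Config R K) : R :=
  dot3 w (blk z j) - dot3 w (blk z i).

Lemma tnth_cr (x : V3 R) (l : 'I_3) : tnth x l = cr x l.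
Proof. by rewrite /cr (tnth_nth 0). Qed.

Lemma co_rcoll (i j : 'I_K) w (z : Config R K) k (l : 'I_3) : i != j ->
  co (rcoll i j w z) (k, l) =
  co z (k, l) + ((k == i)%:R - (k == j)%:R) * tnth w l * coll_amp i j w z.
Proof.
move=> ij; rewrite /co/= tnth_mktuple /coll_amp.
case: (eqVneq k i) => [->|ki].
  by rewrite tnth_cr proj_partE//= -!tnth_cr /blk (negbTE ij) mulr0n subr0 mul1r.
case: (eqVneq k j) => [->|kj].
  by rewrite tnth_cr proj_partE//= -!tnth_cr /blk mulr0n sub0r mulN1r mulNr -mulrN opprB.
by rewrite !mulr0n subrr !mul0r addr0.
Qed.

Lemma dot_rcoll (i j : 'I_K) w (s z : Config R K) : i != j ->
  dot s (rcoll i j w z) = dot s z - coll_amp i j w s * coll_amp i j w z.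
Proof.
move=> ij.
have E : coll_amp i j w s = - \sum_p co s p * (((p.1 == i)%:R - (p.1 == j)%:R) * tnth w p.2).
  rewrite -(pair_bigA _ (fun k l => co s (k, l) * (((k == i)%:R - (k == j)%:R) * tnth w l)))/=.
  transitivity (- \sum_k ((k == i)%:R - (k == j)%:R) * dot3 w (blk s k)).
    rewrite (eq_bigr (fun k => (k == i)%:R * dot3 w (blk s k) - (k == j)%:R * dot3 w (blk s k))).
      rewrite sumrB (bigD1 i)//= eqxx mul1r big1 ?addr0; last by move=> k /negbTE ->; rewrite mul0r.
      rewrite (bigD1 j)//= eqxx mul1r big1 ?addr0; last by move=> k /negbTE ->; rewrite mul0r.
      by rewrite /coll_amp opprB.
    by move=> k _; rewrite mulrBl.
  congr (- _); apply: eq_bigr => k _.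
  by rewrite dot3_co mulr_sumr; apply: eq_bigr => l _; rewrite /co/= /blk; ring.
rewrite E mulNr opprK mulr_suml -big_split; apply: eq_bigr => -[k l] _ /=.
by rewrite co_rcoll//=; ring.
Qed.

Lemma rcoll_sym (i j : 'I_K) w (s z : Config R K) : i != j ->
  dot (rcoll i j w s) z = dot s (rcoll i j w z).
Proof. by move=> ij; rewrite dotC !dot_rcoll// dotC mulrC. Qed.

Lemma dot3_sph_pt th ph : dot3 (sph_pt th ph : V3 R) (sph_pt th ph) = 1.
Proof.
rewrite /dot3 /cr/=.
transitivity (sin th ^+ 2 * (cos ph ^+ 2 + sin ph ^+ 2) + cos th ^+ 2); first by ring.
by rewrite cos2Dsin2 mulr1 addrC cos2Dsin2.
Qed.

Lemma blk_rcoll_l (i j : 'I_K) w (z : Config R K) :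
  blk (rcoll i j w z) i = proj_part w (blk z i) (blk z j).
Proof. by rewrite /blk tnth_mktuple eqxx. Qed.

Lemma blk_rcoll_r (i j : 'I_K) w (z : Config R K) : i != j ->
  blk (rcoll i j w z) j = proj_part w (blk z j) (blk z i).
Proof. by move=> ij; rewrite /blk tnth_mktuple eqxx eq_sym (negbTE ij). Qed.

Lemma blk_rcoll_o (i j : 'I_K) w (z : Config R K) k : k != i -> k != j ->
  blk (rcoll i j w z) k = blk z k.
Proof. by move=> ki kj; rewrite /blk tnth_mktuple (negbTE ki) (negbTE kj). Qed.

Lemma sq_proj_part (w x y : V3 R) : dot3 w w = 1 ->
  dot3 (proj_part w x y) (proj_part w x y) = dot3 x x - dot3 w x ^+ 2 + dot3 w y ^+ 2.
Proof.
move=> w1; rewrite {1}/dot3 !proj_partE//; set a := dot3 w y - dot3 w x.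
transitivity (dot3 x x + 2 * a * dot3 w x + a ^+ 2 * dot3 w w); first by rewrite /dot3; ring.
by rewrite w1 /a; ring.
Qed.

(* a collision with unit direction exchanges the energies along [w], so each weighted
   kinetic energy changes only through the two colliding particles *)
Definition wnorm (dd : 'I_K -> R) (z : Config R K) : R :=
  \sum_k dd k * dot3 (blk z k) (blk z k).

Lemma wnorm_rcoll dd (i j : 'I_K) w (z : Config R K) : i != j -> dot3 w w = 1 ->
  wnorm dd (rcoll i j w z) = wnorm dd z +
   (dd i - dd j) * (dot3 w (blk z j) ^+ 2 - dot3 w (blk z i) ^+ 2).
Proof.
move=> ij w1; rewrite /wnorm (bigD1 i)//= (bigD1 j)/= 1?eq_sym//.
rewrite [in RHS](bigD1 i)//= [in RHS](bigD1 j)/= 1?eq_sym//.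
rewrite blk_rcoll_l blk_rcoll_r// !sq_proj_part//.
rewrite (eq_bigr (fun k => dd k * dot3 (blk z k) (blk z k))); last first.
  by move=> k /andP[ki kj]; rewrite blk_rcoll_o.
ring.
Qed.

Lemma wnorm1 (z : Config R K) : wnorm (fun=> 1) z = sqnorm z.
Proof. by rewrite sqnorm_dot dot_blk; apply: eq_bigr => k _; rewrite mul1r. Qed.

Lemma gauss_rcoll (i j : 'I_K) th ph (z : Config R K) : i != j ->
  gauss (rcoll i j (sph_pt th ph) z) = gauss z.
Proof.
move=> ij; rewrite /gauss -!wnorm1 wnorm_rcoll ?dot3_sph_pt//.
by rewrite subrr mul0r addr0.
Qed.

Lemma measurable_actC p : measurable_fun setT (fun q : (R * R) * Config R K => actC p q.1 q.2).
Proof.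
have h := measurableT_comp (@measurable_sph_pt R) (@measurable_fst _ _ (R * R)%type (Config R K)).
exact: measurable_rcoll h measurable_snd.
Qed.

Lemma dot3_ge0 (x : V3 R) : 0 <= dot3 x x.
Proof. by rewrite !addr_ge0// -expr2 sqr_ge0. Qed.

Lemma wnorm_ge0 dd (z : Config R K) : (forall k, 0 <= dd k) -> 0 <= wnorm dd z.
Proof. by move=> d0; apply: sumr_ge0 => k _; rewrite mulr_ge0 ?dot3_ge0. Qed.

Lemma measurable_blk d (T : measurableType d) k (f : T -> Config R K) :
  measurable_fun setT f -> measurable_fun setT (fun x => blk (f x) k).
Proof. exact: (measurableT_comp (measurable_tnth k)). Qed.

Lemma measurable_wnorm d (T : measurableType d) dd (f : T -> Config R K) :
  measurable_fun setT f -> measurable_fun setT (fun x => wnorm dd (f x)).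
Proof.
move=> mf; apply: measurable_sum => k; apply: measurable_funM => //.
by apply: measurable_dot3; exact: measurable_blk.
Qed.

Lemma integral_wnorm_rcoll dd (p : 'I_K * 'I_K) (z : Config R K) :
  p.1 != p.2 -> (forall k, 0 <= dd k) ->
  (\int[angles R]_u (wnorm dd (actC p u z))%:E = (wnorm dd z +
   (dd p.1 - dd p.2) * (dot3 (blk z p.2) (blk z p.2) - dot3 (blk z p.1) (blk z p.1)) / 3)%:E)%E.
Proof.
case: p => i j /= ij d0.
pose a k := dot3 (blk z k) (blk z k).
pose q k (u : R * R) := dot3 (sph_pt u.1 u.2) (blk z k) ^+ 2.
have mq k : measurable_fun setT (q k).
  apply: measurable_funX; apply: measurable_dot3; last exact: measurable_cst.
  exact: measurable_sph_pt.
have nq c k : 0 <= c -> nnm (fun u => (c * q k u)%:E).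
  move=> c0; split=> [|u]; last by rewrite lee_fin mulr_ge0 ?sqr_ge0.
  by apply/measurable_EFinP; apply: measurable_funM.
have iq c k : 0 <= c -> (\int[angles R]_u (c * q k u)%:E = (c * (a k / 3))%:E)%E.
  move=> c0; under eq_integral do rewrite EFinM.
  rewrite ge0_integralZl ?lee_fin//; last 2 first.
  - exact/measurable_EFinP.
  - by move=> u _; rewrite lee_fin sqr_ge0.
  by rewrite (sphere_second_moment (blk z k)) -EFinM.
have nw : nnm (fun u => (wnorm dd (actC (i, j) u z))%:E).
  split=> [|u]; last by rewrite lee_fin wnorm_ge0.
  apply/measurable_EFinP; apply: measurable_wnorm.
  exact: (measurableT_comp (measurable_actC (i, j)) (measurable_pair2 z)).
have iD f g : nnm f -> nnm g ->
    (\int[angles R]_u (f u + g u) = \int[angles R]_u f u + \int[angles R]_u g u)%E.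
  move=> nf ng; rewrite ge0_integralD//; [by move=> x _; exact: nf.2|exact: nf.1|by move=> x _; exact: ng.2|exact: ng.1].
have wz0 : 0 <= wnorm dd z by exact: wnorm_ge0.
set J := (\int[angles R]_u _)%E.
(* The change of energy has no sign, so its negative terms are moved to the other side; every
   integral then has a nonnegative integrand. *)
have E : (J + ((dd i * (a i / 3))%:E + (dd j * (a j / 3))%:E) =
   (wnorm dd z)%:E + ((dd i * (a j / 3))%:E + (dd j * (a i / 3))%:E))%E.
  rewrite -!iq// -[(wnorm dd z)%:E](integral_prob_cst (angles R)).
  have nc : nnm (fun _ : R * R => (wnorm dd z)%:E) by exact: nnm_cst.
  have n1 := nnmD (nq _ i (d0 i)) (nq _ j (d0 j)).
  have n2 := nnmD (nq _ j (d0 i)) (nq _ i (d0 j)).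
  rewrite -(iD _ _ (nq _ i (d0 i)) (nq _ j (d0 j))) -(iD _ _ nw n1).
  rewrite -(iD _ _ (nq _ j (d0 i)) (nq _ i (d0 j))) -(iD _ _ nc n2).
  apply: eq_integral => u _; rewrite -!EFinD /actC/= wnorm_rcoll ?dot3_sph_pt//.
  by congr (_%:E); rewrite /q; ring.
have Jf : J \is a fin_num.
  move: E; case: J => [r| |]//=.
have [r Jr] : exists r, J = r%:E by exists (fine J); rewrite fineK.
move: E; rewrite Jr -!EFinD => -[E]; congr (_%:E).
rewrite -/(a i) -/(a j); apply: (addIr (dd i * (a i / 3) + dd j * (a j / 3))).
by rewrite E; ring.
Qed.

End collisions.

Lemma catc_parts (R : realType) M N (z : Config R (M + N)) : z = catc (vpart z) (wpart z).
Proof.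
apply: co_inj => -[i l]; rewrite -(splitK i); case: (fintype.split i) => j /=.
  by rewrite co_catl /co tnth_mktuple.
by rewrite co_catr /co tnth_mktuple.
Qed.

Lemma mean_sum d (T : measurableType d) (R : realType) (Phi : (T -> \bar R) -> \bar R)
  (I : Type) (s : seq I) (c : I -> R) (f : I -> T -> \bar R) :
  mean_functional Phi -> (forall i, 0 <= c i) -> (forall i, nnm (f i)) ->
  Phi (fun x => \sum_(i <- s) (c i)%:E * f i x)%E = (\sum_(i <- s) (c i)%:E * Phi (f i))%E.
Proof.
move=> PhiP c0 nf; elim: s => [|i s IH].
  rewrite big_nil (_ : (fun x => _) = fun x => (0%:E * 1)%E).
    by rewrite (meanZ PhiP)// ?mul0e//; exact: nnm_cst.
  by apply/funext => x; rewrite big_nil mul0e.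
rewrite big_cons -IH -(meanZ PhiP (c0 i) (nf i)) -(meanD PhiP).
- by congr Phi; apply/funext => x; rewrite big_cons.
- exact: nnmZ.
- by apply: nnm_sum => j; exact: nnmZ.
Qed.

Section matrices.
Variables (R : realType) (M K : nat).

(* an [M]-particle-valued linear map of [K]-particle configurations, stored by rows *)
Definition Mat := (M.-tuple (3.-tuple (Config R K)))%type.
Definition row (S : Mat) (q : 'I_M * 'I_3) : Config R K := tnth (tnth S q.1) q.2.
Definition appM (S : Mat) (z : Config R K) : Config R M := mkC (fun q => dot (row S q) z).
(** Right multiplication of [S] by the collision matrix, which is symmetric and can therefore be
    applied to the rows. *)
Definition actM (p : 'I_K * 'I_K) (u : R * R) (S : Mat) : Mat :=
  [tuple [tuple actC p u (row S (k, l)) | l < 3] | k < M].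
Definition adjM (S : Mat) (V : Config R M) : Config R K :=
  mkC (fun q => \sum_p co V p * co (row S p) q).

Lemma row_actM p u S q : row (actM p u S) q = actC p u (row S q).
Proof. by case: q => k l; rewrite /row !tnth_mktuple. Qed.

Lemma measurable_row d (T : measurableType d) q (f : T -> Mat) :
  measurable_fun setT f -> measurable_fun setT (fun x => row (f x) q).
Proof.
move=> mf; apply: (measurableT_comp (measurable_tnth q.2)).
exact: (measurableT_comp (measurable_tnth q.1)).
Qed.

Lemma measurable_actM p : measurable_fun setT (fun q : (R * R) * Mat => actM p q.1 q.2).
Proof.
apply/measurable_fun_tnthP => k; apply/measurable_fun_tnthP => l.
rewrite (_ : _ \o _ = (fun q : (R * R) * Config R K => actC p q.1 q.2) \o
  (fun q : (R * R) * Mat => (q.1, row q.2 (k, l)))).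
  apply: (measurableT_comp (measurable_actC p)).
  by apply: measurable_fun_pair => //; exact: measurable_row.
by apply/funext => q /=; rewrite !tnth_mktuple.
Qed.

Lemma measurable_appM d (T : measurableType d) (f : T -> Mat) (g : T -> Config R K) :
  measurable_fun setT f -> measurable_fun setT g ->
  measurable_fun setT (fun x => appM (f x) (g x)).
Proof.
move=> mf mg; apply: measurable_mkC => q.
by apply: measurable_dot => //; exact: measurable_row.
Qed.

Lemma appM_actM p u S z : p.1 != p.2 -> appM (actM p u S) z = appM S (actC p u z).
Proof.
move=> pp; apply: co_inj => q; rewrite !co_mkC row_actM.
exact: rcoll_sym.
Qed.

Lemma appMD S z z' : appM S (addc z z') = addc (appM S z) (appM S z').
Proof. by apply: co_inj => q; rewrite co_addc !co_mkC dotDr. Qed.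

Lemma appMZ S a z : appM S (sclc a z) = sclc a (appM S z).
Proof. by apply: co_inj => q; rewrite co_sclc !co_mkC dotZr. Qed.

Lemma dot_adjM S V z : dot (adjM S V) z = dot V (appM S z).
Proof.
rewrite /dot; under eq_bigr do rewrite co_mkC mulr_suml.
rewrite exchange_big/=; apply: eq_bigr => p _; rewrite co_mkC mulr_sumr.
by apply: eq_bigr => q _; rewrite mulrA.
Qed.

Lemma dot_inj (x y : Config R K) : (forall z, dot x z = dot y z) -> x = y.
Proof.
move=> xy; apply: co_inj => p.
have := xy (mkC (fun q => (q == p)%:R)).
rewrite /dot (bigD1 p)//= [in RHS](bigD1 p)//= !big1.
- by rewrite !co_mkC eqxx !mulr1 !addr0.
- by move=> q /negbTE qp; rewrite co_mkC qp mulr0.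
- by move=> q /negbTE qp; rewrite co_mkC qp mulr0.
Qed.

Lemma adjM_actM p u S V : p.1 != p.2 -> adjM (actM p u S) V = actC p u (adjM S V).
Proof.
by move=> pp; apply: dot_inj => z; rewrite dot_adjM appM_actM// rcoll_sym// dot_adjM.
Qed.

Lemma measurable_adjM d (T : measurableType d) (f : T -> Mat) V :
  measurable_fun setT f -> measurable_fun setT (fun x => adjM (f x) V).
Proof.
move=> mf; apply: measurable_mkC => q; apply: measurable_sum => p.
by apply: measurable_funM => //; apply: measurable_co; exact: measurable_row.
Qed.

End matrices.

Section kac.
Variables (R : realType) (M N : nat) (lamS lamR mu : R).
Hypotheses (lamS0 : 0 < lamS) (lamR0 : 0 < lamR) (mu0 : 0 < mu).
Local Notation K := (M + N)%N.
Local Notation rate := (@rate R M N lamS lamR mu).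

(** Extended by 0 to the remaining ordered pairs, so that sums run over a whole finite type; a
    positive rate then forces two distinct particles. *)
Definition rp (p : 'I_K * 'I_K) : R := if (p.1 < p.2)%N then rate p.1 p.2 else 0.

Lemma rp_ge0 p : 0 <= rp p.
Proof.
rewrite /rp; case: ifP => // _; rewrite /Defs.rate.
by do 2?case: ifP => _; rewrite divr_ge0// ltW.
Qed.

Lemma rp_gt0_neq p : 0 < rp p -> p.1 != p.2.
Proof.
rewrite /rp; case: ifP => [lt _|]; last by rewrite ltxx.
by apply/eqP => e; rewrite e ltnn in lt.
Qed.

Lemma ctotE : @ctot R M N lamS lamR mu = \sum_p rp p.
Proof.
rewrite /ctot; under eq_bigr do rewrite big_mkcond.
by rewrite pair_bigA; apply: eq_bigr => -[].
Qed.

Definition jumpC := jump (angles R) rp (@actC R K).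
Definition jumpM := jump (angles R) rp (@actM R M K).

Let Z := Config R K.

Lemma Aop_jump (F : Z -> \bar R) : nnm F -> @Aop R M N lamS lamR mu F = jumpC F.
Proof.
move=> nF; apply/funext => z; rewrite /Aop /jumpC /jump.
under eq_bigr do rewrite big_mkcond.
rewrite pair_bigA; apply: eq_bigr => -[i j] _ /=.
rewrite /rp/=; case: ifP => ij; last by rewrite mul0e.
rewrite /Rij sphere_intE//; apply: (nnm_comp nF).
by apply: measurable_rcoll => //; exact: measurable_cst.
Qed.

Lemma iter_Aop n (F : Z -> \bar R) : nnm F ->
  iter n (@Aop R M N lamS lamR mu) F = iter n jumpC F.
Proof.
move=> nF; elim: n => //= n ->; apply: Aop_jump.
exact: (nnm_iter_jump (angles R) rp_ge0 (@measurable_actC R K)).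
Qed.

Lemma iter_jumpC_gauss n (F : Z -> \bar R) z : nnm F ->
  (iter n jumpC (fun z => (gauss z)%:E * F z) z = (gauss z)%:E * iter n jumpC F z)%E.
Proof.
move=> nF; elim: n z => //= n IH z.
rewrite {1}/jumpC {1}/jump [in RHS]/jumpC [in RHS]/jump.
have nI := nnm_iter_jump (angles R) rp_ge0 (@measurable_actC R K) n nF.
rewrite ge0_sume_distrr; last first.
  move=> p _; rewrite mule_ge0 ?lee_fin ?rp_ge0//.
  by apply: integral_ge0 => u _; exact: nI.2.
apply: eq_bigr => p _; rewrite muleCA.
have [r0|] := boolP (0 < rp p); last first.
  by rewrite lt_neqAle rp_ge0 andbT negbK => /eqP <-; rewrite !mul0e.
congr (_ * _)%E.
have nA := nnm_act (@measurable_actC R K) p z nI.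
rewrite -ge0_integralZl ?lee_fin ?ltW ?gauss_gt0//; last 2 first.
- exact: nA.1.
- by move=> u _; exact: nA.2.
apply: eq_integral => u _; rewrite IH; congr (_%:E * _)%E.
by apply: gauss_rcoll; exact: rp_gt0_neq.
Qed.

(** Moving the collisions from the point to the matrix reverses their order: the first jump of [z]
    is the last jump of [S]. Hence [iterSr], followed by the exchange of the average over [u] with
    the remaining [n] jumps. *)
Lemma iter_jumpCM n (h : Config R M -> \bar R) S z : nnm h ->
  iter n jumpC (fun z => h (appM S z)) z = iter n jumpM (fun S => h (appM S z)) S.
Proof.
move=> nh; pose Psi z S := h (@appM R M K S z).
have nPsi : nnm (fun p : Z * Mat R M K => Psi p.1 p.2).
  apply: (nnm_comp nh); exact: (measurable_appM measurable_snd measurable_fst).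
elim: n z => //= n IH z.
transitivity (iter n jumpM (jumpM (Psi z)) S); last by rewrite -iterSr.
have nu p : nnm (fun q : (R * R) * Mat R M K => Psi (actC p q.1 z) q.2).
  have m1 : measurable_fun setT (fun u : R * R => actC p u z).
    exact: (measurableT_comp (measurable_actC p) (measurable_pair2 z)).
  apply: (nnm_comp nPsi (f := fun q : (R * R) * Mat R M K => (actC p q.1 z, q.2))).
  by apply: measurable_fun_pair => //; exact: (measurableT_comp m1 measurable_fst).
have nI p : nnm (fun S => \int[angles R]_u Psi (actC p u z) S)%E.
  apply: (@nnm_integral _ _ _ _ _ (angles R) (fun S u => Psi (actC p u z) S)).
  exact: (nnm_comp (nu p) (@measurable_swap _ _ _ _)).
have -> : jumpM (Psi z) =
   (fun S => \sum_p (rp p)%:E * \int[angles R]_u Psi (actC p u z) S)%E.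
  apply/funext => S'; apply: eq_bigr => p _.
  have [r0|] := boolP (0 < rp p); last first.
    by rewrite lt_neqAle rp_ge0 andbT negbK => /eqP <-; rewrite !mul0e.
  congr (_ * _)%E; apply: eq_integral => u _.
  by rewrite /Psi -appM_actM// rp_gt0_neq.
have H := mean_functional_iter_jump (angles R) rp_ge0 (@measurable_actM R M K) n S.
rewrite (mean_sum _ H rp_ge0 nI); apply: eq_bigr => p _; congr (_ * _)%E.
rewrite (iter_jump_integral (angles R) rp_ge0 (@measurable_actM R M K) (angles R) n S (nu p)).
by apply: eq_integral => u _; rewrite IH.
Qed.

Definition S0 : Mat R M K :=
  [tuple [tuple mkC (fun q => (q == (lshift N k, l))%:R) | l < 3] | k < M].

Lemma row_S0 k l : row S0 (k, l) = mkC (fun q => (q == (lshift N k, l))%:R).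
Proof. by rewrite /row !tnth_mktuple. Qed.

Lemma appM_S0 z : appM S0 z = vpart z.
Proof.
apply: co_inj => -[k l]; rewrite co_mkC row_S0 /dot (bigD1 (lshift N k, l))//= big1.
  by rewrite co_mkC eqxx mul1r addr0 /co/= tnth_mktuple.
by move=> q /negbTE qp; rewrite co_mkC qp mul0r.
Qed.

Lemma vpart_catc (v : Config R M) (w : Config R N) : vpart (catc v w) = v.
Proof.
apply: eq_from_tnth => i; rewrite tnth_mktuple.
by apply: eq_from_tnth => l; exact: (co_catl v w i l).
Qed.

Lemma adjM_S0 V : adjM S0 V = catc V (mkC (fun=> 0)).
Proof.
apply: dot_inj => z; rewrite dot_adjM appM_S0.
rewrite (catc_parts z) dot_cat [X in _ = _ + X](_ : _ = 0).
  by rewrite addr0 vpart_catc.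
by apply: big1 => p _; rewrite co_mkC mul0r.
Qed.

(* Collisions preserve this property, so the law nu below lives on it; but it is not known
   to be a measurable set, hence nu_le and nu_eq instead of almost sure statements. *)
Definition Good (S : Mat R M K) := forall F, nnm F ->
  (\int[gam R K]_z F (appM S z) = \int[gam R M]_x F x)%E.

Lemma Good_S0 : Good S0.
Proof.
move=> F nF.
have nS : nnm (fun z => F (appM S0 z)).
  by apply: (nnm_comp nF); apply: measurable_appM => //; exact: measurable_cst.
rewrite (integral_gam_cat nS); apply: eq_integral => v _.
rewrite -[RHS](integral_prob_cst (gam R N)); apply: eq_integral => w _.
by rewrite appM_S0 vpart_catc.
Qed.

Lemma Good_actM p u S : 0 < rp p -> Good S -> Good (actM p u S).
Proof.
move=> r0 gS F nF; have pp := rp_gt0_neq r0.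
have nS : nnm (fun z => F (appM S z)).
  by apply: (nnm_comp nF); apply: measurable_appM => //; exact: measurable_cst.
rewrite -(gS F nF) -(gam_collision u.1 u.2 pp nS).
by apply: eq_integral => z _; rewrite appM_actM.
Qed.

End kac.

(** * Law of the random matrix, representation of the solution, second moment *)

Section law.
Variables (R : realType) (M N : nat) (lamS lamR mu : R).
Hypotheses (lamS0 : 0 < lamS) (lamR0 : 0 < lamR) (mu0 : 0 < mu).
Local Notation K := (M + N)%N.
Local Notation rp := (@rp R M N lamS lamR mu).
Local Notation jumpM := (@jumpM R M N lamS lamR mu).
Local Notation jumpC := (@jumpC R M N lamS lamR mu).
Local Notation c := (\sum_p rp p).
Let rp0 := @rp_ge0 R M N lamS lamR mu lamS0 lamR0 mu0.

(* The law of the random matrix after the Poisson number of collisions up to time t. *)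
Definition nu (t : R) (t0 : 0 <= t) : probability (Mat R M K) R :=
  sval (exp_jump_law (angles R) rp0 (@measurable_actM R M K) (S0 R M N) t0).

Lemma nuE (t : R) (t0 : 0 <= t) Psi : nnm Psi ->
  ((expR (- c * t))%:E *
    (\sum_(n <oo) (t ^+ n / (n`!)%:R)%:E * iter n jumpM Psi (S0 R M N)) =
    \int[nu t0]_S Psi S)%E.
Proof.
exact: (svalP (exp_jump_law (angles R) rp0 (@measurable_actM R M K) (S0 R M N) t0)).
Qed.

Lemma nu_le (t : R) (t0 : 0 <= t) (Psi1 Psi2 : Mat R M K -> \bar R) :
  nnm Psi1 -> nnm Psi2 -> (forall S, Good S -> Psi1 S <= Psi2 S)%E ->
  (\int[nu t0]_S Psi1 S <= \int[nu t0]_S Psi2 S)%E.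
Proof.
move=> n1 n2 le12; rewrite -!nuE//; apply: lee_wpmul2l.
  by rewrite lee_fin expR_ge0.
apply: lee_nneseries => n _.
  rewrite mule_ge0 ?lee_fin ?divr_ge0 ?exprn_ge0//.
  exact: (nnm_iter_jump (angles R) rp0 (@measurable_actM R M K) n n1).2.
apply: lee_wpmul2l; first by rewrite lee_fin divr_ge0 ?exprn_ge0.
apply: (iter_jump_le (angles R) rp0 (@measurable_actM R M K) (Q := @Good R M N)) => //.
- by move=> i u S; exact: Good_actM.
- exact: Good_S0.
Qed.

Lemma nu_eq (t : R) (t0 : 0 <= t) (Psi1 Psi2 : Mat R M K -> \bar R) :
  nnm Psi1 -> nnm Psi2 -> (forall S, Good S -> Psi1 S = Psi2 S)%E ->
  (\int[nu t0]_S Psi1 S = \int[nu t0]_S Psi2 S)%E.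
Proof.
by move=> n1 n2 e; apply/eqP; rewrite eq_le !nu_le// => S GS; rewrite e.
Qed.

Section representation.
Variable f0 : Config R M -> R.
Hypotheses (mf0 : measurable_fun setT f0) (f00 : forall v, 0 <= f0 v).

Definition hdens (v : Config R M) : \bar R := (f0 v / gauss v)%:E.

Lemma measurable_gaussV k : measurable_fun setT (fun z : Config R k => (gauss z)^-1).
Proof.
rewrite (_ : (fun x => _) = (fun z => expR (pi * sqnorm z))); last first.
  by apply/funext => x; rewrite /gauss mulNr expRN invrK.
apply: measurableT_comp => //; apply: measurable_funM => //.
exact: measurable_sqnorm.
Qed.

Lemma nnm_hdens : nnm hdens.
Proof.
split=> [|v]; last by rewrite lee_fin divr_ge0// ltW ?gauss_gt0.
by apply/measurable_EFinP; apply: measurable_funM => //; exact: measurable_gaussV.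
Qed.

Lemma expLt_F0 (t : R) (t0 : 0 <= t) z :
  (@expLt R M N lamS lamR mu t (@F0 R M N f0) z =
   (gauss z)%:E * \int[nu t0]_S hdens (appM S z))%E.
Proof.
have nh := nnm_hdens.
have nhS S : nnm (fun z : Config R K => hdens (appM S z)).
  by apply: (nnm_comp nh); apply: measurable_appM => //; exact: measurable_cst.
have nhz : nnm (fun S : Mat R M K => hdens (appM S z)).
  by apply: (nnm_comp nh); apply: measurable_appM => //; exact: measurable_cst.
have F0E : @F0 R M N f0 = fun z => ((gauss z)%:E * hdens (appM (S0 R M N) z))%E.
  apply/funext => y; rewrite appM_S0 /F0 /hdens -EFinM; congr (_%:E).
  have -> : gauss y = gauss (vpart y) * gauss (wpart y) by rewrite [in LHS](catc_parts y) gauss_cat.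
  have := gauss_gt0 (vpart y); move: (gauss (vpart y)) => a a0.
  by field; rewrite gt_eqF.
have nF : nnm (@F0 R M N f0).
  rewrite F0E; split=> [|y]; last first.
    by rewrite mule_ge0 ?(nhS _).2// lee_fin ltW ?gauss_gt0.
  apply: emeasurable_funM; last exact: (nhS _).1.
  by apply/measurable_EFinP; exact: measurable_gauss.
have ni n : (0 <= iter n jumpM (fun S => hdens (appM S z)) (S0 R M N))%E.
  exact: (nnm_iter_jump (angles R) rp0 (@measurable_actM R M K) n nhz).2.
rewrite /expLt -nuE// ctotE muleCA; congr (_ * _)%E.
rewrite -nneseriesZl; last first.
  by move=> n _; rewrite mule_ge0 ?lee_fin ?divr_ge0 ?exprn_ge0.
apply: eq_eseriesr => n _.
rewrite iter_Aop// F0E iter_jumpC_gauss// muleCA; congr (_ * (_ * _))%E.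
exact: iter_jumpCM.
Qed.

Lemma marginal_F0 (t : R) (t0 : 0 <= t) v :
  (marginal (@expLt R M N lamS lamR mu t (@F0 R M N f0)) v =
   (gauss v)%:E * \int[nu t0]_S \int[gam R N]_w hdens (appM S (catc v w)))%E.
Proof.
rewrite /marginal.
have nh : nnm (fun q : Config R N * Mat R M K => hdens (appM q.2 (catc v q.1))).
  apply: (nnm_comp nnm_hdens); apply: measurable_appM => //.
  by apply: measurable_catc => //; exact: measurable_cst.
have nw : nnm (fun w : Config R N => \int[nu t0]_S hdens (appM S (catc v w)))%E.
  exact: (nnm_integral _ (f := fun w S => hdens (appM S (catc v w))) nh).
have nw' := nnmZ (ltW (gauss_gt0 v)) nw.
transitivity (intC (fun w : Config R N =>
    ((gauss v)%:E * \int[nu t0]_S hdens (appM S (catc v w))) * (gauss w)%:E)%E).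
  congr intC; apply/funext => w.
  rewrite -[[tuple of v ++ w]]/(catc v w) expLt_F0 gauss_cat EFinM.
  by rewrite muleAC.
rewrite (intC_gam nw') ge0_integralZl ?lee_fin ?ltW ?gauss_gt0//; last 2 first.
- exact: nw.1.
- by move=> w _; exact: nw.2.
by rewrite (tonelliP (fun w S => hdens (appM S (catc v w))) nh).
Qed.

End representation.

Section second_moment.
Hypotheses (M0 : (0 < M)%N) (MN : (M <= N)%N).

(* Energy weights constant on each of the two groups form a space stable under collisions;
   on it the generator is a 2 x 2 matrix with eigenvalues 0 and -(mu/3)(N+M)/N. *)
Definition two (x y : R) (k : 'I_K) : R := if (k < M)%N then x else y.
Let bv (z : Config R K) := \sum_(i < M) dot3 (blk z (lshift N i)) (blk z (lshift N i)).
Let bw (z : Config R K) := \sum_(j < N) dot3 (blk z (rshift M j)) (blk z (rshift M j)).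

Lemma two_l x y i : two x y (lshift N i) = x.
Proof. by rewrite /two /= ltn_ord. Qed.
Lemma two_r x y j : two x y (rshift M j) = y.
Proof. by rewrite /two /= ltnNge leq_addr. Qed.

Let wnorm_two x y z : wnorm (two x y) z = x * bv z + y * bw z.
Proof.
rewrite /wnorm big_split_ord/=; congr (_ + _).
  by rewrite mulr_sumr; apply: eq_bigr => i _; rewrite two_l.
by rewrite mulr_sumr; apply: eq_bigr => i _; rewrite two_r.
Qed.

Let rp_lr (i : 'I_M) (j : 'I_N) : rp (lshift N i, rshift M j) = mu / N%:R.
Proof.
rewrite /rp/= (leq_trans (ltn_ord i) (leq_addr _ _)) /Defs.rate/=.
by rewrite ltnNge leq_addr/= leqNgt ltn_ord.
Qed.

Let rp_rl (i : 'I_M) (j : 'I_N) : rp (rshift M j, lshift N i) = 0.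
Proof. by rewrite /rp/= ltnNge ltnW// (leq_trans (ltn_ord i) (leq_addr _ _)). Qed.

Let sum_pairs (G : 'I_K * 'I_K -> R) : \sum_p G p =
  \sum_(i < M) (\sum_(j < M) G (lshift N i, lshift N j) + \sum_(j < N) G (lshift N i, rshift M j))
  + \sum_(i < N) (\sum_(j < M) G (rshift M i, lshift N j) + \sum_(j < N) G (rshift M i, rshift M j)).
Proof.
transitivity (\sum_(i < K) \sum_(j < K) G (i, j)).
  by rewrite pair_bigA; apply: eq_bigr => -[].
rewrite big_split_ord/=; by congr (_ + _); apply: eq_bigr => i _; rewrite big_split_ord.
Qed.

Let sum_cst n (x : R) : \sum_(i < n) x = n%:R * x.
Proof. by rewrite sumr_const card_ord mulr_natl. Qed.

Let N0 : 0 < N%:R :> R.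
Proof. by rewrite ltr0n (leq_trans M0). Qed.

Let lam : R := (mu / 3) * ((N + M)%:R / N%:R).

(** Keeps [c - lam] nonnegative, so that its exponential series has nonnegative terms. The cross
    rates alone give [c >= mu M >= mu], and [M <= N] gives [(N + M) / N <= 2], hence
    [lam <= 2 mu / 3]. *)
Let c_ge : lam <= c.
Proof.
have M1 : 1 <= M%:R :> R by rewrite (ler_nat _ 1).
have MNr : M%:R <= N%:R :> R by rewrite ler_nat.
have : mu * M%:R <= c.
  rewrite sum_pairs -[leLHS]addr0; apply: lerD.
    have -> : mu * M%:R = \sum_(i < M) (\sum_(j < M) 0 + \sum_(j < N) (mu / N%:R)).
      by rewrite !sum_cst mulr0 add0r; field; rewrite gt_eqF.
    apply: ler_sum => i _; apply: lerD; first by apply: ler_sum => j _; exact: rp0.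
    by apply: ler_sum => j _; rewrite rp_lr.
  by apply: sumr_ge0 => i _; apply: addr_ge0; apply: sumr_ge0 => j _; exact: rp0.
apply: le_trans; rewrite /lam.
have h : (N + M)%:R / N%:R <= 2 :> R.
  by rewrite ler_pdivrMr// natrD; lra.
have h1 : mu / 3 * ((N + M)%:R / N%:R) <= mu / 3 * 2.
  by rewrite ler_pM2l// divr_gt0.
have h2 : mu <= mu * M%:R by rewrite ler_peMr// ltW.
have : 0 < mu by []. lra.
Qed.

Let jump_two x y V S : 0 <= x -> 0 <= y ->
  jumpM (fun S => (wnorm (two x y) (adjM S V))%:E) S =
  (wnorm (two (c * x - mu / 3 * (x - y)) (c * y + mu * M%:R / (3 * N%:R) * (x - y)))
     (adjM S V))%:E.
Proof.
move=> x0 y0; have two0 k : 0 <= two x y k by rewrite /two; case: ifP.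
set z := adjM S V; pose b k := dot3 (blk z k) (blk z k).
transitivity (\sum_p (rp p * (wnorm (two x y) z +
   (two x y p.1 - two x y p.2) * (b p.2 - b p.1) / 3))%:E)%E.
  apply: eq_bigr => p _.
  have [r0|] := boolP (0 < rp p); last first.
    by rewrite lt_neqAle rp0 andbT negbK => /eqP <-; rewrite mul0e mul0r.
  have pp := rp_gt0_neq r0.
  rewrite EFinM -(integral_wnorm_rcoll z pp two0); congr (_ * _)%E.
  by apply: eq_integral => u _; rewrite adjM_actM.
rewrite sumEFin; congr (_%:E).
under eq_bigr do rewrite mulrDr.
rewrite big_split/= -mulr_suml (sum_pairs (fun p => rp p * _)) !wnorm_two.
(* Only cross pairs matter: within a group the two weights agree, and pairs in decreasing order have
   rate 0. *)
rewrite [X in _ + (_ + X)]big1 ?addr0; last first.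
  move=> i _; rewrite !big1 ?addr0//= => j _.
    by rewrite !two_r subrr !mul0r mulr0.
  by rewrite rp_rl mul0r.
rewrite (eq_bigr (fun i => \sum_(j < N) (mu / N%:R / 3 * (x - y) * (b (rshift M j) - b (lshift N i))))); last first.
  move=> i _; rewrite big1 ?add0r/=; last by move=> j _; rewrite !two_l subrr !mul0r mulr0.
  by apply: eq_bigr => j _; rewrite two_l two_r rp_lr; ring.
under eq_bigr do rewrite -mulr_sumr sumrB.
rewrite -mulr_sumr sumrB -/(bw z).
rewrite sum_cst.
rewrite (_ : \sum_(i < M) \sum_(i0 < N) b (lshift N i) = N%:R * bv z); last first.
  rewrite mulr_sumr; apply: eq_bigr => j _.
  by rewrite sum_cst.
by field; rewrite gt_eqF.
Qed.

(** Coordinates of the [n]-th iterate of [(1, 0)], decomposed on the eigenvectors [(1, 1)] and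
    [(N, - M)] with eigenvalues [c] and [c - lam]. *)
Let xs n := (M%:R * c ^+ n + N%:R * (c - lam) ^+ n) / (N + M)%:R.
Let ys n := (M%:R * (c ^+ n - (c - lam) ^+ n)) / (N + M)%:R.
Let NM0 : 0 < (N + M)%:R :> R.
Proof. by rewrite ltr0n addn_gt0 M0 orbT. Qed.
Let c0 : 0 <= c. Proof. by apply: sumr_ge0 => p _. Qed.
Let lam0 : 0 <= lam. Proof. by rewrite /lam mulr_ge0// divr_ge0// ltW. Qed.
Let xs0 n : 0 <= xs n.
Proof.
by rewrite divr_ge0 ?(ltW NM0)// addr_ge0// mulr_ge0// exprn_ge0// subr_ge0.
Qed.
Let ys0 n : 0 <= ys n.
Proof.
rewrite divr_ge0 ?(ltW NM0)// mulr_ge0// subr_ge0 lerXn2r// ?nnegrE ?subr_ge0//.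
by rewrite gerBl.
Qed.

Let iter_two n V S : iter n jumpM (fun S => (wnorm (two 1 0) (adjM S V))%:E) S =
  (wnorm (two (xs n) (ys n)) (adjM S V))%:E.
Proof.
elim: n S => [|n IH] S /=.
  congr ((wnorm (two _ _) _)%:E); rewrite /xs /ys !expr0.
    by rewrite !mulr1 -natrD addnC divff// gt_eqF.
  by rewrite subrr mulr0 mul0r.
rewrite (_ : iter n jumpM _ = fun S => (wnorm (two (xs n) (ys n)) (adjM S V))%:E); last first.
  by apply/funext => S'; exact: IH.
rewrite jump_two//; congr ((wnorm (two _ _) _)%:E).
  rewrite /xs /ys /lam !exprS; move: (c) => k; move: NM0 N0.
  rewrite natrD => h1 h2.
  by field; rewrite !gt_eqF.
rewrite /xs /ys /lam !exprS; move: (c) => k; move: NM0 N0.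
rewrite natrD => h1 h2.
by field; rewrite !gt_eqF.
Qed.

Definition kappa (t : R) : R :=
  M%:R / (N + M)%:R + N%:R / (N + M)%:R * expR (- (mu / 3) * ((N + M)%:R / N%:R) * t).

(** Under the normalization [exp (- c t)] the eigenvalues [c] and [c - lam] turn into [1] and
    [exp (- lam t)], the two terms of [kappa]. *)
Lemma nu_second_moment (t : R) (t0 : 0 <= t) V :
  (\int[nu t0]_S (wnorm (two 1 0) (adjM S V))%:E = (kappa t * sqnorm V)%:E)%E.
Proof.
have nP : nnm (fun S : Mat R M K => (wnorm (two 1 0) (adjM S V))%:E).
  split=> [|S]; last first.
    by rewrite lee_fin wnorm_ge0// => k; rewrite /two; case: ifP.
  by apply/measurable_EFinP; apply: measurable_wnorm; exact: measurable_adjM.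
rewrite -nuE//.
have bV : wnorm (two 1 0) (adjM (S0 R M N) V) = sqnorm V.
  rewrite wnorm_two mul0r mul1r addr0 adjM_S0 sqnorm_dot dot_blk.
  apply: eq_bigr => i _; rewrite !dot3_co; apply: eq_bigr => l _.
  by have := co_catl V (mkC (fun=> 0) : Config R N) i l; rewrite /co/= /blk => ->.
have bW : bw (adjM (S0 R M N) V) = 0.
  rewrite /bw adjM_S0 big1// => i _; rewrite dot3_co big1// => l _.
  have := co_catr V (mkC (fun=> 0) : Config R N) i l; rewrite co_mkC /co/= /blk => ->.
  by rewrite mul0r.
have bV' : bv (adjM (S0 R M N) V) = sqnorm V.
  by rewrite -bV wnorm_two mul0r mul1r addr0.
have V0 := sqnorm_ge0 V.
have NMn : 0 <= (N + M)%:R^-1 :> R by rewrite invr_ge0 ltW.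
rewrite (eq_eseriesr (g := fun n => (sqnorm V * ((N + M)%:R)^-1)%:E *
    (M%:R%:E * ((t * c) ^+ n / (n`!)%:R)%:E + N%:R%:E * ((t * (c - lam)) ^+ n / (n`!)%:R)%:E))%E); last first.
  move=> n _; rewrite iter_two wnorm_two bW bV' mulr0 addr0 -!EFinM; congr (_%:E).
  by rewrite /xs !exprMn; ring.
have cl0 : 0 <= c - lam by rewrite subr_ge0.
have e0 a n : 0 <= a -> (0 <= ((t * a) ^+ n / (n`!)%:R)%:E)%E.
  by move=> a0; rewrite lee_fin divr_ge0// exprn_ge0// mulr_ge0.
rewrite nneseriesZl; last first.
  by move=> n _; rewrite adde_ge0// mule_ge0 ?e0// lee_fin.
rewrite nneseriesD; [|by move=> n _ _; rewrite mule_ge0 ?e0// lee_fin|by move=> n _ _; rewrite mule_ge0 ?e0// lee_fin].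
rewrite !nneseriesZl; [|by move=> n _; exact: e0|by move=> n _; exact: e0].
rewrite !nneseries_exp ?mulr_ge0// -?EFinM; congr (_%:E).
have e1 : expR (- c * t) * expR (t * c) = 1.
  by rewrite -expRD mulNr mulrC addNr expR0.
have e2 : expR (- c * t) * expR (t * (c - lam)) = expR (- (mu / 3) * ((N + M)%:R / N%:R) * t).
  by rewrite -expRD; congr expR; rewrite /lam; ring.
rewrite /kappa -e2 mulrCA mulrDr (mulrCA _ M%:R) e1 mulr1; ring.
Qed.

End second_moment.
End law.

(** * Expectations and entropy *)

Section bounded_measurable.
Context d (T : measurableType d) (R : realType).
Implicit Types f g : T -> R.

(** A class stable under sums, products and partial integration, on which [Ex] is linear and Fubini
    holds without further integrability checks. *)
Definition bm f := measurable_fun setT f /\ exists C, forall x, `|f x| <= C.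

Lemma bm_cst (r : R) : bm (fun _ : T => r).
Proof. by split; [exact: measurable_cst|exists `|r|]. Qed.

Lemma bmD f g : bm f -> bm g -> bm (fun x => f x + g x).
Proof.
move=> [mf [C hC]] [mg [D hD]]; split; first exact: measurable_funD.
by exists (C + D) => x; rewrite (le_trans (ler_normD _ _))// lerD.
Qed.

Lemma bmM f g : bm f -> bm g -> bm (fun x => f x * g x).
Proof.
move=> [mf [C hC]] [mg [D hD]]; split; first exact: measurable_funM.
by exists (C * D) => x; rewrite normrM ler_pM.
Qed.

Lemma bmZ (r : R) f : bm f -> bm (fun x => r * f x).
Proof. exact/bmM/bm_cst. Qed.

Lemma bmN f : bm f -> bm (fun x => - f x).
Proof.
move=> [mf [C hC]]; split; first exact: measurableT_comp.
by exists C => x; rewrite normrN.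
Qed.

Lemma bmB f g : bm f -> bm g -> bm (fun x => f x - g x).
Proof. by move=> bf bg; exact: bmD bf (bmN bg). Qed.

Lemma bm_itv f a b : measurable_fun setT f -> (forall x, a <= f x <= b) -> bm f.
Proof.
move=> mf fab; split=> //; exists (`|a| + `|b|) => x.
have /andP[h1 h2] := fab x.
by rewrite ler_norml; have := ler_norm (- a); have := ler_norm b; rewrite normrN;
   have := normr_ge0 a; have := normr_ge0 b; lra.
Qed.

Lemma bm_norm f : bm f -> bm (fun x => `|f x|).
Proof.
move=> [mf [C hC]]; split; first exact: measurableT_comp.
by exists C => x; rewrite normr_id.
Qed.

Lemma bm_sum (I : Type) (s : seq I) (f : I -> T -> R) : (forall i, bm (f i)) ->
  bm (fun x => \sum_(i <- s) f i x).
Proof.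
move=> bf; elim: s => [|i s IH].
  by rewrite (_ : (fun x => _) = fun=> 0); [exact: bm_cst|apply/funext => x; rewrite big_nil].
rewrite (_ : (fun x => _) = fun x => f i x + \sum_(j <- s) f j x); first exact: bmD.
by apply/funext => x; rewrite big_cons.
Qed.

End bounded_measurable.

Lemma bm_comp d d' (T : measurableType d) (U : measurableType d') (R : realType)
  (f : U -> R) (g : T -> U) : bm f -> measurable_fun setT g -> bm (fun x => f (g x)).
Proof.
by move=> [mf [C hC]] mg; split; [exact: measurableT_comp|exists C].
Qed.

Section expectation.
Context d (T : measurableType d) (R : realType) (P : probability T R).
Implicit Types f g : T -> R.

Definition Ex f : R := fine (\int[P]_x (f x)%:E).
Definition ig f := P.-integrable setT (EFin \o f).

Lemma bm_ig f : bm f -> ig f.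
Proof.
move=> [mf [C hC]].
apply: (le_integrable measurableT _ _ (finite_measure_integrable_cst P C measurableT)).
  exact/measurable_EFinP.
by move=> x _; rewrite /= lee_fin (le_trans (hC x))// ler_norm.
Qed.

Lemma ExE f : ig f -> (Ex f)%:E = (\int[P]_x (f x)%:E)%E.
Proof. by move=> igf; rewrite /Ex fineK//; exact: integrable_fin_num. Qed.

Lemma igD f g : ig f -> ig g -> ig (fun x => f x + g x).
Proof. by move=> igf igg; exact: (integrableD measurableT igf igg). Qed.

Lemma igZ (r : R) f : ig f -> ig (fun x => r * f x).
Proof. by move=> igf; exact: (integrableZl measurableT r igf). Qed.

Lemma igB f g : ig f -> ig g -> ig (fun x => f x - g x).
Proof. by move=> igf igg; exact: (integrableB measurableT igf igg). Qed.

Lemma ExD f g : ig f -> ig g -> Ex (fun x => f x + g x) = Ex f + Ex g.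
Proof. by move=> igf igg; apply: RintegralD. Qed.

Lemma ExB f g : ig f -> ig g -> Ex (fun x => f x - g x) = Ex f - Ex g.
Proof. by move=> igf igg; apply: RintegralB. Qed.

Lemma ExZ (r : R) f : ig f -> Ex (fun x => r * f x) = r * Ex f.
Proof. by move=> igf; apply: RintegralZl. Qed.

Lemma Ex_cst (r : R) : Ex (fun=> r) = r.
Proof. by rewrite /Ex integral_prob_cst. Qed.

Lemma Ex_le f g : ig f -> ig g -> (forall x, f x <= g x) -> Ex f <= Ex g.
Proof. by move=> igf igg fg; apply: le_Rintegral. Qed.

Lemma Ex_ge0 f : (forall x, 0 <= f x) -> 0 <= Ex f.
Proof. by move=> f0; apply: fine_ge0; apply: integral_ge0 => x _; rewrite lee_fin. Qed.

Lemma Ex_itv f a b : measurable_fun setT f -> (forall x, a <= f x <= b) -> a <= Ex f <= b.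
Proof.
move=> mf fab; have igf := bm_ig (bm_itv mf fab).
have igc r : ig (fun=> r) by exact/bm_ig/bm_cst.
apply/andP; split.
  by rewrite -(Ex_cst a); apply: Ex_le => // x; case/andP: (fab x).
by rewrite -(Ex_cst b); apply: Ex_le => // x; case/andP: (fab x).
Qed.

Lemma Ex_norm f : ig f -> `|Ex f| <= Ex (fun x => `|f x|).
Proof. by move=> igf; exact: le_normr_Rintegral. Qed.

Lemma eq_Ex f g : (forall x, f x = g x) -> Ex f = Ex g.
Proof. by move=> fg; congr Ex; apply/funext. Qed.

End expectation.

Lemma Ex_law d d' (T : measurableType d) (U : measurableType d') (R : realType)
  (P : probability T R) (Q : probability U R) (g : T -> U) (f : U -> R) :
  measurable_fun setT g ->
  (forall F : U -> \bar R, nnm F -> \int[P]_x F (g x) = \int[Q]_y F y)%E ->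
  bm f -> Ex P (fun x => f (g x)) = Ex Q f.
Proof.
move=> mg PQ bf; have [mf [C hC]] := bf.
(* Adding the bound [C] reduces to nonnegative functions, where the equality of laws is assumed; the
   same shift yields Fubini for bounded functions. *)
have bC : bm (fun y => f y + C) by exact/bmD/bm_cst.
have nf : nnm (fun y => (f y + C)%:E).
  split=> [|y]; first by apply/measurable_EFinP; exact: bC.1.
  by rewrite lee_fin; have := hC y; rewrite ler_norml => /andP[]; lra.
have := PQ _ nf => /(congr1 fine); rewrite -/(Ex P (fun x => f (g x) + C)) -/(Ex Q (fun y => f y + C)).
rewrite !ExD ?Ex_cst; [exact: addIr|exact: bm_ig|exact/bm_ig/bm_cst|exact/bm_ig/bm_comp|exact/bm_ig/bm_cst].
Qed.

Section fubini.
Context d d' (T : measurableType d) (U : measurableType d') (R : realType).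
Variables (P : probability T R) (Q : probability U R).

Lemma bm_pair1 (f : T -> U -> R) x : bm (fun p : T * U => f p.1 p.2) -> bm (f x).
Proof.
by move=> bf; exact: (bm_comp bf (measurable_pair1 x)).
Qed.

Lemma bm_pair2 (f : T -> U -> R) y : bm (fun p : T * U => f p.1 p.2) -> bm (f ^~ y).
Proof.
by move=> bf; exact: (bm_comp bf (measurable_pair2 y)).
Qed.

Lemma bm_Ex (f : T -> U -> R) : bm (fun p : T * U => f p.1 p.2) -> bm (fun x => Ex Q (f x)).
Proof.
move=> bf; have [mf [C hC]] := bf; split; last first.
  exists C => x; have bx := bm_pair1 x bf.
  apply: (le_trans (Ex_norm (bm_ig Q bx))).
  rewrite -(Ex_cst Q C); apply: Ex_le.
  - exact/bm_ig/bm_norm.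
  - exact/bm_ig/bm_cst.
  - by move=> y; exact: (hC (x, y)).
have nf : nnm (fun p : T * U => (f p.1 p.2 + C)%:E).
  split=> [|p]; first by apply/measurable_EFinP; exact: measurable_funD.
  by rewrite lee_fin; have := hC p; rewrite ler_norml => /andP[]; lra.
have nI := @nnm_integral _ _ _ _ _ Q (fun x y => (f x y + C)%:E) nf.
rewrite (_ : (fun x => _) = fun x => fine (\int[Q]_y (f x y + C)%:E)%E - C); last first.
  apply/funext => x; have bx := bm_pair1 x bf.
  rewrite -/(Ex Q (fun y => f x y + C)) ExD ?Ex_cst ?addrK//; [exact: bm_ig|exact/bm_ig/bm_cst].
apply: measurable_funB => //.
exact: (measurableT_comp (@fine_measurable _ setT measurableT) nI.1).
Qed.

End fubini.

Lemma Ex_fubini d d' (T : measurableType d) (U : measurableType d') (R : realType)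
  (P : probability T R) (Q : probability U R) (f : T -> U -> R) :
  bm (fun p : T * U => f p.1 p.2) ->
  Ex P (fun x => Ex Q (f x)) = Ex Q (fun y => Ex P (f ^~ y)).
Proof.
move=> bf; have [mf [C hC]] := bf.
have bf' : bm (fun p : U * T => f p.2 p.1) by exact: (bm_comp bf (@measurable_swap _ _ _ _)).
have nf : nnm (fun p : T * U => (f p.1 p.2 + C)%:E).
  split=> [|p]; first by apply/measurable_EFinP; exact: measurable_funD.
  by rewrite lee_fin; have := hC p; rewrite ler_norml => /andP[]; lra.
have igC d1 (W : measurableType d1) (mu : probability W R) : ig mu (fun=> C).
  exact/bm_ig/bm_cst.
have E1 : (\int[P]_x \int[Q]_y (f x y + C)%:E = (Ex P (fun x => Ex Q (f x)) + C)%:E)%E.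
  rewrite -(Ex_cst P C) -ExD; [|exact/bm_ig/bm_Ex|exact: igC].
  rewrite ExE; last by apply: igD; [exact/bm_ig/bm_Ex|exact: igC].
  apply: eq_integral => x _; have bx := bm_pair1 x bf.
  rewrite -(Ex_cst Q C) -ExD; [|exact: bm_ig|exact: igC].
  rewrite ExE; last by apply: igD; [exact: bm_ig|exact: igC].
  by apply: eq_integral => y _; rewrite !Ex_cst.
have E2 : (\int[Q]_y \int[P]_x (f x y + C)%:E = (Ex Q (fun y => Ex P (f ^~ y)) + C)%:E)%E.
  rewrite -(Ex_cst Q C) -ExD; [|exact/bm_ig/(bm_Ex P bf')|exact: igC].
  rewrite ExE; last by apply: igD; [exact/bm_ig/(bm_Ex P bf')|exact: igC].
  apply: eq_integral => y _; have bx := bm_pair2 y bf.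
  rewrite -(Ex_cst P C) -ExD; [|exact: bm_ig|exact: igC].
  rewrite ExE; last by apply: igD; [exact: bm_ig|exact: igC].
  by apply: eq_integral => x _; rewrite !Ex_cst.
move: E1; rewrite (tonelliP (fun x y => (f x y + C)%:E) nf) E2 => -[] /addIr.
exact: esym.
Qed.

(** * The entropy function and convexity of the entropy *)

Section phi.
Variable R : realType.
Implicit Types x m : R.

(* Differs from x ln x by an affine function, hence defines the same entropy, but is
   nonnegative. *)
Definition phi x := x * ln x - x + 1.

Lemma ln_le_sub1 x : 0 < x -> ln x <= x - 1.
Proof.
move=> x0; have := @le_ln1Dx R (x - 1); rewrite (addrC 1) subrK; apply.
by rewrite ltrBrDl subrr.
Qed.

Lemma ln_ge_1subV x : 0 < x -> 1 - x^-1 <= ln x.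
Proof.
move=> x0; have := ln_le_sub1 (x := x^-1); rewrite invr_gt0 lnV ?posrE//.
by move=> /(_ x0); lra.
Qed.

(** The left side is the tangent plane at [(x0, m0)] of [x ln (x / m)], which is jointly convex;
    being homogeneous of degree one, its tangent planes pass through the origin. *)
Lemma log_sum x m x0 m0 : 0 < x -> 0 < m -> 0 < x0 -> 0 < m0 ->
  x * (ln x0 - ln m0) + x - m * (x0 / m0) <= x * (ln x - ln m).
Proof.
move=> hx hm hx0 hm0.
have t0 : 0 < (m * x0) / (x * m0) by rewrite divr_gt0// mulr_gt0.
have := ln_le_sub1 t0.
rewrite ln_div ?posrE ?mulr_gt0// !lnM ?posrE// => h.
have := ler_wpM2l (ltW hx) h.
have -> : x * (m * x0 / (x * m0) - 1) = m * (x0 / m0) - x by field; rewrite !gt_eqF.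
by lra.
Qed.

Lemma phi_tangent x m : 0 < x -> 0 < m -> phi m + ln m * (x - m) <= phi x.
Proof.
move=> hx hm; have := log_sum hx hm ltr01 ltr01.
rewrite ln1 subrr mulr0 add0r divr1 mulr1 /phi => h.
have : x * ln x - x * ln m >= x - m by rewrite -mulrBr.
by lra.
Qed.

Lemma phi_ge0 x : 0 < x -> 0 <= phi x.
Proof.
by move=> x0; have := phi_tangent x0 ltr01; rewrite /phi ln1; lra.
Qed.

Lemma measurable_phi : measurable_fun setT phi.
Proof.
apply: measurable_funD => //; apply: measurable_funB => //.
by apply: measurable_funM => //; exact: measurable_ln.
Qed.

End phi.

Section entropy.
Context d (T : measurableType d) (R : realType) (P : probability T R).
Variables (a b : R) (a0 : 0 < a).

(** A positive lower bound keeps [ln] and [phi] bounded along [f], so that entropies stay within the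
    class [bm]. *)
Definition rng d' (U : measurableType d') (f : U -> R) :=
  measurable_fun setT f /\ forall x, a <= f x <= b.

Lemma rng_gt0 d' (U : measurableType d') (f : U -> R) x : rng f -> 0 < f x.
Proof. by move=> [_ h]; have /andP[? _] := h x; exact: lt_le_trans a0 _. Qed.

Lemma rng_bm d' (U : measurableType d') (f : U -> R) : rng f -> bm f.
Proof. by move=> [mf fab]; exact: bm_itv fab. Qed.

Lemma rng_comp d' (U : measurableType d') d'' (W : measurableType d'') (f : U -> R) (g : W -> U) :
  rng f -> measurable_fun setT g -> rng (fun x => f (g x)).
Proof. by move=> [mf fab] mg; split=> [|x//]; exact: measurableT_comp. Qed.

Lemma rng_ln d' (U : measurableType d') (f : U -> R) : rng f -> bm (fun x => ln (f x)).
Proof.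
move=> rf; apply: (@bm_itv _ _ _ _ (ln a) (ln b)).
  by apply: measurableT_comp; [exact: measurable_ln|exact: rf.1].
move=> x; have f0 := rng_gt0 x rf; have /andP[h1 h2] := rf.2 x.
by rewrite !ler_ln ?posrE ?h1 ?h2//; exact: lt_le_trans h2.
Qed.

Lemma rng_phi d' (U : measurableType d') (f : U -> R) : rng f -> bm (fun x => phi (f x)).
Proof.
move=> rf; apply: bmD; last exact: bm_cst.
apply: bmB; last exact: rng_bm rf.
by apply: bmM; [exact: rng_bm rf|exact: rng_ln].
Qed.

Lemma rng_Ex d' (U : measurableType d') d'' (W : measurableType d'') (Q : probability W R)
  (f : U -> W -> R) : rng (fun p : U * W => f p.1 p.2) -> rng (fun x => Ex Q (f x)).
Proof.
move=> rf; split=> [|x]; first exact: (bm_Ex Q (rng_bm rf)).1.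
apply: Ex_itv; first exact: (rng_comp rf (measurable_pair1 x)).1.
by move=> y; exact: (rf.2 (x, y)).
Qed.

Lemma Ex_rng (f : T -> R) : rng f -> a <= Ex P f <= b.
Proof. by move=> [mf fab]; exact: Ex_itv. Qed.

Lemma Ex_gt0 (f : T -> R) : rng f -> 0 < Ex P f.
Proof. by move=> rf; have /andP[? _] := Ex_rng rf; exact: lt_le_trans a0 _. Qed.

Definition Ent (f : T -> R) := Ex P (fun x => phi (f x)) - phi (Ex P f).

Lemma EntE (f : T -> R) : rng f -> Ent f = Ex P (fun x => f x * (ln (f x) - ln (Ex P f))).
Proof.
move=> rf; have bf := rng_bm rf; have bl := rng_ln rf.
have bfl : bm (fun x => f x * ln (f x)) by exact: bmM.
rewrite /Ent /phi ExD; [|exact/bm_ig/bmB|exact/bm_ig/bm_cst].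
rewrite ExB ?Ex_cst; [|exact: bm_ig|exact: bm_ig].
rewrite (@eq_Ex _ _ _ P (fun x => f x * (ln (f x) - ln (Ex P f))) (fun x => f x * ln (f x) - ln (Ex P f) * f x)); last first.
  by move=> x; rewrite mulrBr (mulrC (ln _)).
by rewrite ExB ?ExZ; [ring|exact: bm_ig|exact: bm_ig|exact/bm_ig/bmZ].
Qed.

Lemma Ent_ge0 (f : T -> R) : rng f -> 0 <= Ent f.
Proof.
move=> rf; rewrite EntE//; have bf := rng_bm rf; have bl := rng_ln rf.
have m0 := Ex_gt0 rf; set m := Ex P f.
have : Ex P (fun x => f x - m) <= Ex P (fun x => f x * (ln (f x) - ln m)).
  apply: Ex_le.
  - exact/bm_ig/bmB/bm_cst.
  - by apply: bm_ig; apply: bmM => //; exact/bmB/bm_cst.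
  - move=> x; have := log_sum (rng_gt0 x rf) m0 ltr01 ltr01.
    by rewrite ln1 subrr mulr0 add0r divr1 mulr1.
by rewrite ExB ?Ex_cst ?subrr//; [exact: bm_ig|exact/bm_ig/bm_cst].
Qed.

End entropy.

Section entropy_convexity.
Context d (T : measurableType d) (R : realType) (P : probability T R).
Context dW (W : measurableType dW) (Q : probability W R).
Variables (a b : R) (a0 : 0 < a).

Lemma bm_Ent (F : T -> W -> R) : rng a b (fun p : T * W => F p.1 p.2) ->
  bm (fun w => Ent P (F ^~ w)).
Proof.
move=> rF.
have rF' : rng a b (fun p : W * T => F p.2 p.1) := rng_comp rF (@measurable_swap _ _ _ _).
apply: bmB.
  by apply: (bm_Ex P (f := fun w x => phi (F x w))); exact: (rng_phi a0 rF').
by apply: (rng_phi a0); exact: (rng_Ex P rF').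
Qed.

(** [log_sum] is applied at [(F x w, m w)] with the tangent plane based at the averaged pair
    [(U x, m0)]. The average of that plane over [w] is exactly the integrand of the left side. *)
Lemma Ent_convex (F : T -> W -> R) : rng a b (fun p : T * W => F p.1 p.2) ->
  Ent P (fun x => Ex Q (F x)) <= Ex Q (fun w => Ent P (F ^~ w)).
Proof.
move=> rF; have bF := rng_bm rF.
have rF' : rng a b (fun p : W * T => F p.2 p.1) := rng_comp rF (@measurable_swap _ _ _ _).
have rFw w : rng a b (F ^~ w) by exact: (rng_comp rF (measurable_pair2 w)).
pose U x := Ex Q (F x); have rU : rng a b U by exact: rng_Ex.
pose m w := Ex P (F ^~ w); have rm : rng a b m by exact: (rng_Ex P rF').
have m0E : Ex P U = Ex Q m by exact: Ex_fubini.
set m0 := Ex P U; have m00 : 0 < m0 by exact: (Ex_gt0 P a0 rU).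
have m1 d1 d2 (T1 : measurableType d1) (T2 : measurableType d2) (f : T1 -> R) : bm f ->
  bm (fun p : T1 * T2 => f p.1) by move=> bf; exact: (bm_comp bf (@measurable_fst _ _ _ _)).
have m2 d1 d2 (T1 : measurableType d1) (T2 : measurableType d2) (f : T2 -> R) : bm f ->
  bm (fun p : T1 * T2 => f p.2) by move=> bf; exact: (bm_comp bf (@measurable_snd _ _ _ _)).
have bLU : bm (fun x => ln (U x) - ln m0) by apply: bmB; [exact: (rng_ln a0 rU)|exact: bm_cst].
have bUm : bm (fun x => U x / m0) by apply: bmM; [exact: (rng_bm rU)|exact: bm_cst].
have b1 : bm (fun p : T * W => F p.1 p.2 * (ln (U p.1) - ln m0)).
  by apply: bmM => //; exact: (m1 _ _ _ _ _ bLU).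
have b2 : bm (fun p : T * W => m p.2 * (U p.1 / m0)).
  by apply: bmM; [exact: (m2 _ _ _ _ _ (rng_bm rm))|exact: (m1 _ _ _ _ _ bUm)].
have b3 : bm (fun p : T * W => F p.1 p.2 * (ln (U p.1) - ln m0) + F p.1 p.2 - m p.2 * (U p.1 / m0)).
  by apply: bmB b2; exact: bmD.
have b4 : bm (fun p : T * W => F p.1 p.2 * (ln (F p.1 p.2) - ln (m p.2))).
  apply: bmM => //; apply: bmB; first exact: (rng_ln a0 rF).
  exact: (m2 _ _ _ _ _ (rng_ln a0 rm)).
rewrite (EntE P a0 rU) -/m0.
rewrite (eq_Ex Q (g := fun w => Ex P (fun x => F x w * (ln (F x w) - ln (m w))))); last first.
  by move=> w; rewrite (EntE P a0 (rFw w)).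
rewrite -(Ex_fubini P Q (f := fun x w => F x w * (ln (F x w) - ln (m w))) b4).
have -> : Ex P (fun x => U x * (ln (U x) - ln m0)) =
   Ex P (fun x => Ex Q (fun w => F x w * (ln (U x) - ln m0) + F x w - m w * (U x / m0))).
  apply: eq_Ex => x.
  have bFx := bm_pair1 x bF.
  rewrite (eq_Ex Q (g := fun w => ((ln (U x) - ln m0) * F x w + F x w) - (U x / m0) * m w)); last first.
    by move=> w; ring.
  have bm' : bm m by exact: rng_bm rm.
  rewrite ExB; [|exact/bm_ig/bmD/bFx/bmZ|exact/bm_ig/bmZ].
  rewrite ExD; [|exact/bm_ig/bmZ|exact: bm_ig].
  rewrite !ExZ; [|exact: bm_ig|exact: bm_ig].
  by rewrite -/(U x) -m0E -/m0; field; rewrite gt_eqF.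
apply: Ex_le.
- exact: (bm_ig P (bm_Ex Q b3)).
- exact: (bm_ig P (bm_Ex Q b4)).
- move=> x; apply: Ex_le.
  + exact: (bm_ig Q (bm_comp b3 (measurable_pair1 x))).
  + exact: (bm_ig Q (bm_comp b4 (measurable_pair1 x))).
  + move=> w; apply: log_sum => //.
    * exact: (rng_gt0 a0 (x, w) rF).
    * exact: (rng_gt0 a0 w rm).
    * exact: (rng_gt0 a0 x rU).
Qed.

End entropy_convexity.

Lemma Ex_prod d1 d2 (T1 : measurableType d1) (T2 : measurableType d2) (R : realType)
  (P : probability T1 R) (Q : probability T2 R) (f : T1 * T2 -> R) : bm f ->
  Ex (prodP P Q) f = Ex P (fun x => Ex Q (fun y => f (x, y))).
Proof.
move=> bf; have [mf [C hC]] := bf.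
have bC d (T : measurableType d) : bm (fun _ : T => C) by exact: bm_cst.
have bfC : bm (fun p => f p + C) by exact: bmD.
have nf : nnm (fun p => (f p + C)%:E).
  split=> [|p]; first by apply/measurable_EFinP; exact: bfC.1.
  by rewrite lee_fin; have := hC p; rewrite ler_norml => /andP[]; lra.
have bx x : bm (fun y => f (x, y)) := bm_comp bf (measurable_pair1 x).
have bE : bm (fun x => Ex Q (fun y => f (x, y))).
  apply: (bm_Ex Q (f := fun x y => f (x, y))).
  by rewrite (_ : (fun p => _) = f)//; apply/funext => -[].
apply: (@addIr _ C); rewrite -[X in _ + X = _](Ex_cst (prodP P Q)).
rewrite -ExD; [|exact: bm_ig|exact: bm_ig].
rewrite -[X in _ = _ + X](Ex_cst P) -ExD; [|exact: bm_ig|exact: bm_ig].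
apply: EFin_inj; rewrite ExE; last exact: bm_ig.
rewrite ExE; last exact/bm_ig/bmD.
rewrite (integral_prodP nf); apply: eq_integral => x _.
rewrite -[X in _ = (_ + X)%:E](Ex_cst Q) -ExD; [|exact: bm_ig|exact: bm_ig].
by rewrite ExE//; exact/bm_ig/bmD.
Qed.

Lemma Ex2_law d1 d2 d3 (T1 : measurableType d1) (T2 : measurableType d2)
  (U : measurableType d3) (R : realType) (P : probability T1 R) (Q : probability T2 R)
  (L : probability U R) (g : T1 * T2 -> U) (f : U -> R) : measurable_fun setT g ->
  (forall F : U -> \bar R, nnm F -> \int[P]_x \int[Q]_y F (g (x, y)) = \int[L]_u F u)%E ->
  bm f -> Ex P (fun x => Ex Q (fun y => f (g (x, y)))) = Ex L f.
Proof.
move=> mg law bf; have bfg := bm_comp bf mg.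
rewrite -(Ex_prod P Q bfg); apply: (Ex_law mg _ bf) => F nF.
by rewrite (integral_prodP (nnm_comp nF mg)); exact: law.
Qed.

(** * The two-scale decomposition *)

Section two_scale.
Variables (R : realType) (M N : nat).
Local Notation K := (M + N)%N.
Local Notation gM := (gam R M).
Local Notation gN := (gam R N).
Variables (a b : R) (a0 : 0 < a).

Definition hs : R := (Num.sqrt 2)^-1.
Lemma hs2 : hs ^+ 2 + hs ^+ 2 = 1.
Proof. by rewrite /hs exprVn sqr_sqrtr//; field. Qed.
Lemma hs_gt0 : 0 < hs. Proof. by rewrite invr_gt0 sqrtr_gt0. Qed.

Definition mid k (x y : Config R k) : Config R k := addc (sclc hs x) (sclc hs y).

Lemma measurable_mid d (T : measurableType d) k (f g : T -> Config R k) :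
  measurable_fun setT f -> measurable_fun setT g ->
  measurable_fun setT (fun x => mid (f x) (g x)).
Proof. by move=> mf mg; apply: measurable_addc; apply: measurable_sclc. Qed.

Lemma Ex_mid k (f : Config R k -> R) : bm f ->
  Ex (gam R k) (fun x => Ex (gam R k) (fun y => f (mid x y))) = Ex (gam R k) f.
Proof.
exact: (Ex2_law (g := fun p => mid p.1 p.2) (gam_stable hs2 k).1 (gam_stable hs2 k).2).
Qed.

Definition NS (S : Mat R M K) (h : Config R M -> R) (x : Config R M) : R :=
  Ex gN (fun w => h (appM S (catc x w))).
Definition zoom (h : Config R M -> R) (p y : Config R M) : R := h (mid p y).
(** The Ornstein-Uhlenbeck average of [h] with correlation [1 / sqrt 2], in Mehler form. *)
Definition coarse (h : Config R M -> R) (p : Config R M) : R := Ex gM (zoom h p).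

Lemma measurable_appM_cat d (T : measurableType d) (S : T -> Mat R M K)
  (x : T -> Config R M) (w : T -> Config R N) :
  measurable_fun setT S -> measurable_fun setT x -> measurable_fun setT w ->
  measurable_fun setT (fun t => appM (S t) (catc (x t) (w t))).
Proof. by move=> mS mx mw; apply: measurable_appM => //; exact: measurable_catc. Qed.

Lemma Ex_Good S f : Good S -> bm f ->
  Ex gM (fun x => Ex gN (fun w => f (appM S (catc x w)))) = Ex gM f.
Proof.
move=> gS bf.
have mg : measurable_fun setT (fun p : Config R M * Config R N => appM S (catc p.1 p.2)).
  by apply: measurable_appM_cat => //; exact: measurable_cst.
apply: (Ex2_law mg _ bf) => F nF; rewrite -(gS F nF) integral_gam_cat//.
by apply: (nnm_comp nF); apply: measurable_appM => //; exact: measurable_cst.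
Qed.

Lemma rng_NS_param d (T : measurableType d) (S : T -> Mat R M K) (x : T -> Config R M)
  (h : T -> Config R M -> R) : measurable_fun setT S -> measurable_fun setT x ->
  rng a b (fun p : T * Config R M => h p.1 p.2) ->
  rng a b (fun t => NS (S t) (h t) (x t)).
Proof.
move=> mS mx rh; apply: rng_Ex.
have m : measurable_fun setT (fun p : T * Config R N => (p.1, appM (S p.1) (catc (x p.1) p.2))).
  apply: measurable_fun_pair => //; apply: measurable_appM_cat => //.
    exact: (measurableT_comp mS measurable_fst).
  exact: (measurableT_comp mx measurable_fst).
exact: (rng_comp rh m).
Qed.

Lemma rng_NS S h : rng a b h -> rng a b (NS S h).
Proof.
move=> rh; apply: (rng_NS_param (S := fun=> S) (x := id) (h := fun=> h)) => //.
exact: (rng_comp rh measurable_snd).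
Qed.

Lemma rng_zoom_param h : rng a b h -> rng a b (fun p : Config R M * Config R M => zoom h p.1 p.2).
Proof. by move=> rh; apply: (rng_comp rh); exact: measurable_mid. Qed.

Lemma rng_zoom h p : rng a b h -> rng a b (zoom h p).
Proof. by move=> rh; exact: (rng_comp (rng_zoom_param rh) (measurable_pair1 p)). Qed.

Lemma rng_coarse h : rng a b h -> rng a b (coarse h).
Proof. by move=> rh; apply: rng_Ex; exact: rng_zoom_param. Qed.

(** Chain rule of the entropy: the mean of [phi (coarse h p)] is added and subtracted, and stability
    of [gam] under [mid] identifies the outer terms. *)
Lemma Ent_two_scale h : rng a b h ->
  Ent gM h = Ent gM (coarse h) + Ex gM (fun p => Ent gM (zoom h p)).
Proof.
move=> rh; have bh := rng_bm rh; have rz := rng_zoom_param rh.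
have bz : bm (fun p => Ex gM (fun y => phi (zoom h p y))).
  by apply: (bm_Ex gM (f := fun p y => phi (zoom h p y))); exact: (rng_phi a0 rz).
have bc : bm (fun p => phi (coarse h p)) by exact: (rng_phi a0 (rng_coarse rh)).
rewrite [X in _ + X]ExB; [|exact: bm_ig|exact: bm_ig].
rewrite {1}/Ent -(Ex_mid (rng_phi a0 rh)) -(Ex_mid bh) /Ent.
by rewrite -/(coarse h); ring.
Qed.

(** The variable [w] is itself split as [mid w w']. By linearity [S] maps the pair of midpoints to
    the midpoint of [S (x, w)] and [S (y, w')], so a slice of [NS S h] is an average over [w] of
    images of slices of [h]. *)
Lemma NS_mid S h x y : rng a b h ->
  NS S h (mid x y) = Ex gN (fun w => NS S (zoom h (appM S (catc x w))) y).
Proof.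
move=> rh; have bh := rng_bm rh.
have bS : bm (fun w => h (appM S (catc (mid x y) w))).
  apply: (bm_comp bh); apply: measurable_appM_cat => //; exact: measurable_cst.
rewrite /NS -(Ex_mid bS); apply: eq_Ex => w; apply: eq_Ex => w'.
by rewrite /zoom /mid -!appMZ -appMD !sclc_cat addc_cat.
Qed.

(** The chain rule for [NS S h] is an equality; the only loss is [Ent_convex] applied to its slices,
    which are averages over [w] by [NS_mid]. [Good S] then turns the base point [appM S (catc x w)]
    into a Gaussian [p]. *)
Lemma NS_Ent_two_scale S h : Good S -> rng a b h ->
  Ent gM (NS S h) <= Ent gM (NS S (coarse h)) + Ex gM (fun p => Ent gM (NS S (zoom h p))).
Proof.
move=> gS rh; set u := NS S h; have ru : rng a b u := rng_NS S rh.
have bh := rng_bm rh; have bu := rng_bm ru.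
have rz := rng_zoom_param rh; have rc := rng_coarse rh.
pose A p y := NS S (zoom h p) y.
have rA : rng a b (fun q : Config R M * Config R M => A q.1 q.2).
  apply: (rng_NS_param (S := fun=> S) (x := snd) (h := fun q => zoom h q.1)) => //.
  have m : measurable_fun setT (fun q : (Config R M * Config R M) * Config R M => (q.1.1, q.2)).
    by apply: measurable_fun_pair => //; apply: measurableT_comp.
  exact: (rng_comp rz m).
pose p x w := appM S (catc x w).
have mp : measurable_fun setT (fun q : Config R M * Config R N => p q.1 q.2).
  by apply: measurable_appM_cat => //; exact: measurable_cst.
have bEA : bm (fun q => Ent gM (A q)).
  apply: (bm_Ent gM a0 (F := fun y q => A q y)).
  exact: (rng_comp rA (@measurable_swap _ _ _ _)).
have rAx x : rng a b (fun q : Config R M * Config R N => A (p x q.2) q.1).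
  have m : measurable_fun setT (fun q : Config R M * Config R N => (p x q.2, q.1)).
    apply: measurable_fun_pair => //.
    by apply: measurable_appM_cat => //; exact: measurable_cst.
  exact: (rng_comp rA m).
have uA x y : u (mid x y) = Ex gN (fun w => A (p x w) y) by exact: NS_mid.
have mean x : Ex gM (fun y => u (mid x y)) = NS S (coarse h) x.
  rewrite (eq_Ex gM (g := fun y => Ex gN (fun w => A (p x w) y))); last exact: uA.
  rewrite (Ex_fubini gM gN (f := fun y w => A (p x w) y) (rng_bm (rAx x))).
  by apply: eq_Ex => w; rewrite /A /NS (Ex_Good gS (rng_bm (rng_zoom _ rh))).
have rum : rng a b (fun q : Config R M * Config R M => u (mid q.1 q.2)).
  by apply: (rng_comp ru); exact: measurable_mid.
have E : Ent gM u = Ex gM (fun x => Ent gM (fun y => u (mid x y))) + Ent gM (NS S (coarse h)).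
  have b1 : bm (fun x => Ex gM (fun y => phi (u (mid x y)))).
    by apply: (bm_Ex gM (f := fun x y => phi (u (mid x y)))); exact: (rng_phi a0 rum).
  have b2 : bm (fun x => phi (Ex gM (fun y => u (mid x y)))).
    have rE := rng_Ex gM (f := fun x y => u (mid x y)) rum.
    exact: (rng_phi a0 rE).
  rewrite [X in X + _]ExB; [|exact: bm_ig|exact: bm_ig].
  rewrite {1}/Ent -(Ex_mid (rng_phi a0 ru)) -(Ex_mid bu).
  rewrite (eq_Ex gM (f := fun x => Ex gM (fun y => u (mid x y))) mean).
  rewrite (eq_Ex gM (f := fun x => phi (Ex gM (fun y => u (mid x y))))
    (g := fun x => phi (NS S (coarse h) x))); last by move=> x; rewrite mean.
  by rewrite /Ent; ring.
have EG : Ex gM (fun x => Ex gN (fun w => Ent gM (A (p x w)))) = Ex gM (fun q => Ent gM (A q)).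
  exact: (Ex_Good gS bEA).
rewrite E addrC; apply: lerD; first exact: lexx.
rewrite -[X in _ <= X]EG; apply: Ex_le.
- apply: bm_ig; apply: (bm_Ent gM a0 (F := fun y x => u (mid x y))).
  exact: (rng_comp rum (@measurable_swap _ _ _ _)).
- apply: bm_ig; apply: (bm_Ex gN (f := fun x w => Ent gM (A (p x w)))).
  exact: (bm_comp bEA mp).
- move=> x; have -> : (fun y => u (mid x y)) = (fun y => Ex gN (fun w => A (p x w) y)).
    by apply/funext => y; exact: uA.
  exact: (Ent_convex gM gN a0 (F := fun y w => A (p x w) y) (rAx x)).
Qed.

End two_scale.

Lemma ge0_ig d (T : measurableType d) (R : realType) (P : probability T R) (f : T -> R) :
  measurable_fun setT f -> (forall x, 0 <= f x) -> (\int[P]_x (f x)%:E < +oo)%E -> ig P f.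
Proof.
move=> mf f0 foo; apply/integrableP; split; first exact/measurable_EFinP.
by under eq_integral do rewrite /= ger0_norm//.
Qed.

Lemma ig_le d (T : measurableType d) (R : realType) (P : probability T R) (f g : T -> R) :
  measurable_fun setT f -> (forall x, `|f x| <= g x) -> ig P g -> ig P f.
Proof.
move=> mf fg igg; apply: (le_integrable measurableT _ _ igg); first exact/measurable_EFinP.
by move=> x _; rewrite /= lee_fin (le_trans (fg x))// ler_norm.
Qed.

(** * Nearly affine densities *)

Section moments.
Variable R : realType.
Local Notation g1 := (gauss1 R).

(** Domination by a wider Gaussian, whose integral is known from an affine substitution; this makes
    the fourth moment finite. *)
Lemma quartic_gauss (x : R) : x ^+ 4 * e1 x <= (16 / pi ^+ 2) * e1 (hs R * x).
Proof.
have pi0 : 0 < pi :> R by exact: pi_gt0.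
(* With this [y] the two Gaussians are [exp (- 2 y)] and [exp (- y)], and
   [x ^ 4 = 4 y ^ 2 / pi ^ 2], so all reduces to [y ^ 2 / 4 <= exp y]. *)
pose y := pi * x ^+ 2 / 2.
have y0 : 0 <= y by rewrite divr_ge0// mulr_ge0 ?sqr_ge0// ltW.
have hs2' : hs R ^+ 2 = 1 / 2 by have := hs2 R; lra.
have e1h : e1 (hs R * x) = expR (- y).
  by congr expR; rewrite exprMn hs2' /y; field.
have e1x : e1 x = expR (- y) * expR (- y).
  by rewrite -expRD; congr expR; rewrite /y; field.
have ey : y ^+ 2 / 4 <= expR y.
  have -> : expR y = expR (y / 2) ^+ 2 by rewrite -expRM_natl -mulr_natr; congr expR; field.
  have h := expR_ge1Dx (y / 2).
  rewrite (_ : y ^+ 2 / 4 = (y / 2) ^+ 2); last by field.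
  apply: lerXn2r; [by rewrite nnegrE divr_ge0|by rewrite nnegrE expR_ge0|].
  by apply: (le_trans _ h); rewrite lerDr.
rewrite e1x e1h mulrA ler_pM2r ?expR_gt0//.
have -> : x ^+ 4 = 16 / pi ^+ 2 * (y ^+ 2 / 4) by rewrite /y; move: (pi : R) pi0 => p p0; field; rewrite gt_eqF.
have c0 : 0 <= 16 / pi ^+ 2 :> R by rewrite divr_ge0// exprn_ge0// ltW.
apply: (@le_trans _ _ (16 / pi ^+ 2 * expR y * expR (- y))).
  by apply: (ler_wpM2r (expR_ge0 _)); apply: (ler_wpM2l c0).
by rewrite -mulrA -expRD subrr expR0 mulr1.
Qed.

Lemma gauss1_quartic : (\int[g1]_x (x ^+ 4)%:E < +oo)%E.
Proof.
have n4 : nnm (fun x : R => (x ^+ 4)%:E).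
  split=> [|x]; last by rewrite lee_fin exprn_even_ge0.
  by apply/measurable_EFinP; exact: measurable_funX.
rewrite -(gauss1E n4).
have ne : nnm (fun x : R => (e1 x)%:E).
  by split=> [|x]; [apply/measurable_EFinP; exact: measurable_e1|rewrite lee_fin ltW ?e1_gt0].
have hs0 : hs R != 0 by rewrite gt_eqF ?hs_gt0.
have H := integral_lebesgue_affine 0 hs0 ne.
have i1 : (\int[lebesgue_measure]_(x in [set: R]) (e1 x)%:E = 1)%E by exact: integral_gauss1.
have pi0 : 0 < pi :> R by exact: pi_gt0.
pose k := 16 / pi ^+ 2 / `|hs R|.
have k0 : 0 <= k by rewrite !divr_ge0 ?exprn_ge0 ?(ltW pi0).
have mae : measurable_fun [set: R] (fun x : R => (e1 (hs R * x + 0) * `|hs R|)).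
  apply: measurable_funM => //; apply: (measurableT_comp (@measurable_e1 R)).
  by apply: measurable_funD => //; exact: measurable_funM.
apply: (@le_lt_trans _ _ (\int[lebesgue_measure]_(x in [set: R]) (k%:E * (e1 (hs R * x + 0) * `|hs R|)%:E))%E).
  apply: ge0_le_integral => //.
  - by move=> x _; rewrite -EFinM lee_fin mulr_ge0 ?exprn_even_ge0 ?expR_ge0.
  - apply/measurable_EFinP; apply: measurable_funM; first exact: measurable_funX.
    exact: measurable_e1.
  - by apply/measurable_EFinP; apply: measurable_funM.
  - move=> x _; rewrite -!EFinM lee_fin addr0 /k.
    have n0 : `|hs R| != 0 by rewrite normr_eq0.
    have := quartic_gauss x; set c := 16 / _.
    by rewrite (_ : c / _ * (_ * _) = c * e1 (hs R * x)) //; field.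
rewrite ge0_integralZl ?lee_fin//; last 2 first.
- exact/measurable_EFinP.
- by move=> x _; rewrite lee_fin mulr_ge0// ltW ?e1_gt0.
under eq_integral do rewrite EFinM.
by rewrite H i1 mule1 ltry.
Qed.

Lemma sq_le_quartic (x : R) : x ^+ 2 <= 1 + x ^+ 4.
Proof. by have := sqr_ge0 (x ^+ 2 - 1); rewrite sqrrB1 -exprM; nra. Qed.

Lemma gauss1_ig4 : ig g1 (fun x => x ^+ 4).
Proof.
apply: ge0_ig gauss1_quartic; first exact: measurable_funX.
by move=> x; rewrite exprn_even_ge0.
Qed.

Lemma gauss1_ig2 : ig g1 (fun x => x ^+ 2).
Proof.
apply: (@ig_le _ _ _ g1 _ (fun x => 1 + x ^+ 4)).
- exact: measurable_funX.
- by move=> x; rewrite ger0_norm ?sqr_ge0// sq_le_quartic.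
- by apply: igD; [exact/bm_ig/bm_cst|exact: gauss1_ig4].
Qed.

(** Only the sign of this second moment matters: it multiplies both quadratic forms in the second
    order comparison. *)
Definition c2 : R := Ex g1 (fun x => x ^+ 2).
Lemma c2_ge0 : 0 <= c2. Proof. by apply: Ex_ge0 => x; exact: sqr_ge0. Qed.

Lemma gam_dot2 k (V : Config R k) :
  (\int[gam R k]_z ((dot V z) ^+ 2)%:E = (c2 * sqnorm V)%:E)%E.
Proof.
have n2 : nnm (fun x : R => (x ^+ 2)%:E).
  by split=> [|x]; [apply/measurable_EFinP; exact: measurable_funX|rewrite lee_fin sqr_ge0].
rewrite (gam_dot V n2) mulrC EFinM (ExE gauss1_ig2) -ge0_integralZl ?lee_fin ?sqnorm_ge0//; last 2 first.
- exact: n2.1.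
- by move=> x _; rewrite lee_fin sqr_ge0.
by apply: eq_integral => x _; rewrite exprMn sqr_sqrtr ?sqnorm_ge0.
Qed.

Lemma measurable_dotr k (V : Config R k) : measurable_fun setT (fun z => dot V z).
Proof. by apply: measurable_dot => //; exact: measurable_cst. Qed.

Lemma dot_ig k (V : Config R k) : ig (gam R k) (fun z => dot V z).
Proof.
have m := measurable_dotr V.
apply: (ig_le (g := fun z => 1 + dot V z ^+ 2)) => //.
  move=> z; rewrite -[dot V z ^+ 2]real_normK ?num_real//.
  by have := sqr_ge0 (`|dot V z| - 1); have := normr_ge0 (dot V z); nra.
apply: igD; first exact/bm_ig/bm_cst.
apply: ge0_ig; [exact: measurable_funX|by move=> z; exact: sqr_ge0|].
by rewrite gam_dot2 ltry.
Qed.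

(** The law of a linear form depends on the norm of [V] only, so [V] and [- V] give positive parts
    of equal mean. *)
Lemma dot_mean0 k (V : Config R k) : Ex (gam R k) (fun z => dot V z) = 0.
Proof.
pose F (x : R) := (Num.max x 0)%:E.
have nF : nnm F.
  split=> [|x]; last by rewrite lee_fin le_max lexx orbT.
  by apply/measurable_EFinP; exact: measurable_maxr.
have igp W : ig (gam R k) (fun z => Num.max (dot W z) 0).
  apply: (ig_le (g := fun z => `|dot W z|)).
  - by apply: measurable_maxr => //; exact: measurable_dotr.
  - by move=> z; rewrite ger0_norm ?le_max ?lexx ?orbT// ge_max normr_ge0 ler_norm.
  - exact: integrable_norm (dot_ig W).
have nV z : dot (sclc (-1) V) z = - dot V z by rewrite dotZl mulN1r.
have e : Ex (gam R k) (fun z => Num.max (dot V z) 0) = Ex (gam R k) (fun z => Num.max (dot (sclc (-1) V) z) 0).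
  apply: EFin_inj; rewrite !ExE// (gam_dot V nF) (gam_dot (sclc (-1) V) nF).
  have -> : sqnorm (sclc (-1) V) = sqnorm V by rewrite !sqnorm_dot dotZl dotZr !mulN1r opprK.
  by [].
rewrite (eq_Ex (gam R k) (g := fun z => Num.max (dot V z) 0 - Num.max (dot (sclc (-1) V) z) 0)).
  by rewrite ExB// e subrr.
move=> z; rewrite nV; case: (leP (dot V z) 0) => h.
  by rewrite max_l ?oppr_ge0// sub0r opprK.
by rewrite max_r ?oppr_le0 ?ltW// subr0.
Qed.

Definition n1 k (z : Config R k) : R := \sum_p `|co z p|.
Lemma n1_ge0 k (z : Config R k) : 0 <= n1 z.
Proof. by apply: sumr_ge0 => p _. Qed.
(** One integrable weight for all growth bounds below: squares of quadratic remainders reach degree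
    4, cubes of linear increments degree 3. *)
Definition wt k (z : Config R k) : R := (1 + n1 z) ^+ 4.

Lemma pow4D (x y : R) : (x + y) ^+ 4 <= 8 * (x ^+ 4 + y ^+ 4).
Proof.
have h1 : (x + y) ^+ 2 <= 2 * (x ^+ 2 + y ^+ 2) by have := sqr_ge0 (x - y); nra.
have h0 := sqr_ge0 (x + y).
rewrite !(exprM _ 2 2 : _ ^+ 4 = _).
have h2 : ((x + y) ^+ 2) ^+ 2 <= (2 * (x ^+ 2 + y ^+ 2)) ^+ 2.
  by apply: lerXn2r; rewrite ?nnegrE// mulr_ge0// addr_ge0 ?sqr_ge0.
by have := sqr_ge0 (x ^+ 2 - y ^+ 2); nra.
Qed.

Lemma wt_ig k : ig (gam R k) (@wt k).
Proof.
pose q4 (f : Config R k -> R) := measurable_fun setT f /\ ig (gam R k) (fun z => f z ^+ 4).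
have qD f g : q4 f -> q4 g -> q4 (fun z => f z + g z).
  move=> [mf qf] [mg qg]; split; first exact: measurable_funD.
  apply: (ig_le (g := fun z => 8 * (f z ^+ 4 + g z ^+ 4))).
  - by apply: measurable_funX; exact: measurable_funD.
  - by move=> z; rewrite ger0_norm ?pow4D// exprn_even_ge0.
  - by apply: igZ; exact: igD.
have qc c : q4 (fun=> c) by split; [exact: measurable_cst|exact/bm_ig/bm_cst].
have qp p : q4 (fun z => `|co z p|).
  split; first by apply: measurableT_comp => //; exact: measurable_co.
  pose V : Config R k := mkC (fun q => (q == p)%:R).
  have dV z : dot V z = co z p.
    rewrite /dot (bigD1 p)//= co_mkC eqxx mul1r big1 ?addr0// => q /negbTE qp.
    by rewrite co_mkC qp mul0r.
  have n4 : nnm (fun x : R => (`|x| ^+ 4)%:E).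
    split=> [|x]; last by rewrite lee_fin exprn_ge0.
    by apply/measurable_EFinP; apply: measurable_funX; exact: normr_measurable.
  apply: ge0_ig.
  - by apply: measurable_funX; apply: measurableT_comp => //; exact: measurable_co.
  - by move=> z; rewrite exprn_ge0.
  - under eq_integral do rewrite -dV.
    rewrite (gam_dot V n4); set r := Num.sqrt _.
    under eq_integral do rewrite normrM exprMn EFinM.
    rewrite ge0_integralZl ?lee_fin ?exprn_ge0//; last first.
      by apply/measurable_EFinP; apply: measurable_funX; exact: normr_measurable.
    rewrite lte_mul_pinfty ?lee_fin ?exprn_ge0//.
    under eq_integral do rewrite -normrX ger0_norm ?exprn_even_ge0//.
    exact: gauss1_quartic.
have qs (s : seq ('I_k * 'I_3)) : q4 (fun z => \sum_(p <- s) `|co z p|).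
  elim: s => [|p s IH].
    by rewrite (_ : (fun z => _) = fun=> 0)//; apply/funext => z; rewrite big_nil.
  rewrite (_ : (fun z => _) = fun z => `|co z p| + \sum_(q <- s) `|co z q|); first exact: qD.
  by apply/funext => z; rewrite big_cons.
exact: (qD _ _ (qc 1) (qs (index_enum _))).2.
Qed.

Lemma wt_ge1 k (z : Config R k) : 1 <= wt z.
Proof. by rewrite exprn_ege1// lerDl n1_ge0. Qed.

Lemma n1_le_wt k (z : Config R k) j : (j <= 4)%N -> n1 z ^+ j <= wt z.
Proof.
move=> j4; apply: (@le_trans _ _ ((1 + n1 z) ^+ j)).
  by apply: lerXn2r; rewrite ?nnegrE ?addr_ge0 ?n1_ge0// lerDr.
by rewrite ler_weXn2l// lerDl n1_ge0.
Qed.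

End moments.

(** * Taylor expansion of the entropy *)

Section taylor.
Variable R : realType.
Implicit Types x m a : R.

(** Mean value theorem for the remainder [F]: its derivative [ln (y / m) - (y - m) / m] lies between
    [(y - m) / y - (y - m) / m] and 0, hence is quadratic in [y - m]. *)
Lemma phi_taylor a x m : 0 < a -> a <= x -> a <= m ->
  `|phi x - phi m - ln m * (x - m) - (x - m) ^+ 2 / (2 * m)| <= `|x - m| ^+ 3 / a ^+ 2.
Proof.
move=> a0 ax am; have m0 : 0 < m by exact: lt_le_trans am.
pose F y := y * ln y + ((-1) * y + ((- ln m) * y + (- (2 * m)^-1) * ((y - m) * (y - m)))).
pose dF y := ln y - ln m - (y - m) / m.
have dFP (y : R) : 0 < y -> is_derive y 1 F (dF y).
  move=> y0; have yn : y != 0 by rewrite gt_eqF.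
  have mn : m != 0 by rewrite gt_eqF.
  have d1 : is_derive y 1 (fun z : R => z * ln z) (y * y^-1 + ln y * 1).
    exact: is_derive1M (is_derive1_id y) (is_derive1_ln y0).
  have dm : is_derive y 1 (fun z : R => z - m) (1 + 0).
    exact: is_derive1D (is_derive1_id y) (is_derive1_cst y (- m)).
  have dl (k : R) (f : R -> R) (d : R) : is_derive y 1 f d -> is_derive y 1 (fun z => k * f z) (k * d + f y * 0).
    exact: is_derive1M (is_derive1_cst y k).
  have := is_derive1D d1 (is_derive1D (dl (-1) _ _ (is_derive1_id y))
    (is_derive1D (dl (- ln m) _ _ (is_derive1_id y)) (dl (- (2 * m)^-1) _ _ (is_derive1M dm dm)))).
  move/is_derive1_eq; apply.
  by rewrite /dF; field; rewrite yn mn.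
have dF_le (y : R) : a <= y -> `|y - m| <= `|x - m| -> `|dF y| <= `|x - m| ^+ 2 / a ^+ 2.
  move=> ay yx; have y0 : 0 < y by exact: lt_le_trans ay.
  have l1 : ln y - ln m <= (y - m) / m.
    by rewrite -ln_div ?posrE// (le_trans (ln_le_sub1 _)) ?divr_gt0// mulrBl divff ?gt_eqF.
  have l2 : (y - m) / y <= ln y - ln m.
    rewrite -ln_div ?posrE//; apply: le_trans (ln_ge_1subV _); last by rewrite divr_gt0.
    by rewrite invf_div mulrBl divff ?gt_eqF.
  rewrite ler0_norm; last by rewrite /dF subr_le0.
  apply: (@le_trans _ _ ((y - m) ^+ 2 / (y * m))).
    rewrite (_ : _ / (y * m) = (y - m) / m - (y - m) / y); last by field; rewrite !gt_eqF.
    by rewrite /dF; lra.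
  apply: ler_pM; [exact: sqr_ge0|by rewrite invr_ge0 mulr_ge0 // ltW| |].
    by rewrite -(real_normK (num_real (y - m))); apply: lerXn2r; rewrite ?nnegrE.
  by rewrite lef_pV2 ?posrE ?mulr_gt0// ?exprn_gt0// expr2 ler_pM// ltW.
have cF (u v : R) : 0 < u -> {within `[u, v], continuous F}.
  move=> u0; apply: derivable_within_continuous => y; rewrite in_itv/= => /andP[uy _].
  by have [] := dFP y (lt_le_trans u0 uy).
have Fxm : F x - F m = phi x - phi m - ln m * (x - m) - (x - m) ^+ 2 / (2 * m).
  by rewrite /F /phi; field; rewrite gt_eqF.
rewrite -Fxm.
have fin (c d : R) : a <= c -> `|c - m| <= `|x - m| -> `|d| = `|x - m| -> `|dF c * d| <= `|x - m| ^+ 3 / a ^+ 2.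
  move=> ac cx dx; rewrite normrM dx exprSr mulrAC; apply: ler_wpM2r => //.
  exact: dF_le.
case: (leP m x) => mx.
  have [|c] := @MVT_segment _ F dF m x mx _ (cF _ _ m0).
    by move=> y; rewrite in_itv/= => /andP[my _]; apply: dFP; exact: lt_trans my.
  rewrite in_itv/= => /andP[mc cx] ->; apply: fin => //; first exact: le_trans mc.
  by rewrite !ger0_norm ?subr_ge0// lerB.
have x0 : 0 < x by exact: lt_le_trans ax.
have [|c] := @MVT_segment _ F dF x m (ltW mx) _ (cF _ _ x0).
  by move=> y; rewrite in_itv/= => /andP[my _]; apply: dFP; exact: lt_trans my.
rewrite in_itv/= => /andP[xc cm]; rewrite distrC => ->; apply: fin; first exact: le_trans xc.
- by rewrite !ler0_norm ?subr_le0 ?(ltW mx)// lerN2 lerB.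
- by rewrite distrC.
Qed.

(** Expanding [phi] at the mean, the linear term integrates to 0 and the variance remains, up to a
    third absolute moment. *)
Lemma Ent_taylor d (T : measurableType d) (P : probability T R) a b (u : T -> R) :
  0 < a -> rng a b u ->
  `|Ent P u - Ex P (fun y => (u y - Ex P u) ^+ 2) / (2 * Ex P u)|
    <= Ex P (fun y => `|u y - Ex P u| ^+ 3) / a ^+ 2.
Proof.
move=> a0 ru; set m := Ex P u; have bu := rng_bm ru; have bp := rng_phi a0 ru.
have am : a <= m by have /andP[] := Ex_rng P ru.
have bum : bm (fun y => u y - m) by exact: bmB bu (bm_cst _ _).
have b2 : bm (fun y => (u y - m) ^+ 2) by exact: bmM.
have b3 : bm (fun y => `|u y - m| ^+ 3).
  by have bn := bm_norm bum; exact: (bmM bn (bmM bn bn)).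
pose G y := phi (u y) - phi m - ln m * (u y - m) - (2 * m)^-1 * (u y - m) ^+ 2.
have bG : bm G.
  apply: bmB; last exact: bmZ.
  by apply: bmB; [apply: bmB => //; exact: bm_cst|exact: bmZ].
have <- : Ex P G = Ent P u - Ex P (fun y => (u y - m) ^+ 2) / (2 * m).
  rewrite /G ExB; [|apply: bm_ig; apply: bmB; [exact: bmB bp (bm_cst _ _)|exact: bmZ]|exact/bm_ig/bmZ].
  rewrite ExB; [|apply: bm_ig; exact: bmB bp (bm_cst _ _)|exact/bm_ig/bmZ].
  rewrite ExB; [|exact: bm_ig|exact/bm_ig/bm_cst].
  rewrite !ExZ; [|exact: bm_ig|exact: bm_ig].
  rewrite ExB; [|exact: bm_ig|exact/bm_ig/bm_cst].
  by rewrite !Ex_cst -/m subrr mulr0 subr0 /Ent -/m [X in _ - X]mulrC.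
apply: (le_trans (Ex_norm (bm_ig P bG))).
rewrite mulrC -ExZ; last exact: bm_ig.
apply: Ex_le; [exact/bm_ig/bm_norm|exact/bm_ig/bmZ|].
move=> y; rewrite mulrC /G (mulrC (2 * m)^-1); apply: phi_taylor => //.
by have /andP[] := ru.2 y.
Qed.

End taylor.

(** Used with [s = lam]: a remainder of size [lam ^ 2] then costs [lam ^ 4 / lam = lam ^ 3], while
    the main term gains only the factor [1 + lam]. *)
Lemma sqD_le (R : realType) (s x y : R) : 0 < s ->
  (x + y) ^+ 2 <= (1 + s) * x ^+ 2 + (1 + s^-1) * y ^+ 2.
Proof.
move=> s0; rewrite -subr_ge0.
have -> : (1 + s) * x ^+ 2 + (1 + s^-1) * y ^+ 2 - (x + y) ^+ 2 = s^-1 * (s * x - y) ^+ 2.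
  by field; rewrite gt_eqF.
by rewrite mulr_ge0 ?sqr_ge0// invr_ge0 ltW.
Qed.

Lemma cube_tangent (R : realType) (x v : R) : `|v| ^+ 3 + 3 * v * `|v| * (x - v) <= `|x| ^+ 3.
Proof.
wlog v0 : x v / 0 <= v.
  move=> H; case: (leP 0 v) => v0; first exact: H.
  have nv : 0 <= - v by rewrite oppr_ge0 ltW.
  by have := H (- x) (- v) nv; rewrite !normrN; lra.
rewrite (ger0_norm v0).
have [x0|x0] := leP 0 x.
  rewrite (ger0_norm x0) -subr_ge0.
  have -> : x ^+ 3 - (v ^+ 3 + 3 * v * v * (x - v)) = (x - v) ^+ 2 * (x + 2 * v) by ring.
  by rewrite mulr_ge0 ?sqr_ge0// addr_ge0// mulr_ge0.
have h1 : 0 <= `|x| ^+ 3 by rewrite exprn_ge0.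
apply: le_trans h1.
have -> : v ^+ 3 + 3 * v * v * (x - v) = 3 * v ^+ 2 * x - 2 * v ^+ 3 by ring.
have h2 : 0 <= v ^+ 2 * - x by rewrite mulr_ge0 ?sqr_ge0// oppr_ge0 ltW.
have h3 : 0 <= v ^+ 3 by rewrite exprn_ge0.
lra.
Qed.

Lemma cube_Ex d (T : measurableType d) (R : realType) (P : probability T R) (g : T -> R) :
  bm g -> `|Ex P g| ^+ 3 <= Ex P (fun x => `|g x| ^+ 3).
Proof.
move=> bg; set v := Ex P g.
have b1 : bm (fun x => (3 * v * `|v|) * (g x - v)) by apply: bmZ; exact: bmB bg (bm_cst _ _).
have bn := bm_norm bg.
have <- : `|v| ^+ 3 + Ex P (fun x => (3 * v * `|v|) * (g x - v)) = `|v| ^+ 3.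
  rewrite ExZ; last by apply: bm_ig; exact: bmB bg (bm_cst _ _).
  by rewrite ExB ?Ex_cst ?subrr ?mulr0 ?addr0//; [exact: bm_ig|exact/bm_ig/bm_cst].
rewrite -(Ex_cst P (`|v| ^+ 3)) -ExD; [|exact/bm_ig/bm_cst|exact: bm_ig].
apply: Ex_le.
- by apply: bm_ig; apply: bmD b1; exact: bm_cst.
- by apply: bm_ig; exact: (bmM bn (bmM bn bn)).
- by move=> x; exact: cube_tangent.
Qed.

Lemma wt_pow (R : realType) k (z : Config R k) j : (j <= 4)%N -> (1 + n1 z) ^+ j <= wt z.
Proof. by move=> j4; rewrite /wt ler_weXn2l// lerDl n1_ge0. Qed.

Lemma sq_Ex d (T : measurableType d) (R : realType) (P : probability T R) (f : T -> R) :
  ig P f -> ig P (fun x => f x ^+ 2) -> Ex P f ^+ 2 <= Ex P (fun x => f x ^+ 2).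
Proof.
move=> i1 i2; set v := Ex P f.
have i3 : ig P (fun x => 2 * v * f x - v ^+ 2) by apply: igB; [exact: igZ|exact/bm_ig/bm_cst].
have <- : Ex P (fun x => 2 * v * f x - v ^+ 2) = v ^+ 2.
  rewrite ExB; [|exact: igZ|exact/bm_ig/bm_cst].
  by rewrite ExZ// Ex_cst -/v; ring.
by apply: Ex_le => // x; have := sqr_ge0 (f x - v); rewrite sqrrB; lra.
Qed.

Lemma wnorm_two10 (R : realType) M N (z : Config R (M + N)) :
  wnorm (two 1 0) z = sqnorm (vpart z).
Proof.
rewrite -wnorm1 /wnorm big_split_ord/= [X in _ + X]big1 ?addr0; last first.
  by move=> i _; rewrite two_r mul0r.
by apply: eq_bigr => i _; rewrite two_l /blk tnth_mktuple.
Qed.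

Lemma Good_cat (R : realType) M N (S : Mat R M (M + N)) F : Good S -> nnm F ->
  (\int[gam R M]_x \int[gam R N]_w F (appM S (catc x w)) = \int[gam R M]_x F x)%E.
Proof.
move=> gS nF; rewrite -(gS F nF) integral_gam_cat//.
by apply: (nnm_comp nF); apply: measurable_appM => //; exact: measurable_cst.
Qed.

(** * Entropy comparison at scale [lam] up to third order *)

Section local.
Variables (R : realType) (M N : nat) (a b : R).
Hypothesis a0 : 0 < a.
Local Notation K := (M + N)%N.
Local Notation gM := (gam R M).
Local Notation gN := (gam R N).
Variables (h : Config R M -> R) (V : Config R M) (h0 lam C : R).
Hypotheses (rh : rng a b h) (lam0 : 0 < lam) (lam1 : lam <= 1) (C0 : 0 <= C).
Hypothesis lip : forall y, `|h y - h0| <= lam * C * n1 y.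
Hypothesis quad : forall y, `|h y - h0 - dot V y| <= lam ^+ 2 * C * n1 y ^+ 2.

Let m := Ex gM h.
Definition wmean := Ex gM (@wt R M).
Local Notation D := wmean.
Let E := C * (1 + D).

Let D0 : 0 <= D.
Proof. by apply: Ex_ge0 => x; rewrite (le_trans ler01)// wt_ge1. Qed.

Let E0 : 0 <= E. Proof. by rewrite mulr_ge0// addr_ge0. Qed.

Let bh : bm h. Proof. exact: rng_bm rh. Qed.

(** The linear form has mean 0, so the mean of [h] differs from its central value [h0] at second
    order only. Recentring at [m] thus preserves both growth bounds up to the constant [E]. *)
Let mean_close : `|h0 - m| <= lam ^+ 2 * C * D.
Proof.
have igV : ig gM (fun y => dot V y) := dot_ig V.
have igh : ig gM (fun y => h y - h0) by apply/bm_ig/bmB => //; exact: bm_cst.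
have -> : h0 - m = - Ex gM (fun y => h y - h0 - dot V y).
  rewrite ExB// dot_mean0 subr0 ExB; [|exact: bm_ig|exact/bm_ig/bm_cst].
  by rewrite Ex_cst opprB.
rewrite normrN; apply: (le_trans (Ex_norm (igB igh igV))).
rewrite -ExZ; last exact: wt_ig.
apply: Ex_le; first by exact: integrable_norm (igB igh igV).
  by apply: igZ; exact: wt_ig.
move=> y; apply: (le_trans (quad y)); apply: ler_wpM2l; last exact: n1_le_wt.
by rewrite mulr_ge0// sqr_ge0.
Qed.

Let g y := h y - m.
Let rho y := g y - dot V y.

Let bg : bm g. Proof. exact: bmB bh (bm_cst _ _). Qed.
Let bg2 : bm (fun y => g y ^+ 2). Proof. exact: bmM bg bg. Qed.
Let bg3 : bm (fun y => `|g y| ^+ 3).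
Proof. by have bn := bm_norm bg; exact: (bmM bn (bmM bn bn)). Qed.

Let lam2 : lam ^+ 2 <= lam.
Proof. by rewrite expr2 ler_piMr// ltW. Qed.

Let g_le y : `|g y| <= lam * E * (1 + n1 y).
Proof.
have -> : g y = (h y - h0) + (h0 - m) by rewrite /g; ring.
apply: (le_trans (ler_normD _ _)).
have h1 := lip y; have h2 := mean_close.
have h3 : lam ^+ 2 * C * D <= lam * C * D by apply: ler_wpM2r => //; exact: ler_wpM2r.
have h4 : 0 <= lam * C * (1 + D * n1 y).
  by rewrite !mulr_ge0 ?(ltW lam0)// addr_ge0// mulr_ge0// n1_ge0.
rewrite (_ : lam * E * (1 + n1 y) = lam * C * n1 y + lam * C * D + lam * C * (1 + D * n1 y)).
  lra.
by rewrite /E; ring.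
Qed.

Let rho_le y : `|rho y| <= lam ^+ 2 * E * (1 + n1 y) ^+ 2.
Proof.
have -> : rho y = (h y - h0 - dot V y) + (h0 - m) by rewrite /rho /g; ring.
apply: (le_trans (ler_normD _ _)).
have h1 := quad y; have h2 := mean_close; have n0 := n1_ge0 y.
have h4 : 0 <= lam ^+ 2 * C * (1 + 2 * n1 y + D * (2 * n1 y + n1 y ^+ 2)).
  have n2 : 0 <= 2 * n1 y by exact: mulr_ge0.
  apply: mulr_ge0; first by rewrite mulr_ge0 ?sqr_ge0.
  by rewrite !addr_ge0// mulr_ge0// addr_ge0// sqr_ge0.
rewrite (_ : lam ^+ 2 * E * (1 + n1 y) ^+ 2 = lam ^+ 2 * C * n1 y ^+ 2 + lam ^+ 2 * C * D +
   lam ^+ 2 * C * (1 + 2 * n1 y + D * (2 * n1 y + n1 y ^+ 2))).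
  lra.
by rewrite /E; ring.
Qed.

Let n1p (y : Config R M) : 0 <= 1 + n1 y. Proof. by rewrite addr_ge0 ?n1_ge0. Qed.

Let pow_le (x e : R) (y : Config R M) i j : 0 <= e -> (i * j <= 4)%N ->
  `|x| <= e * (1 + n1 y) ^+ i -> `|x| ^+ j <= e ^+ j * wt y.
Proof.
move=> e0 ij hx; apply: (@le_trans _ _ ((e * (1 + n1 y) ^+ i) ^+ j)).
  by apply: lerXn2r => //; rewrite nnegrE// mulr_ge0// exprn_ge0.
by rewrite exprMn -exprM ler_wpM2l ?exprn_ge0// wt_pow.
Qed.

Let lE0 : 0 <= lam * E. Proof. by rewrite mulr_ge0// ltW. Qed.
Let l2E0 : 0 <= lam ^+ 2 * E. Proof. by rewrite mulr_ge0// sqr_ge0. Qed.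

Let igwt c : ig gM (fun y => c * wt y). Proof. by apply: igZ; exact: wt_ig. Qed.

Let q := Ex gM (fun y => g y ^+ 2).

Let q_le : q <= lam ^+ 2 * (E ^+ 2 * D).
Proof.
rewrite mulrA -exprMn -ExZ; last exact: wt_ig.
apply: Ex_le => //; first exact: bm_ig.
move=> y; rewrite -(real_normK (num_real (g y))).
by apply: (@pow_le _ _ _ 1) => //; rewrite expr1.
Qed.

Let cube_le : Ex gM (fun y => `|g y| ^+ 3) <= lam ^+ 3 * (E ^+ 3 * D).
Proof.
rewrite mulrA -exprMn -ExZ; last exact: wt_ig.
apply: Ex_le => //; first exact: bm_ig.
by move=> y; apply: (@pow_le _ _ _ 1) => //; rewrite expr1.
Qed.

Let mrho : measurable_fun setT rho.
Proof. by apply: measurable_funB; [exact: bg.1|exact: measurable_dotr]. Qed.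

Let rho2_le y : rho y ^+ 2 <= (lam ^+ 2 * E) ^+ 2 * wt y.
Proof.
rewrite -(real_normK (num_real (rho y))).
by apply: (@pow_le _ _ _ 2).
Qed.

Let ig_rho2 : ig gM (fun y => rho y ^+ 2).
Proof.
apply: (ig_le (g := fun y => (lam ^+ 2 * E) ^+ 2 * wt y)) => //.
- exact: measurable_funX.
- by move=> y; rewrite ger0_norm ?sqr_ge0.
Qed.

Let rho2_Ex : Ex gM (fun y => rho y ^+ 2) <= lam ^+ 4 * (E ^+ 2 * D).
Proof.
rewrite (_ : lam ^+ 4 * _ = (lam ^+ 2 * E) ^+ 2 * D); last by rewrite /D; ring.
by rewrite -ExZ; [exact: Ex_le|exact: wt_ig].
Qed.

Let rho_scaled : (1 + lam^-1) * (lam ^+ 4 * (E ^+ 2 * D)) <= 2 * (lam ^+ 3 * (E ^+ 2 * D)).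
Proof.
have l0 : lam != 0 by rewrite gt_eqF.
have -> : (1 + lam^-1) * (lam ^+ 4 * (E ^+ 2 * D)) = (lam + 1) * (lam ^+ 3 * (E ^+ 2 * D)).
  by field.
have l2 : lam + 1 <= 2 by move: lam1; lra.
apply: (ler_wpM2r _ l2).
by rewrite mulr_ge0 ?exprn_ge0 ?(ltW lam0)// mulr_ge0// sqr_ge0.
Qed.

Let lamV0 : 0 <= 1 + lam^-1. Proof. by rewrite addr_ge0// invr_ge0 ltW. Qed.

(** Read backwards, a lower bound of the variance [q] by its linear part, through which [Ent gM h]
    is bounded below by the slope. *)
Let slope_le : c2 R * sqnorm V <= (1 + lam) * q + 2 * (lam ^+ 3 * (E ^+ 2 * D)).
Proof.
have igV2 : ig gM (fun y => dot V y ^+ 2).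
  apply: ge0_ig; [by apply: measurable_funX; exact: measurable_dotr|by move=> y; exact: sqr_ge0|].
  by rewrite gam_dot2 ltry.
have -> : c2 R * sqnorm V = Ex gM (fun y => dot V y ^+ 2).
  by apply: EFin_inj; rewrite ExE// gam_dot2.
apply: le_trans (lerD (lexx _) rho_scaled).
apply: le_trans (lerD (lexx _) (ler_wpM2l lamV0 rho2_Ex)).
rewrite -ExZ; last exact: bm_ig.
rewrite -ExZ// -ExD; [|exact/bm_ig/bmZ|exact: igZ].
apply: Ex_le => //; first by apply: igD; [exact/bm_ig/bmZ|exact: igZ].
move=> y; rewrite (_ : dot V y = g y + - rho y); last by rewrite /rho; ring.
by rewrite -(sqrrN (rho y)); exact: sqD_le.
Qed.

Let m_rng : a <= m. Proof. by have /andP[] := Ex_rng gM rh. Qed.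

Section fixed_matrix.
Variable S : Mat R M K.
Hypothesis gS : Good S.

Let av := vpart (adjM S V).
Let aw := wpart (adjM S V).

Let mS x : measurable_fun setT (fun w : Config R N => appM S (catc x w)).
Proof. by apply: measurable_appM_cat => //; exact: measurable_cst. Qed.

Let bgS x : bm (fun w => g (appM S (catc x w))). Proof. exact: (bm_comp bg (mS x)). Qed.

Let dotS x w : dot V (appM S (catc x w)) = dot av x + dot aw w.
Proof. by rewrite -dot_adjM (catc_parts (adjM S V)) dot_cat. Qed.

Let NS_center x : NS S h x - m = Ex gN (fun w => g (appM S (catc x w))).
Proof.
rewrite ExB ?Ex_cst//; first exact: (bm_ig _ (bm_comp bh (mS x))).
exact/bm_ig/bm_cst.
Qed.

Let rS x w := g (appM S (catc x w)) - dot av x - dot aw w.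

Let rSE x w : rS x w = rho (appM S (catc x w)).
Proof. by rewrite /rho dotS /rS; ring. Qed.

Let bgd x : bm (fun w => g (appM S (catc x w)) - dot av x).
Proof. exact: bmB (bgS x) (bm_cst _ _). Qed.

Let ig_rS x : ig gN (rS x).
Proof. by apply: igB; [exact/bm_ig/bgd|exact: dot_ig]. Qed.

Let ig_dot2 k (U : Config R k) : ig (gam R k) (fun y => dot U y ^+ 2).
Proof.
apply: ge0_ig; [by apply: measurable_funX; exact: measurable_dotr|by move=> y; exact: sqr_ge0|].
by rewrite gam_dot2 ltry.
Qed.

Let ig_rS2 x : ig gN (fun w => rS x w ^+ 2).
Proof.
apply: (ig_le (g := fun w => 2 * (g (appM S (catc x w)) - dot av x) ^+ 2 + 2 * dot aw w ^+ 2)).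
- apply: measurable_funX; apply: measurable_funB; first exact: (bgd x).1.
  exact: measurable_dotr.
- move=> w; rewrite ger0_norm ?sqr_ge0// /rS.
  have := @sqD_le R 1 (g (appM S (catc x w)) - dot av x) (- dot aw w) ltr01.
  by rewrite sqrrN invr1.
- apply: igD; apply: igZ; last exact: ig_dot2.
  exact: (bm_ig _ (bmM (bgd x) (bgd x))).
Qed.

Let NS_sq_point x : (NS S h x - m) ^+ 2 <=
  (1 + lam) * dot av x ^+ 2 + (1 + lam^-1) * Ex gN (fun w => rho (appM S (catc x w)) ^+ 2).
Proof.
have -> : NS S h x - m = dot av x + Ex gN (rS x).
  rewrite [Ex gN (rS x)](ExB (bm_ig gN (bgd x)) (dot_ig aw)).
  rewrite (ExB (bm_ig gN (bgS x)) (bm_ig gN (bm_cst _ (dot av x)))).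
  by rewrite dot_mean0 NS_center Ex_cst; ring.
apply: (le_trans (sqD_le _ _ lam0)); apply: lerD; first exact: lexx.
apply: ler_wpM2l => //; apply: (le_trans (sq_Ex (ig_rS x) (ig_rS2 x))).
by rewrite le_eqVlt; apply/orP; left; apply/eqP; apply: eq_Ex => w; rewrite rSE.
Qed.

Let bNS : bm (fun x => NS S h x - m).
Proof. exact: bmB (rng_bm (rng_NS S rh)) (bm_cst _ _). Qed.

(** Integrating out [w] kills the linear form [dot aw w], so only the first block [av] of [adjM S V]
    contributes; its squared norm is [wnorm (two 1 0) (adjM S V)]. The remainder is transported back
    to [gam R M] by [Good S]. *)
Lemma NS_sq : Ex gM (fun x => (NS S h x - m) ^+ 2) <=
  (1 + lam) * (c2 R * wnorm (two 1 0) (adjM S V)) + 2 * (lam ^+ 3 * (E ^+ 2 * D)).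
Proof.
apply: le_trans (lerD (lexx _) rho_scaled).
apply: le_trans (lerD (lexx _) (ler_wpM2l lamV0 rho2_Ex)).
have l10 : 0 <= 1 + lam by rewrite addr_ge0// ltW.
have nr : nnm (fun y => (rho y ^+ 2)%:E).
  split=> [|y]; last by rewrite lee_fin sqr_ge0.
  by apply/measurable_EFinP; exact: measurable_funX.
have nd : nnm (fun x => (dot av x ^+ 2)%:E).
  split=> [|y]; last by rewrite lee_fin sqr_ge0.
  by apply/measurable_EFinP; apply: measurable_funX; exact: measurable_dotr.
have nrS : nnm (fun x => \int[gN]_w (rho (appM S (catc x w)) ^+ 2)%:E)%E.
  apply: (@nnm_integral _ _ _ _ _ gN (fun x w => (rho (appM S (catc x w)) ^+ 2)%:E)).
  by apply: (nnm_comp nr); apply: measurable_appM_cat => //; exact: measurable_cst.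
rewrite -lee_fin EFinD !EFinM ExE; last exact: (bm_ig _ (bmM bNS bNS)).
have e1 : (\int[gM]_y (rho y ^+ 2)%:E =
    \int[gM]_x \int[gN]_w (rho (appM S (catc x w)) ^+ 2)%:E)%E := esym (Good_cat gS nr).
rewrite (ExE ig_rho2) e1 -(EFinM (c2 R)) wnorm_two10 -gam_dot2.
rewrite -!ge0_integralZl//; [|exact: nrS.1|by move=> x _; exact: nrS.2|exact: nd.1|by move=> x _; exact: nd.2].
rewrite -ge0_integralD//; [|by move=> x _; exact: (nnmZ l10 nd).2|exact: (nnmZ l10 nd).1
  |by move=> x _; exact: (nnmZ lamV0 nrS).2|exact: (nnmZ lamV0 nrS).1].
apply: ge0_le_integral => //.
- by move=> x _; rewrite lee_fin sqr_ge0.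
- by apply/measurable_EFinP; exact: (bmM bNS bNS).1.
- by have := (nnmD (nnmZ l10 nd) (nnmZ lamV0 nrS)).1.
- move=> x _; have i2 : ig gN (fun w => rho (appM S (catc x w)) ^+ 2).
    by rewrite (_ : (fun w => _) = fun w => rS x w ^+ 2)//; apply/funext => w; rewrite rSE.
  by rewrite -(ExE i2) -!EFinM -EFinD lee_fin; exact: NS_sq_point.
Qed.

Lemma NS_cube : Ex gM (fun x => `|NS S h x - m| ^+ 3) <= lam ^+ 3 * (E ^+ 3 * D).
Proof.
apply: (le_trans _ cube_le); rewrite -(Ex_Good gS bg3).
have bn := bm_norm bNS.
apply: Ex_le.
- exact: (bm_ig _ (bmM bn (bmM bn bn))).
- apply: bm_ig; apply: (bm_Ex gN (f := fun x w => `|g (appM S (catc x w))| ^+ 3)).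
  by apply: (bm_comp bg3); apply: measurable_appM_cat => //; exact: measurable_cst.
- by move=> x; rewrite NS_center; exact: cube_Ex.
Qed.

Lemma NS_mean : Ex gM (NS S h) = m. Proof. exact: Ex_Good. Qed.

Lemma NS_Ent : Ent gM (NS S h) <=
  ((1 + lam) * (c2 R * wnorm (two 1 0) (adjM S V)) + 2 * (lam ^+ 3 * (E ^+ 2 * D))) / (2 * m)
  + lam ^+ 3 * (E ^+ 3 * D) / a ^+ 2.
Proof.
have := Ent_taylor gM a0 (rng_NS S rh); rewrite NS_mean => /ler_normlP[_ h1].
have m0 : 0 < m := lt_le_trans a0 m_rng.
have h2 := ler_wpM2r (_ : 0 <= (2 * m)^-1) NS_sq.
have h3 := ler_wpM2r (_ : 0 <= (a ^+ 2)^-1) NS_cube.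
have {}h2 := h2 _; have {}h3 := h3 _.
have i1 : 0 <= (2 * m)^-1 by rewrite invr_ge0 mulr_ge0// ltW.
have i2 : 0 <= a ^- 2 by rewrite invr_ge0 sqr_ge0.
by have := h2 i1; have := h3 i2; lra.
Qed.

End fixed_matrix.

Lemma Ent_lower : q / (2 * m) - lam ^+ 3 * (E ^+ 3 * D) / a ^+ 2 <= Ent gM h.
Proof.
have := Ent_taylor gM a0 rh => /ler_normlP[h1 _].
have i2 : 0 <= a ^- 2 by rewrite invr_ge0 sqr_ge0.
by have := ler_wpM2r i2 cube_le; move: h1; rewrite -/m -/g -/q; lra.
Qed.

Section averaged.
Variables (lamS lamR mu t : R).
Hypotheses (lamS0 : 0 < lamS) (lamR0 : 0 < lamR) (mu0 : 0 < mu) (t0 : 0 <= t).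
Hypotheses (M0 : (0 < M)%N) (MN : (M <= N)%N).
Local Notation nu := (nu M N lamS0 lamR0 mu0 t0).
Local Notation kp := (kappa M N mu t).

(** Depends on neither [h], [V] nor [lam], as the iteration over scales requires. The [2] comes from
    the remainder of [NS_sq]; in [kp + 1] the two parts are the cubic errors of [Ent_lower] and
    [NS_cube]. *)
Definition defect_cst := (7 * kp + 2) * (E ^+ 2 * D) / a + (kp + 1) * (E ^+ 3 * D) / a ^+ 2.

Lemma kappa_ge0 : 0 <= kp.
Proof. by rewrite addr_ge0 ?mulr_ge0 ?divr_ge0 ?expR_ge0. Qed.

Lemma bm_Ent_NS : bm (fun S : Mat R M K => Ent gM (NS S h)).
Proof.
apply: (bm_Ent gM a0 (F := fun y S => NS S h y) (b := b)).
apply: (rng_NS_param (S := snd) (x := fst) (h := fun=> h)) => //.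
exact: (rng_comp rh measurable_snd).
Qed.

(** [NS S] preserves the mean [m] when [Good S] holds, so both entropies carry the same factor
    [1 / (2 m)] at second order; the quadratic forms left over are matched by [nu_second_moment]. *)
Lemma local_entropy :
  Ex nu (fun S => Ent gM (NS S h)) <= kp * Ent gM h + defect_cst * lam ^+ 3.
Proof.
have m0 : 0 < m := lt_le_trans a0 m_rng.
have k0 := kappa_ge0.
pose X := E ^+ 2 * D; pose Y := E ^+ 3 * D.
have X0 : 0 <= X by rewrite mulr_ge0 ?sqr_ge0.
have Y0 : 0 <= Y by rewrite mulr_ge0 ?exprn_ge0.
have l0 := ltW lam0; have l3 : 0 <= lam ^+ 3 by rewrite exprn_ge0.
have im : 0 < (2 * m)^-1 by rewrite invr_gt0 mulr_gt0.
have im0 := ltW im.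
have ia : 0 < a ^- 2 by rewrite invr_gt0 exprn_gt0.
pose al := (1 + lam) * c2 R / (2 * m).
pose be := 2 * (lam ^+ 3 * X) / (2 * m) + lam ^+ 3 * Y / a ^+ 2.
have al0 : 0 <= al by rewrite !mulr_ge0 ?c2_ge0// addr_ge0.
have be0 : 0 <= be.
  apply: addr_ge0; apply: mulr_ge0; rewrite ?(ltW ia)//; last exact: mulr_ge0.
  by rewrite mulr_ge0// mulr_ge0.
have w0 S : 0 <= wnorm (two 1 0) (adjM S V) :> R.
  by rewrite wnorm_ge0// => k; rewrite /two; case: ifP.
have nw : nnm (fun S : Mat R M K => (wnorm (two 1 0) (adjM S V))%:E).
  split=> [|S]; last by rewrite lee_fin.
  by apply/measurable_EFinP; apply: measurable_wnorm; exact: measurable_adjM.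
have step : Ex nu (fun S => Ent gM (NS S h)) <= al * (kp * sqnorm V) + be.
  rewrite -lee_fin ExE; last exact: (bm_ig _ bm_Ent_NS).
  apply: (@le_trans _ _ (\int[nu]_S (al%:E * (wnorm (two 1 0) (adjM S V))%:E + be%:E))%E).
    apply: nu_le.
    - split=> [|S]; first by apply/measurable_EFinP; exact: bm_Ent_NS.1.
      by rewrite lee_fin; exact: (Ent_ge0 gM a0 (rng_NS S rh)).
    - by apply: nnmD; [exact: nnmZ|exact: nnm_cst].
    - move=> S gS; rewrite -EFinM -EFinD lee_fin; apply: (le_trans (NS_Ent gS)).
      by rewrite /al /be -/X -/Y; lra.
  rewrite ge0_integralD//; last 2 first.
  - by move=> S _; exact: (nnmZ al0 nw).2.
  - exact: (nnmZ al0 nw).1.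
  rewrite ge0_integralZl//; last 2 first.
  - exact: nw.1.
  - by move=> S _; exact: nw.2.
  by rewrite nu_second_moment// integral_prob_cst -EFinM -EFinD.
apply: (le_trans step).
have hq := q_le; have hs := slope_le; have hl := Ent_lower; rewrite -/X -/Y in hq hs hl.
have q0 : 0 <= q by apply: Ex_ge0 => y; exact: sqr_ge0.
(* Since [q <= lam ^ 2 X], the excess of [(1 + lam) ^ 2 q] over [q] is at most [3 lam ^ 3 X]; the
   remainder of [slope_le] adds [2 (1 + lam) lam ^ 3 X <= 4 lam ^ 3 X]. Their sum is the 7 of
   [defect_cst]. *)
have e1 : (1 + lam) * (c2 R * sqnorm V) <= q + 3 * (lam ^+ 3 * X) + 4 * (lam ^+ 3 * X).
  have p1 : 0 <= 1 + lam by rewrite addr_ge0.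
  apply: (le_trans (ler_wpM2l p1 hs)).
  have h1 : lam * q <= lam ^+ 3 * X.
    by rewrite exprS -mulrA; exact: ler_wpM2l.
  have h2 : lam * (lam * q) <= lam ^+ 3 * X.
    by apply: le_trans h1; apply: ler_piMl => //; exact: mulr_ge0.
  have h3 : lam * (lam ^+ 3 * X) <= lam ^+ 3 * X.
    by apply: ler_piMl => //; exact: mulr_ge0.
  by lra.
have e2 : al * (kp * sqnorm V) <= kp * (q / (2 * m)) + kp * (7 * (lam ^+ 3 * X)) / (2 * m).
  have := ler_wpM2l (mulr_ge0 k0 im0) e1.
  by rewrite /al; lra.
have e3 := ler_wpM2l k0 hl.
have X3 : 0 <= lam ^+ 3 * X by exact: mulr_ge0.
have e4 : (7 * kp + 2) * (lam ^+ 3 * X) / (2 * m) <= (7 * kp + 2) * (lam ^+ 3 * X) / a.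
  apply: ler_wpM2l; first by rewrite mulr_ge0// addr_ge0// mulr_ge0.
  rewrite lef_pV2 ?posrE ?mulr_gt0//; apply: (le_trans m_rng).
  by rewrite ler_peMl ?ler1n// ltW.
rewrite /be /defect_cst -/X -/Y.
have -> : ((7 * kp + 2) * X / a + (kp + 1) * Y / a ^+ 2) * lam ^+ 3 =
  (7 * kp + 2) * (lam ^+ 3 * X) / a + kp * (lam ^+ 3 * Y / a ^+ 2) + lam ^+ 3 * Y / a ^+ 2.
  by ring.
by lra.
Qed.

End averaged.
End local.

Lemma Ex_sum d (T : measurableType d) (R : realType) (P : probability T R) (I : Type)
  (s : seq I) (f : I -> T -> R) : (forall i, bm (f i)) ->
  Ex P (fun x => \sum_(i <- s) f i x) = \sum_(i <- s) Ex P (f i).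
Proof.
move=> bf; elim: s => [|i s IH].
  by rewrite big_nil -[RHS](Ex_cst P); apply: eq_Ex => x; rewrite big_nil.
rewrite big_cons -IH -ExD; [|exact: bm_ig|exact/bm_ig/bm_sum].
by apply: eq_Ex => x; rewrite big_cons.
Qed.

Lemma norm_le_Ex d (T : measurableType d) (R : realType) (P : probability T R) (f : T -> R) c :
  bm f -> (forall x, `|f x| <= c) -> `|Ex P f| <= c.
Proof.
move=> bf fc; apply: (le_trans (Ex_norm (bm_ig P bf))).
rewrite -(Ex_cst P c); apply: Ex_le => //; first exact/bm_ig/bm_norm.
exact/bm_ig/bm_cst.
Qed.

(** * Contraction for smooth densities *)

Section smooth.
Variables (R : realType) (M : nat) (a b C : R).
Local Notation gM := (gam R M).

(* lam is the scale: V is a gradient of size lam and the second order remainder has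
   size lam^2. *)
Definition smooth (lam : R) (h : Config R M -> R) := rng a b h /\
  exists V : Config R M -> Config R M, [/\ forall q, bm (fun x => co (V x) q),
    forall x y, `|h (addc x y) - h x| <= lam * C * n1 y &
    forall x y, `|h (addc x y) - h x - dot (V x) y| <= lam ^+ 2 * C * n1 y ^+ 2].

Lemma n1Z (c : R) (y : Config R M) : 0 <= c -> n1 (sclc c y) = c * n1 y.
Proof.
move=> c0; rewrite /n1 mulr_sumr; apply: eq_bigr => p _.
by rewrite co_sclc normrM ger0_norm.
Qed.

Let hs0 : 0 <= hs R := ltW (hs_gt0 R).

Lemma mid_addr (p y z : Config R M) : mid p (addc y z) = addc (mid p y) (sclc (hs R) z).
Proof. by rewrite /mid sclcD addcA. Qed.

Lemma mid_addl (p y z : Config R M) : mid (addc p z) y = addc (mid p y) (sclc (hs R) z).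
Proof. by rewrite /mid sclcD -!addcA (addcC (sclc _ z)). Qed.

Let scaled_bounds lam h V (x z : Config R M) :
  (forall x y, `|h (addc x y) - h x| <= lam * C * n1 y) ->
  (forall x y, `|h (addc x y) - h x - dot (V x) y| <= lam ^+ 2 * C * n1 y ^+ 2) ->
  `|h (addc x (sclc (hs R) z)) - h x| <= lam * hs R * C * n1 z /\
  `|h (addc x (sclc (hs R) z)) - h x - dot (sclc (hs R) (V x)) z| <= (lam * hs R) ^+ 2 * C * n1 z ^+ 2.
Proof.
move=> lip quad; split.
  apply: (le_trans (lip _ _)); rewrite n1Z//.
  by rewrite le_eqVlt; apply/orP; left; apply/eqP; ring.
rewrite dotZl -dotZr; apply: (le_trans (quad _ _)); rewrite n1Z//.
by rewrite le_eqVlt; apply/orP; left; apply/eqP; ring.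
Qed.

Lemma smooth_zoom lam h p : smooth lam h -> smooth (lam * hs R) (zoom h p).
Proof.
move=> [rh [V [bV lip quad]]]; split; first exact: rng_zoom.
have mm : measurable_fun setT (fun y : Config R M => mid p y) by exact: measurable_mid.
exists (fun y => sclc (hs R) (V (mid p y))); split=> [q|y z|y z].
- rewrite (_ : (fun x => _) = fun x => hs R * co (V (mid p x)) q); last first.
    by apply/funext => x; rewrite co_sclc.
  by apply: bmZ; exact: (bm_comp (bV q) mm).
- by rewrite /zoom mid_addr; exact: (scaled_bounds _ _ lip quad).1.
- by rewrite /zoom mid_addr; exact: (scaled_bounds _ _ lip quad).2.
Qed.

(** Pointwise bounds survive averaging over [y], with the average of the rescaled gradients as new
    gradient; this is why [smooth] asks for bounded measurable coordinates of [V]. *)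
Lemma smooth_coarse lam h : smooth lam h -> smooth (lam * hs R) (coarse h).
Proof.
move=> [rh [V [bV lip quad]]]; split; first exact: rng_coarse.
have mm : measurable_fun setT (fun q : Config R M * Config R M => mid q.1 q.2).
  exact: measurable_mid.
have bz p : bm (fun y => h (mid p y)) := rng_bm (rng_zoom p rh).
have bVm p q : bm (fun y => hs R * co (V (mid p y)) q).
  by apply: bmZ; apply: (bm_comp (bV q)); exact: (measurableT_comp mm (measurable_pair1 p)).
have bd p z : bm (fun y => dot (sclc (hs R) (V (mid p y))) z).
  rewrite (_ : (fun y => _) = fun y => \sum_q hs R * co (V (mid p y)) q * co z q); last first.
    by apply/funext => y; apply: eq_bigr => q _; rewrite co_sclc.
  by apply: bm_sum => q; apply: bmM; [exact: bVm|exact: bm_cst].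
have dE p z : dot (mkC (fun q => Ex gM (fun y => hs R * co (V (mid p y)) q))) z =
    Ex gM (fun y => dot (sclc (hs R) (V (mid p y))) z).
  rewrite (eq_Ex gM (g := fun y => \sum_q co z q * (hs R * co (V (mid p y)) q))); last first.
    by move=> y; apply: eq_bigr => q _; rewrite co_sclc mulrC.
  rewrite Ex_sum; last by move=> q; exact: bmZ.
  by apply: eq_bigr => q _; rewrite co_mkC mulrC [RHS]ExZ; [|exact: bm_ig].
exists (fun p => mkC (fun q => Ex gM (fun y => hs R * co (V (mid p y)) q))); split=> [q|p z|p z].
- rewrite (_ : (fun x => _) = fun p => Ex gM (fun y => hs R * co (V (mid p y)) q)); last first.
    by apply/funext => p; rewrite co_mkC.
  apply: (bm_Ex gM (f := fun p y => hs R * co (V (mid p y)) q)).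
  by apply: bmZ; exact: (bm_comp (bV q) mm).
- rewrite -ExB; [|exact/bm_ig/bz|exact/bm_ig/bz].
  apply: norm_le_Ex; first exact: bmB (bz _) (bz _).
  by move=> y; rewrite /zoom mid_addl; exact: (scaled_bounds _ _ lip quad).1.
- rewrite dE -ExB; [|exact/bm_ig/bz|exact/bm_ig/bz].
  have bB : bm (fun y => zoom h (addc p z) y - zoom h p y) by exact: bmB (bz _) (bz _).
  rewrite -ExB; [|exact: bm_ig|exact/bm_ig/bd].
  apply: norm_le_Ex; first exact: bmB bB (bd _ _).
  by move=> y; rewrite /zoom mid_addl; exact: (scaled_bounds _ _ lip quad).2.
Qed.

End smooth.

(** * Iteration of the two-scale inequality *)

Section contraction.
Variables (R : realType) (M N : nat) (a b C : R).
Hypotheses (a0 : 0 < a) (C0 : 0 <= C).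
Local Notation K := (M + N)%N.
Local Notation gM := (gam R M).
Local Notation gN := (gam R N).
Variables (lamS lamR mu t : R).
Hypotheses (lamS0 : 0 < lamS) (lamR0 : 0 < lamR) (mu0 : 0 < mu) (t0 : 0 <= t).
Hypotheses (M0 : (0 < M)%N) (MN : (M <= N)%N).
Local Notation nu := (nu M N lamS0 lamR0 mu0 t0).
Local Notation kp := (kappa M N mu t).

Definition gap (h : Config R M -> R) := Ex nu (fun S => Ent gM (NS S h)) - kp * Ent gM h.

Lemma bm_Ent_zoom h : rng a b h -> bm (fun p => Ent gM (zoom h p)).
Proof.
move=> rh; apply: (bm_Ent gM a0 (F := fun y p => zoom h p y) (b := b)).
exact: (rng_comp (rng_zoom_param rh) (@measurable_swap _ _ _ _)).
Qed.

Lemma bm_Ent_NS_zoom h : rng a b h ->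
  bm (fun q : Config R M * Mat R M K => Ent gM (NS q.2 (zoom h q.1))).
Proof.
move=> rh; apply: (bm_Ent gM a0 (F := fun y q => NS q.2 (zoom h q.1) y) (b := b)).
apply: (rng_NS_param (S := fun r => r.2.2) (x := fst) (h := fun r => zoom h r.2.1)).
- exact: (measurableT_comp measurable_snd measurable_snd).
- exact: measurable_fst.
- apply: (rng_comp rh); apply: measurable_mid.
    exact: (measurableT_comp measurable_fst (measurableT_comp measurable_snd measurable_fst)).
  exact: measurable_snd.
Qed.

(** The inequality [NS_Ent_two_scale] is averaged over [nu], and [kp] times the equality
    [Ent_two_scale] is subtracted from it. *)
Lemma gap_split h : rng a b h -> gap h <= gap (coarse h) + Ex gM (fun p => gap (zoom h p)).
Proof.
move=> rh; have rz := rng_zoom_param rh; have rc := rng_coarse rh.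
pose W p (S : Mat R M K) := Ent gM (NS S (zoom h p)).
have bW : bm (fun q : Config R M * Mat R M K => W q.1 q.2) := bm_Ent_NS_zoom rh.
have bc : bm (fun S : Mat R M K => Ent gM (NS S (coarse h))) := bm_Ent_NS N a0 rc.
have bW' : bm (fun q : Mat R M K * Config R M => W q.2 q.1) := bm_comp bW (@measurable_swap _ _ _ _).
have bWS : bm (fun S => Ex gM (fun p => W p S)) by exact: (bm_Ex gM (f := fun S p => W p S)).
have bz := bm_Ent_zoom rh.
have W0 p S : 0 <= W p S by exact: (Ent_ge0 gM a0 (rng_NS S (rng_zoom p rh))).
have step : Ex nu (fun S => Ent gM (NS S h)) <=
    Ex nu (fun S => Ent gM (NS S (coarse h)) + Ex gM (fun p => W p S)).
  have bs := bmD bc bWS.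
  rewrite -lee_fin ExE; last exact: (bm_ig _ (bm_Ent_NS N a0 rh)).
  rewrite ExE; last exact: bm_ig.
  apply: nu_le.
  - split=> [|S]; first by apply/measurable_EFinP; exact: (bm_Ent_NS N a0 rh).1.
    by rewrite lee_fin; exact: (Ent_ge0 gM a0 (rng_NS S rh)).
  - split=> [|S]; first by apply/measurable_EFinP; exact: bs.1.
    rewrite lee_fin addr_ge0//; first exact: (Ent_ge0 gM a0 (rng_NS S rc)).
    exact: Ex_ge0.
  - by move=> S gS; rewrite lee_fin; exact: (NS_Ent_two_scale a0 gS rh).
have gz : Ex gM (fun p => gap (zoom h p)) = Ex nu (fun S => Ex gM (fun p => W p S)) - kp * Ex gM (fun p => Ent gM (zoom h p)).
  have bWp : bm (fun p => Ex nu (W p)) by exact: (bm_Ex nu (f := W)).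
  rewrite ExB; [|exact: bm_ig|exact/bm_ig/bmZ].
  by rewrite ExZ; [rewrite (Ex_fubini gM nu (f := W))|exact: bm_ig].
rewrite (ExD (bm_ig nu bc) (bm_ig nu bWS)) in step.
rewrite gz /gap (Ent_two_scale a0 rh) mulrDr [leRHS]addrACA -opprD.
exact: (lerD step (lexx _)).
Qed.

Lemma bm_gap_zoom h : rng a b h -> bm (fun p => gap (zoom h p)).
Proof.
move=> rh; apply: bmB; last exact/bmZ/bm_Ent_zoom.
apply: (bm_Ex nu (f := fun p S => Ent gM (NS S (zoom h p)))).
exact: bm_Ent_NS_zoom.
Qed.

Let K3 := defect_cst M N a C mu t.

(* Each splitting doubles the number of terms and divides the cubic error by 2 sqrt 2,
   which leaves a factor 1 / sqrt 2. *)
Lemma gap_iter n lam h : 0 < lam -> lam <= 1 -> smooth a b C lam h ->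
  gap h <= hs R ^+ n * (K3 * lam ^+ 3).
Proof.
have h0 := hs_gt0 R; have h2 := hs2 R.
elim: n lam h => [|n IH] lam h l0 l1 sh.
  have [rh [V [bV lip quad]]] := sh.
  rewrite mul1r /gap lerBlDl.
  have z0 y : addc (mkC (fun=> 0)) y = y :> Config R M.
    by apply: co_inj => p; rewrite co_addc co_mkC add0r.
  apply: (@local_entropy _ _ _ a b a0 h (V (mkC (fun=> 0))) (h (mkC (fun=> 0))) lam C) => //.
    by move=> y; have := lip (mkC (fun=> 0)) y; rewrite z0.
  by move=> y; have := quad (mkC (fun=> 0)) y; rewrite z0.
have hs1 : hs R <= 1 by nra.
have l0' : 0 < lam * hs R by exact: mulr_gt0.
have l1' : lam * hs R <= 1 by apply: le_trans l1; rewrite ger_pMr.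
have rh := sh.1.
have h1 := IH _ _ l0' l1' (smooth_coarse sh).
have h3 : Ex gM (fun p => gap (zoom h p)) <= hs R ^+ n * (K3 * (lam * hs R) ^+ 3).
  rewrite -(Ex_cst gM (hs R ^+ n * _)); apply: Ex_le.
  - exact: (bm_ig _ (bm_gap_zoom rh)).
  - exact/bm_ig/bm_cst.
  - by move=> p; exact: IH _ _ l0' l1' (smooth_zoom p sh).
apply: (le_trans (gap_split rh)); apply: (le_trans (lerD h1 h3)).
rewrite le_eqVlt; apply/orP; left; apply/eqP.
transitivity ((hs R ^+ 2 + hs R ^+ 2) * (hs R ^+ n.+1 * (K3 * lam ^+ 3))); last by rewrite h2 mul1r.
by rewrite [hs R ^+ n.+1]exprS; ring.
Qed.

Lemma smooth_contraction h : smooth a b C 1 h -> gap h <= 0.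
Proof.
move=> sh; have h0 := hs_gt0 R; have h2 := hs2 R.
have hs1 : `|hs R| < 1 by rewrite gtr0_norm//; nra.
have cv : (fun n => hs R ^+ n * (K3 * 1 ^+ 3)) @ \oo --> 0 * (K3 * 1 ^+ 3).
  by apply: cvgMl; exact: cvg_expr.
rewrite mul0r in cv; rewrite -(cvg_lim _ cv)//; apply: limr_ge; first by apply/cvg_ex; exists 0.
by apply: nearW => n; exact: gap_iter.
Qed.

End contraction.

Lemma Ex_cvg d (T : measurableType d) (R : realType) (P : probability T R)
  (fn : nat -> T -> R) (f : T -> R) (C : R) : (forall n, measurable_fun setT (fn n)) ->
  (forall n x, `|fn n x| <= C) -> (forall x, fn n x @[n --> \oo] --> f x) ->
  Ex P (fn n) @[n --> \oo] --> Ex P f.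
Proof.
move=> mfn fnC fnf.
have mf : measurable_fun setT f by exact: (measurable_fun_cvg mfn (fun x _ => fnf x)).
have [|||||igf _ cv] := @dominated_convergence _ _ _ P setT measurableT
    (fun n x => (fn n x)%:E) (fun x => (f x)%:E) (fun=> C%:E).
- by move=> n; exact/measurable_EFinP.
- exact/measurable_EFinP.
- by apply: aeW => x _; apply: cvg_EFin; [exact: nearW|exact: fnf].
- exact: finite_measure_integrable_cst.
- by apply: aeW => x n _; rewrite /= lee_fin.
by rewrite -(ExE igf) in cv; exact: fine_cvg cv.
Qed.

(** * Density of smooth functions *)

Section ramp.
Variable R : realType.
Implicit Types u d : R.

(** A profile equal to 1 on the negative half-line and vanishing at infinity; sharpened by a large
    slope it tends to the indicator of a half-line. The square makes the junction at 0
    differentiable, with Lipschitz derivative [decay']. *)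
Definition decay u := (1 + Num.max u 0 ^+ 2)^-1.
Definition decay' u := - 2 * Num.max u 0 * decay u ^+ 2.

Lemma decay_itv u : 0 <= decay u <= 1.
Proof.
have h : 1 <= 1 + Num.max u 0 ^+ 2 by rewrite lerDl sqr_ge0.
by rewrite invr_ge0 (le_trans ler01 h) invf_le1// (lt_le_trans ltr01 h).
Qed.

(** The last item is the first order expansion of the squared positive part: derivative [2 p],
    remainder between 0 and [d ^ 2]. *)
Let maxD u d (p := Num.max u 0) (q := Num.max (u + d) 0) :
  [/\ 0 <= p, 0 <= q, `|q - p| <= `|d| & 0 <= q ^+ 2 - p ^+ 2 - 2 * p * d <= d ^+ 2].
Proof.
have d1 := ler_norm d; have d2 := ler_norm (- d); rewrite normrN in d2.
rewrite /p /q; case: (leP u 0) => hu; case: (leP (u + d) 0) => hud.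
- split=> //; first by rewrite subrr normr0.
  by rewrite !expr0n/= mulr0 mul0r !subr0 lexx sqr_ge0.
- split; rewrite ?(ltW hud)//; first by rewrite ler_norml; apply/andP; split; lra.
  by rewrite mulr0 mul0r expr0n/= !subr0 sqr_ge0/=; nra.
- split; rewrite ?(ltW hu)//; first by rewrite ler_norml; apply/andP; split; lra.
  by apply/andP; split; nra.
- split; rewrite ?(ltW hu) ?(ltW hud)//; first by rewrite ler_norml; apply/andP; split; lra.
  by apply/andP; split; nra.
Qed.

Lemma decay_lip u d : `|decay (u + d) - decay u| <= `|d|.
Proof.
have [p0 q0 pq _] := maxD u d; rewrite /decay.
set p := Num.max u 0 in p0 pq *; set q := Num.max (u + d) 0 in q0 pq *.
have A0 : 0 < 1 + p ^+ 2 by rewrite ltr_pwDl// sqr_ge0.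
have B0 : 0 < 1 + q ^+ 2 by rewrite ltr_pwDl// sqr_ge0.
have -> : (1 + q ^+ 2)^-1 - (1 + p ^+ 2)^-1 = (p - q) * ((p + q) / ((1 + p ^+ 2) * (1 + q ^+ 2))).
  by field; rewrite !gt_eqF.
rewrite normrM distrC -[leRHS]mulr1; apply: ler_pM => //.
rewrite ger0_norm; last by rewrite divr_ge0 ?addr_ge0// mulr_ge0// ltW.
rewrite ler_pdivrMr ?mulr_gt0// mul1r.
have := sqr_ge0 (p - 1); have := sqr_ge0 (q - 1); have := mulr_ge0 (sqr_ge0 p) (sqr_ge0 q).
by move=> *; nra.
Qed.

Lemma measurable_decay : measurable_fun setT decay.
Proof.
apply: continuous_measurable_fun => x; apply/cvgrPdist_le => e e0; near=> y.
rewrite distrC -(subrKC x y); apply: (le_trans (decay_lip _ _)).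
by rewrite distrC; near: y; apply: cvgr_dist_le.
Unshelve. all: by end_near. Qed.

Lemma decay_quad u d : `|decay (u + d) - decay u - decay' u * d| <= 2 * d ^+ 2.
Proof.
have [p0 q0 pq /andP[e0 e1]] := maxD u d; rewrite /decay' /decay.
set p := Num.max u 0 in p0 pq e0 e1 *; set q := Num.max (u + d) 0 in q0 pq e0 e1 *.
set A := 1 + p ^+ 2; set B := 1 + q ^+ 2; set e := q ^+ 2 - p ^+ 2 - 2 * p * d in e0 e1 *.
have A0 : 0 < A by rewrite ltr_pwDl// sqr_ge0.
have B0 : 0 < B by rewrite ltr_pwDl// sqr_ge0.
(* Both terms of the numerator are of second order in [d]: [|q - p| <= |d|] and [e <= d ^ 2]. *)
have -> : B^-1 - A^-1 - (- 2 * p * A^-1 ^+ 2) * d =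
    (2 * (p * (q + p)) * (d * (q - p)) - A * e) / (A ^+ 2 * B).
  by rewrite /e /A /B; field; rewrite !gt_eqF.
have AB0 : 0 < A ^+ 2 * B by rewrite mulr_gt0// exprn_gt0.
rewrite normrM (@ger0_norm _ (_^-1)) ?invr_ge0 ?(ltW AB0)// ler_pdivrMr//.
have d2 : 0 <= d ^+ 2 by exact: sqr_ge0.
have t1 : `|d * (q - p)| <= d ^+ 2.
  by rewrite normrM -(real_normK (num_real d)) expr2 ler_wpM2l.
have t2 : 2 * (p * (q + p)) <= A ^+ 2 * B.
  rewrite /A /B; have := sqr_ge0 (p * q - 1); have := mulr_ge0 (sqr_ge0 p) (sqr_ge0 q).
  have := mulr_ge0 (sqr_ge0 (p ^+ 2)) (sqr_ge0 q); have := sqr_ge0 (p ^+ 2); have := sqr_ge0 q.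
  by move=> *; nra.
have t3 : A * e <= d ^+ 2 * (A ^+ 2 * B).
  apply: (@le_trans _ _ (A * d ^+ 2)); first by rewrite ler_wpM2l// ltW.
  rewrite mulrC ler_wpM2l// expr2 -mulrA ler_peMr ?(ltW A0)//.
  by rewrite mulr_ege1// lerDl sqr_ge0.
apply: (le_trans (ler_normB _ _)).
rewrite [X in _ + X]ger0_norm; last by rewrite mulr_ge0// ltW.
rewrite normrM ger0_norm; last by rewrite mulr_ge0// mulr_ge0// addr_ge0.
have t4 : 2 * (p * (q + p)) * `|d * (q - p)| <= A ^+ 2 * B * d ^+ 2.
  by apply: ler_pM => //; rewrite mulr_ge0// mulr_ge0// addr_ge0.
by lra.
Qed.

Lemma decay'_le u : `|decay' u| <= 2.
Proof.
rewrite /decay' /decay; set p := Num.max u 0.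
have p0 : 0 <= p by rewrite le_max lexx orbT.
have A0 : 0 < 1 + p ^+ 2 by rewrite ltr_pwDl// sqr_ge0.
rewrite !normrM normrN normr_nat (ger0_norm p0) ger0_norm; last first.
  by rewrite invr_ge0 ltW.
rewrite -mulrA -[leRHS]mulr1 ler_wpM2l// -invfM ler_pdivrMr ?mulr_gt0// mul1r.
by have := sqr_ge0 (p - 1); have := sqr_ge0 (p ^+ 2); nra.
Qed.

Lemma decay_le0 u : u <= 0 -> decay u = 1.
Proof. by move=> u0; rewrite /decay max_r// expr0n/= addr0 invr1. Qed.

Lemma decay_gt0 u : 0 < u -> decay u <= u^-1.
Proof.
move=> u0; rewrite /decay max_l ?(ltW u0)// lef_pV2 ?posrE//; last first.
  by rewrite ltr_pwDl// sqr_ge0.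
by have := sqr_ge0 (u - 1); nra.
Qed.

End ramp.

Section C11.
Variables (R : realType) (M : nat).
Local Notation gM := (gam R M).
Implicit Types k l : Config R M -> R.

(** [smooth] at scale 1 with no prescribed range and an existential constant; in this form the class
    is an algebra. *)
Definition C11 k := bm k /\ exists C V, [/\ 0 <= C, forall q, bm (fun x => co (V x) q),
    forall x y, `|k (addc x y) - k x| <= C * n1 y &
    forall x y, `|k (addc x y) - k x - dot (V x) y| <= C * n1 y ^+ 2].

Lemma C11_cst (c : R) : C11 (fun=> c).
Proof.
split; first exact: bm_cst.
exists 0, (fun=> mkC (fun=> 0)); split=> // [q|x y|x y].
- by rewrite (_ : (fun x => _) = fun=> 0); [exact: bm_cst|apply/funext => x; rewrite co_mkC].
- by rewrite subrr normr0 mul0r.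
- rewrite subrr /dot big1 ?subr0 ?normr0 ?mul0r// => p _.
  by rewrite co_mkC mul0r.
Qed.

Lemma C11D k l : C11 k -> C11 l -> C11 (fun x => k x + l x).
Proof.
move=> [bk [C [V [C0 bV lip quad]]]] [bl [C' [V' [C0' bV' lip' quad']]]]; split; first exact: bmD.
exists (C + C'), (fun x => addc (V x) (V' x)); split=> [|q|x y|x y]; first exact: addr_ge0.
- rewrite (_ : (fun x => _) = fun x => co (V x) q + co (V' x) q); first exact: bmD.
  by apply/funext => x; rewrite co_addc.
- rewrite opprD addrACA mulrDl; apply: (le_trans (ler_normD _ _)).
  by apply: lerD; [exact: lip|exact: lip'].
- rewrite dotDl (_ : _ - _ - _ = (k (addc x y) - k x - dot (V x) y) + (l (addc x y) - l x - dot (V' x) y)); last by ring.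
  rewrite mulrDl; apply: (le_trans (ler_normD _ _)).
  by apply: lerD; [exact: quad|exact: quad'].
Qed.

Lemma C11M k l : C11 k -> C11 l -> C11 (fun x => k x * l x).
Proof.
move=> [bk [C [V [C0 bV lip quad]]]] [bl [C' [V' [C0' bV' lip' quad']]]]; split; first exact: bmM.
have [_ [B kB]] := bk; have [_ [B' lB']] := bl.
pose z : Config R M := mkC (fun=> 0).
have B0 : 0 <= B := le_trans (normr_ge0 _) (kB z).
have B0' : 0 <= B' := le_trans (normr_ge0 _) (lB' z).
pose D := B * C' + B' * C + C * C'.
exists D, (fun x => addc (sclc (k x) (V' x)) (sclc (l x) (V x))).
split=> [|q|x y|x y]; first by rewrite !addr_ge0// mulr_ge0.
- rewrite (_ : (fun x => _) = fun x => k x * co (V' x) q + l x * co (V x) q).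
    by apply: bmD; exact: bmM.
  by apply/funext => x; rewrite co_addc !co_sclc.
- rewrite (_ : _ - _ = k (addc x y) * (l (addc x y) - l x) + l x * (k (addc x y) - k x)); last by ring.
  apply: (le_trans (ler_normD _ _)); rewrite !normrM.
  have h1 : `|k (addc x y)| * `|l (addc x y) - l x| <= B * (C' * n1 y) by exact: ler_pM.
  have h2 : `|l x| * `|k (addc x y) - k x| <= B' * (C * n1 y) by exact: ler_pM.
  have h3 : 0 <= C * C' * n1 y by rewrite !mulr_ge0// n1_ge0.
  by rewrite /D !mulrDl; lra.
- rewrite dotDl !dotZl (_ : _ - _ - _ = k x * (l (addc x y) - l x - dot (V' x) y) +
     l x * (k (addc x y) - k x - dot (V x) y) + (k (addc x y) - k x) * (l (addc x y) - l x)); last by ring.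
  rewrite /D [leRHS]mulrDl [X in _ <= X + _]mulrDl.
  apply: (le_trans (ler_normD _ _)); apply: lerD.
    apply: (le_trans (ler_normD _ _)); rewrite !normrM; apply: lerD; rewrite -mulrA; exact: ler_pM.
  rewrite normrM (_ : C * C' * _ = (C * n1 y) * (C' * n1 y)); last by ring.
  exact: ler_pM.
Qed.

Lemma C11_decay p (s c : R) : 0 <= s -> C11 (fun x => decay (s * (co x p - c))).
Proof.
move=> s0; have mu0 : measurable_fun setT (fun x : Config R M => s * (co x p - c)).
  by apply: measurable_funM => //; apply: measurable_funB => //; exact: measurable_co.
have bd : bm (fun x : Config R M => decay (s * (co x p - c))).
  apply: (@bm_itv _ _ _ _ 0 1) => [|x]; last exact: decay_itv.
  exact: (measurableT_comp (@measurable_decay R) mu0).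
split=> //.
have e (x y : Config R M) : s * (co (addc x y) p - c) = s * (co x p - c) + s * co y p.
  by rewrite co_addc; ring.
have cn (y : Config R M) : `|co y p| <= n1 y.
  by rewrite /n1 (bigD1 p)//= lerDl sumr_ge0.
exists (s + 2 * s ^+ 2), (fun x => mkC (fun q => (s * decay' (s * (co x p - c))) * (q == p)%:R)).
split=> [|q|x y|x y]; first by rewrite addr_ge0// mulr_ge0// sqr_ge0.
- rewrite (_ : (fun x => _) = fun x => (s * decay' (s * (co x p - c))) * (q == p)%:R); last first.
    by apply/funext => x; rewrite co_mkC.
  apply: bmM; last exact: bm_cst.
  apply: bmZ; split.
    apply: measurable_funM; last by apply: measurable_funX; exact: bd.1.
    by apply: measurable_funM => //; apply: measurable_maxr.
  by exists 2 => x; exact: decay'_le.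
- rewrite e; apply: (le_trans (decay_lip _ _)); rewrite normrM (ger0_norm s0) mulrDl.
  apply: (@le_trans _ _ (s * n1 y)); first exact: ler_wpM2l.
  by rewrite lerDl mulr_ge0 ?n1_ge0// mulr_ge0// sqr_ge0.
- rewrite e (_ : dot _ y = decay' (s * (co x p - c)) * (s * co y p)).
    apply: (le_trans (decay_quad _ _)).
    have h : (s * co y p) ^+ 2 <= s ^+ 2 * n1 y ^+ 2.
      rewrite exprMn ler_wpM2l ?sqr_ge0// -(real_normK (num_real (co y p))).
      by apply: lerXn2r; rewrite ?nnegrE ?n1_ge0.
    have h2 : 0 <= s * n1 y ^+ 2 by rewrite mulr_ge0// sqr_ge0.
    by rewrite mulrDl; lra.
  rewrite /dot (bigD1 p)//= big1 ?addr0; last first.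
    by move=> q /negbTE qp; rewrite co_mkC qp mulr0 mul0r.
  by rewrite co_mkC eqxx mulr1; ring.
Qed.

End C11.

Section density.
Variables (R : realType) (M : nat).
Local Notation gM := (gam R M).
Local Notation Z := (Config R M).
Implicit Types f g k : Z -> R.

(** Approximants stay in [[0, 1]]: the error of a product is then at most the sum of the errors, and
    the range [[a, b]] can be restored exactly in [smooth_dense]. *)
Definition apprf f := rng 0 1 f /\ forall e, 0 < e ->
  exists k, [/\ C11 k, forall x, 0 <= k x <= 1 & Ex gM (fun x => `|f x - k x|) <= e].

Lemma apprf_C11 k : C11 k -> (forall x, 0 <= k x <= 1) -> apprf k.
Proof.
move=> ck k01; split; first by split=> //; exact: ck.1.1.
move=> e e0; exists k; split=> //.
rewrite (eq_Ex gM (g := fun=> 0)) ?Ex_cst ?ltW// => x.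
by rewrite subrr normr0.
Qed.

Lemma apprf_compl f : apprf f -> apprf (fun x => 1 - f x).
Proof.
move=> [rf af]; split.
  split=> [|x]; first by apply: measurable_funB => //; exact: rf.1.
  by have := rf.2 x; lra.
move=> e e0; have [k [ck k01 fk]] := af _ e0; exists (fun x => 1 - k x); split.
- rewrite (_ : (fun x => _) = fun x => 1 + (-1) * k x); last by apply/funext => x; ring.
  by apply: C11D; [exact: C11_cst|apply: C11M => //; exact: C11_cst].
- by move=> x; have := k01 x; lra.
- rewrite (eq_Ex gM (g := fun x => `|f x - k x|))// => x.
  by rewrite -normrN; congr `|_|; ring.
Qed.

Lemma apprf_mul f g : apprf f -> apprf g -> apprf (fun x => f x * g x).
Proof.
move=> [rf af] [rg ag]; split.
  split=> [|x]; first by apply: measurable_funM; [exact: rf.1|exact: rg.1].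
  have /andP[f0 f1] := rf.2 x; have /andP[g0 g1] := rg.2 x.
  by rewrite mulr_ge0//= mulr_ile1.
move=> e e0; have e20 : 0 < e / 2 by rewrite divr_gt0.
have [k [ck k01 fk]] := af _ e20; have [l [cl l01 gl]] := ag _ e20.
have bf := rng_bm rf; have bg := rng_bm rg.
have bfk : bm (fun x => `|f x - k x|) by apply/bm_norm/bmB => //; exact: ck.1.
have bgl : bm (fun x => `|g x - l x|) by apply/bm_norm/bmB => //; exact: cl.1.
exists (fun x => k x * l x); split; first exact: C11M.
  by move=> x; have /andP[f0 f1] := k01 x; have /andP[g0 g1] := l01 x; rewrite mulr_ge0//= mulr_ile1.
apply: (@le_trans _ _ (Ex gM (fun x => `|f x - k x| + `|g x - l x|))); last first.
  by rewrite ExD; [lra|exact: bm_ig|exact: bm_ig].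
apply: Ex_le.
- apply/bm_ig/bm_norm/bmB; [exact: bmM|exact: bmM ck.1 cl.1].
- exact/bm_ig/bmD.
- move=> x; have /andP[g0 g1] := rg.2 x; have /andP[k0 k1] := k01 x.
  rewrite (_ : f x * g x - k x * l x = (f x - k x) * g x + k x * (g x - l x)); last by ring.
  apply: (le_trans (ler_normD _ _)); rewrite !normrM (ger0_norm g0) (ger0_norm k0).
  by apply: lerD; [rewrite ler_piMr|rewrite ler_piMl].
Qed.

Lemma apprf_lim (fn : nat -> Z -> R) f : (forall n, apprf (fn n)) ->
  (forall x, fn n x @[n --> \oo] --> f x) -> apprf f.
Proof.
move=> afn cv; have mf : measurable_fun setT f.
  by apply: (@measurable_fun_cvg _ _ _ _ fn) => [n|x _]; [exact: (afn n).1.1|exact: cv].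
have rf : rng 0 1 f.
  split=> // x; have cx : cvgn (fun n => fn n x) by apply/cvg_ex; exists (f x); exact: cv.
  rewrite -(cvg_lim _ (cv x))//; apply/andP; split.
    by apply: limr_ge => //; apply: nearW => n; have /andP[] := (afn n).1.2 x.
  by apply: limr_le => //; apply: nearW => n; have /andP[] := (afn n).1.2 x.
split=> // e e0; have e20 : 0 < e / 2 by rewrite divr_gt0.
have bf := rng_bm rf; have bn n := rng_bm (afn n).1.
have : Ex gM (fun x => `|f x - fn n x|) @[n --> \oo] --> Ex gM (fun=> 0).
  apply: (@Ex_cvg _ _ _ _ _ _ 1).
  - by move=> n; exact: (bm_norm (bmB bf (bn n))).1.
  - move=> n x; rewrite normr_id ler_norml.
    by have := rf.2 x; have := (afn n).1.2 x; lra.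
  - move=> x; rewrite -(normr0 R) -(subrr (f x)); apply: cvg_norm.
    by apply: cvgB; [exact: cvg_cst|exact: cv].
rewrite Ex_cst => cvE; have [n _ hn] := cvgr0_norm_le _ cvE _ e20.
have {hn} := hn n (leqnn n); rewrite ger0_norm; last by apply: Ex_ge0.
move=> hn; have [k [ck k01 fk]] := (afn n).2 _ e20; exists k; split=> //.
apply: (@le_trans _ _ (Ex gM (fun x => `|f x - fn n x| + `|fn n x - k x|))).
  apply: Ex_le.
  - exact/bm_ig/bm_norm/bmB/ck.1.
  - by apply/bm_ig/bmD; apply/bm_norm/bmB => //; exact: ck.1.
  - by move=> x; rewrite -(subrKA (fn n x)) ler_normD.
rewrite ExD; [lra|exact/bm_ig/bm_norm/bmB|exact/bm_ig/bm_norm/bmB/ck.1].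
Qed.

Lemma apprf_prod (I : Type) (s : seq I) (f : I -> Z -> R) : (forall i, apprf (f i)) ->
  apprf (fun x => \prod_(i <- s) f i x).
Proof.
move=> af; elim: s => [|i s IH].
  rewrite (_ : (fun x => _) = fun=> 1); last by apply/funext => x; rewrite big_nil.
  by apply: apprf_C11 => [|x]; [exact: C11_cst|rewrite ler01 lexx].
rewrite (_ : (fun x => _) = fun x => f i x * \prod_(j <- s) f j x); first exact: apprf_mul.
by apply/funext => x; rewrite big_cons.
Qed.

Definition apprs (A : set Z) := apprf (fun x => \1_A x).

Lemma apprs_sigma : sigma_algebra setT apprs.
Proof.
have indC (A : set Z) x : \1_(~` A) x = 1 - \1_A x :> R.
  by rewrite !indicE in_setC; case: (x \in A); rewrite ?subrr ?subr0.
split=> [|A aA|F aF].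
- rewrite /apprs (_ : (fun x => _) = fun=> 0); last by apply/funext => x; rewrite indic0.
  by apply: apprf_C11 => [|x]; [exact: C11_cst|rewrite lexx ler01].
- rewrite /apprs (_ : (fun x => _) = fun x => 1 - \1_A x); first exact: apprf_compl.
  by apply/funext => x; rewrite setTD indC.
rewrite /apprs (_ : (fun x => _) = fun x => 1 - \1_(~` (\bigcup_k F k)) x); last first.
  by apply/funext => x; rewrite indC opprB addrC subrK.
(* Countable unions reduce to products: the complement of the union has as indicator the limit of
   the finite products of [1 - \1_(F i)]. *)
apply: apprf_compl; apply: (@apprf_lim (fun n x => \prod_(i < n) (1 - \1_(F i) x))) => [n|x].
  by apply: apprf_prod => i; apply: apprf_compl; exact: aF.
rewrite indicE; have [[k _ Fk]|nF] := pselect ((\bigcup_k F k) x).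
  rewrite memNset; last by apply; exists k.
  apply: cvg_near_cst; exists k.+1 => // n /= kn.
  by rewrite (bigD1 (Ordinal kn))//= indicE mem_set// subrr mul0r.
rewrite mem_set//; apply: cvg_near_cst; exists 0%N => // n _.
rewrite big1// => i _; rewrite indicE memNset ?subr0// => Fi.
by apply: nF; exists i.
Qed.

(** Since [decay] equals 1 at 0, the complements of the sharpened profiles converge to the indicator
    of the open ray, and open rays generate the Borel sets. *)
Lemma apprs_ray p c : apprs [set x | c < co x p].
Proof.
apply: (@apprf_lim (fun n x => 1 - decay (n.+1%:R * (co x p - c)))) => [n|x].
  apply: apprf_compl; apply: apprf_C11; first exact: C11_decay.
  by move=> x; exact: decay_itv.
rewrite indicE; case: (ltP c (co x p)) => h; last first.
  rewrite memNset; last by rewrite /= ltNge h.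
  apply: cvg_near_cst; apply: nearW => n; rewrite decay_le0 ?subrr//.
  by rewrite mulr_ge0_le0// subr_le0.
rewrite mem_set// -[X in _ --> X]subr0; apply: cvgB; first exact: cvg_cst.
have d0 : 0 < co x p - c by rewrite subr_gt0.
apply: (@squeeze_cvgr _ _ _ _ (fun=> 0) (fun n => (co x p - c)^-1 * harmonic n)).
- apply: nearW => n; have /andP[-> _] := decay_itv (n.+1%:R * (co x p - c)).
  by rewrite /=; apply: le_trans (decay_gt0 _) _; rewrite ?mulr_gt0// invfM mulrC.
- exact: cvg_cst.
- by rewrite -[X in _ --> X](mulr0 (co x p - c)^-1); apply: cvgMr; exact: cvg_harmonic.
Qed.

(* The approximable sets are a sigma-algebra making every coordinate measurable, so the
   identity is measurable from it to the product sigma-algebra. *)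
Lemma apprs_measurable (A : set Z) : measurable A -> apprs A.
Proof.
move=> mA.
have mid : measurable_fun setT (fun x : g_sigma_algebraType apprs => (x : Z)).
  apply: measurable_config => p.
  apply: (measurability _ (RGenOInfty.measurableE R)) => //.
  move=> /= _ [_ [c ->] <-]; rewrite setTI; apply: sub_sigma_algebra.
  rewrite (_ : _ @^-1` _ = [set x | c < co x p]); first exact: apprs_ray.
  by apply/seteqP; split => x /=; rewrite in_itv/= andbT.
have := mid measurableT A mA; rewrite setTI => H.
exact: (smallest_sub apprs_sigma (@subset_refl _ _) H).
Qed.

(* One binary digit at a time: f = (1_A + g) / 2 with A = {f >= 1/2}. *)
Lemma apprf_half f n : rng 0 1 f ->
  exists k, [/\ C11 k, forall x, 0 <= k x <= 1 & Ex gM (fun x => `|f x - k x|) <= (3 / 4) ^+ n].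
Proof.
elim: n f => [|n IH] f rf.
  exists (fun=> 0); split; [exact: C11_cst|by move=> x; rewrite lexx ler01|].
  rewrite expr0 -(Ex_cst gM 1); apply: Ex_le; [|exact/bm_ig/bm_cst|].
    by apply/bm_ig/bm_norm/bmB; [exact: rng_bm rf|exact: bm_cst].
  by move=> x; rewrite subr0 ger0_norm; have /andP[] := rf.2 x.
pose A := [set x | 1 / 2 <= f x].
have mA : measurable A.
  rewrite (_ : A = setT `&` f @^-1` `[1 / 2, +oo[); first exact: rf.1.
  by rewrite setTI; apply/seteqP; split => x /=; rewrite in_itv/= andbT.
have A1 : rng 0 1 (fun x => \1_A x : R).
  exact: (apprs_measurable mA).1.
pose g x := 2 * f x - \1_A x.
have rg : rng 0 1 g.
  split=> [|x]; first by apply: measurable_funB; [apply: measurable_funM => //; exact: rf.1|exact: A1.1].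
  rewrite /g indicE; have /andP[f0 f1] := rf.2 x.
  have [h|h] := leP (1 / 2) (f x).
    by rewrite mem_set//=; apply/andP; split; lra.
  by rewrite memNset/=; [apply/andP; split; lra|rewrite /A/= => h'; lra].
have r0 : 0 < (3 / 4) ^+ n / 2 :> R by rewrite divr_gt0// exprn_gt0// divr_gt0.
have [k [ck k01 gk]] := IH _ rg; have [l [cl l01 Al]] := (apprs_measurable mA).2 _ r0.
exists (fun x => 2^-1 * (k x + l x)); split.
- by apply: C11M; [exact: C11_cst|exact: C11D].
- by move=> x; have := k01 x; have := l01 x; lra.
have bk := ck.1; have bl := cl.1; have bg := rng_bm rg; have bA := rng_bm A1.
have b1 : bm (fun x => `|g x - k x|) by exact/bm_norm/bmB.
have b2 : bm (fun x => `|\1_A x - l x|) by exact/bm_norm/bmB.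
apply: (@le_trans _ _ (Ex gM (fun x => 2^-1 * (`|g x - k x| + `|\1_A x - l x|)))).
  apply: Ex_le; [|exact/bm_ig/bmZ/bmD|].
    by apply/bm_ig/bm_norm/bmB; [exact: rng_bm rf|exact/bmZ/bmD].
  move=> x; rewrite (_ : _ - _ = 2^-1 * ((g x - k x) + (\1_A x - l x))); last by rewrite /g; field.
  by rewrite normrM ger0_norm// ler_wpM2l// ler_normD.
rewrite ExZ; last exact/bm_ig/bmD.
rewrite ExD; [|exact: bm_ig|exact: bm_ig].
by rewrite exprS; lra.
Qed.

Lemma smooth_dense (a b : R) h e : rng a b h -> 0 < e ->
  exists C h', [/\ 0 <= C, smooth a b C 1 h' & Ex gM (fun x => `|h x - h' x|) <= e].
Proof.
move=> rh e0; have ab : a <= b by have := rh.2 (mkC (fun=> 0)); lra.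
pose r := b - a; have r0 : 0 <= r by rewrite subr_ge0.
(* If [r = 0], then [h] is the constant [a] and the convention on division by 0 gives [f = 0], so
   that [h = a + r f] holds in all cases. *)
pose f x := (h x - a) / r.
have hf x : h x = a + r * f x.
  rewrite /f; have [r1|r1] := eqVneq r 0; last by field.
  by rewrite r1 mul0r addr0; have := rh.2 x; rewrite /r in r1; lra.
have rf : rng 0 1 f.
  split=> [|x]; first by apply: measurable_funM => //; apply: measurable_funB => //; exact: rh.1.
  have /andP[h1 h2] := rh.2 x; rewrite /f divr_ge0 ?subr_ge0//=.
  have [r1|r1] := eqVneq r 0; first by rewrite r1 invr0 mulr0 ler01.
  by rewrite ler_pdivrMr ?mul1r ?lt_neqAle ?r0 1?eq_sym ?r1//; rewrite /r; lra.
have cvr : r * (3 / 4) ^+ n @[n --> \oo] --> r * 0.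
  by apply: cvgMr; apply: cvg_expr; rewrite ger0_norm; lra.
rewrite mulr0 in cvr; have [n _ hn] := cvgr0_norm_le _ cvr _ e0.
have {hn} := hn n (leqnn n); rewrite ger0_norm; last by rewrite mulr_ge0// exprn_ge0//; lra.
move=> hn; have [k [ck k01 fk]] := apprf_half n rf.
have [bk [C [V [C0 bV lip quad]]]] : C11 (fun x => a + r * k x).
  by apply: C11D; [exact: C11_cst|apply: C11M => //; exact: C11_cst].
exists C, (fun x => a + r * k x); split=> //.
  split; last by exists V; split=> // x y; rewrite ?expr1n mul1r.
  split=> [|x]; first exact: bk.1.
  have /andP[k0 k1] := k01 x; rewrite lerDl mulr_ge0//=.
  have : r * k x <= r * 1 by exact: ler_wpM2l.
  by rewrite mulr1 /r; lra.
apply: le_trans hn; apply: (@le_trans _ _ (r * Ex gM (fun x => `|f x - k x|))); last exact: ler_wpM2l.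
have bfk : bm (fun x => `|f x - k x|) by apply/bm_norm/bmB; [exact: rng_bm rf|exact: ck.1].
rewrite -ExZ; last exact: bm_ig.
apply: Ex_le; [|exact/bm_ig/bmZ|].
  by apply/bm_ig/bm_norm/bmB => //; exact: rng_bm rh.
move=> x; rewrite hf (_ : _ - _ = r * (f x - k x)); last by ring.
by rewrite normrM (ger0_norm r0).
Qed.

End density.

(** The derivative [ln] of [phi] is bounded on [[a, b]] by its end values; the tangent inequality
    takes the place of the mean value theorem. *)
Lemma phi_lip (R : realType) (a b x y : R) : 0 < a -> a <= x <= b -> a <= y <= b ->
  `|phi x - phi y| <= (`|ln a| + `|ln b|) * `|x - y|.
Proof.
move=> a0; wlog yx : x y / phi y <= phi x.
  move=> H hx hy; have [h|h] := leP (phi y) (phi x); first exact: H.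
  by rewrite distrC (distrC x); apply: H => //; exact: ltW.
move=> /andP[ax xb] /andP[ay yb].
have x0 : 0 < x := lt_le_trans a0 ax; have y0 : 0 < y := lt_le_trans a0 ay.
have b0 : 0 < b := lt_le_trans x0 xb.
rewrite ger0_norm ?subr_ge0//.
apply: (@le_trans _ _ (ln x * (x - y))).
  by have := phi_tangent y0 x0; rewrite -(opprB x y) mulrN; lra.
apply: (le_trans (ler_norm _)); rewrite normrM; apply: ler_wpM2r => //.
have l1 : ln a <= ln x by rewrite ler_ln.
have l2 : ln x <= ln b by rewrite ler_ln.
rewrite ler_norml; have := ler_norm (ln b); have := ler_norm (- ln a).
by have := normr_ge0 (ln a); have := normr_ge0 (ln b); rewrite normrN; lra.
Qed.

Lemma Ent_lip d (T : measurableType d) (R : realType) (P : probability T R) (a b : R) (u v : T -> R) :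
  0 < a -> rng a b u -> rng a b v ->
  `|Ent P u - Ent P v| <= 2 * (`|ln a| + `|ln b|) * Ex P (fun x => `|u x - v x|).
Proof.
move=> a0 ru rv; set L := `|ln a| + `|ln b|; have bu := rng_bm ru; have bv := rng_bm rv.
have L0 : 0 <= L by exact: addr_ge0.
have pu := rng_phi a0 ru; have pv := rng_phi a0 rv.
have buv : bm (fun x => `|u x - v x|) by exact/bm_norm/bmB.
have h1 : `|Ex P (fun x => phi (u x)) - Ex P (fun x => phi (v x))| <= L * Ex P (fun x => `|u x - v x|).
  rewrite -ExB; [|exact: bm_ig|exact: bm_ig]; rewrite -ExZ; last exact: bm_ig.
  apply: (le_trans (Ex_norm (bm_ig P (bmB pu pv)))); apply: Ex_le.
  - exact/bm_ig/bm_norm/bmB.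
  - exact/bm_ig/bmZ.
  - by move=> x; apply: phi_lip => //; [exact: ru.2|exact: rv.2].
have h2 : `|phi (Ex P u) - phi (Ex P v)| <= L * Ex P (fun x => `|u x - v x|).
  apply: (le_trans (phi_lip a0 (Ex_rng P ru) (Ex_rng P rv))); apply: ler_wpM2l => //.
  by rewrite -ExB; [exact: (Ex_norm (bm_ig P (bmB bu bv)))|exact: bm_ig|exact: bm_ig].
rewrite /Ent (_ : _ - _ - (_ - _) = (Ex P (fun x => phi (u x)) - Ex P (fun x => phi (v x))) -
  (phi (Ex P u) - phi (Ex P v))); last by ring.
by apply: (le_trans (ler_normB _ _)); move: h1 h2; lra.
Qed.

(** * Contraction for densities bounded above and away from 0 *)

Section averaged_contraction.
Variables (R : realType) (M N : nat) (a b : R).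
Hypotheses (a0 : 0 < a).
Local Notation K := (M + N)%N.
Local Notation gM := (gam R M).
Local Notation gN := (gam R N).
Variables (lamS lamR mu t : R).
Hypotheses (lamS0 : 0 < lamS) (lamR0 : 0 < lamR) (mu0 : 0 < mu) (t0 : 0 <= t).
Hypotheses (M0 : (0 < M)%N) (MN : (M <= N)%N).
Local Notation nu := (nu M N lamS0 lamR0 mu0 t0).
Local Notation kp := (kappa M N mu t).

Lemma nu_Ex_le (f g : Mat R M K -> R) : bm f -> bm g -> (forall S, 0 <= f S) ->
  (forall S, 0 <= g S) -> (forall S, Good S -> f S <= g S) -> Ex nu f <= Ex nu g.
Proof.
move=> bf bg f0 g0 fg; rewrite -lee_fin ExE; last exact: bm_ig.
rewrite ExE; last exact: bm_ig.
apply: nu_le => [||S gS]; last by rewrite lee_fin fg.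
- by split=> [|S]; [apply/measurable_EFinP; exact: bf.1|rewrite lee_fin].
- by split=> [|S]; [apply/measurable_EFinP; exact: bg.1|rewrite lee_fin].
Qed.

Definition avg (h : Config R M -> R) (x : Config R M) : R := Ex nu (fun S => NS S h x).

Lemma bm_NS (f : Config R M -> R) : bm f ->
  bm (fun p : Config R M * Mat R M K => NS p.2 f p.1).
Proof.
move=> bf; apply: (bm_Ex gN (f := fun p w => f (appM p.2 (catc p.1 w)))).
apply: (bm_comp bf); apply: measurable_appM_cat.
- exact: (measurableT_comp measurable_snd measurable_fst).
- exact: (measurableT_comp measurable_fst measurable_fst).
- exact: measurable_snd.
Qed.

Lemma rng_NS2 h : rng a b h -> rng a b (fun p : Config R M * Mat R M K => NS p.2 h p.1).
Proof.
move=> rh; apply: (rng_NS_param (S := snd) (x := fst) (h := fun=> h)) => //.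
exact: (rng_comp rh measurable_snd).
Qed.

Lemma rng_avg h : rng a b h -> rng a b (avg h).
Proof.
by move=> rh; apply: (rng_Ex nu (f := fun x S => NS S h x)); exact: rng_NS2.
Qed.

(** For [Good S], [NS S] preserves the Gaussian mean of [|h - h'|]; averaging therefore contracts
    the L1 distance, and smooth approximations pass through [avg]. *)
Lemma avg_L1 h h' : bm h -> bm h' ->
  Ex gM (fun x => `|avg h x - avg h' x|) <= Ex gM (fun x => `|h x - h' x|).
Proof.
move=> bh bh'; pose k x := `|h x - h' x|.
have bk : bm k by exact/bm_norm/bmB.
have bN := bm_NS bh; have bN' := bm_NS bh'; have bNk := bm_NS bk.
have bNx x : bm (fun S : Mat R M K => NS S h x) := bm_pair1 (f := fun x S => NS S h x) x bN.
have bNx' x : bm (fun S : Mat R M K => NS S h' x) := bm_pair1 (f := fun x S => NS S h' x) x bN'.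
have bNkx x : bm (fun S : Mat R M K => NS S k x) := bm_pair1 (f := fun x S => NS S k x) x bNk.
have ms (S : Mat R M K) x : measurable_fun setT (fun w : Config R N => appM S (catc x w)).
  by apply: measurable_appM_cat => //; exact: measurable_cst.
have bNkS : bm (fun S : Mat R M K => Ex gM (NS S k)).
  by apply: (bm_Ex gM (f := fun (S : Mat R M K) x => NS S k x)); exact: (bm_comp bNk (@measurable_swap _ _ _ _)).
have pt x : `|avg h x - avg h' x| <= Ex nu (fun S => NS S k x).
  rewrite /avg -ExB; [|exact: bm_ig|exact: bm_ig].
  apply: (le_trans (Ex_norm (bm_ig nu (bmB (bNx x) (bNx' x))))); apply: Ex_le.
  - exact/bm_ig/bm_norm/bmB.
  - exact: bm_ig.
  - move=> S; have b1 := bm_comp bh (ms S x); have b2 := bm_comp bh' (ms S x).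
    rewrite /NS -ExB; [|exact: bm_ig|exact: bm_ig].
    exact: (Ex_norm (bm_ig gN (bmB b1 b2))).
apply: (@le_trans _ _ (Ex gM (fun x => Ex nu (fun S => NS S k x)))).
  apply: Ex_le => //; last exact/bm_ig/(bm_Ex nu (f := fun x S => NS S k x)).
  apply/bm_ig/bm_norm/bmB; exact: (bm_Ex nu (f := fun x S => NS S _ x)).
rewrite (Ex_fubini gM nu (f := fun x S => NS S k x))//.
rewrite -[leRHS](Ex_cst nu); apply: nu_Ex_le => //.
- exact: bm_cst.
- by move=> S; do 2 apply: Ex_ge0 => ?; exact: normr_ge0.
- by move=> S; apply: Ex_ge0 => ?; exact: normr_ge0.
- by move=> S gS; rewrite (Ex_Good gS bk).
Qed.

Lemma Ent_avg_smooth C h : 0 <= C -> smooth a b C 1 h -> Ent gM (avg h) <= kp * Ent gM h.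
Proof.
move=> C0 sh; have rh := sh.1.
have h1 : Ent gM (avg h) <= Ex nu (fun S => Ent gM (NS S h)).
  exact: (Ent_convex gM nu a0 (F := fun x S => NS S h x) (rng_NS2 rh)).
have := smooth_contraction a0 C0 lamS0 lamR0 mu0 t0 M0 MN sh; rewrite subr_le0.
exact: le_trans.
Qed.

Lemma Ent_avg h : rng a b h -> Ent gM (avg h) <= kp * Ent gM h.
Proof.
move=> rh; set L := 2 * (`|ln a| + `|ln b|).
have L0 : 0 <= L by rewrite mulr_ge0// addr_ge0.
have k0 := @kappa_ge0 R M N mu t.
apply/ler_addgt0Pr => e e0.
(* The approximation is paid [L] times on the left and [kp L] times on the right; the extra 1 keeps
   [c] positive. *)
pose c := L + kp * L + 1; have c0 : 0 < c by rewrite ltr_wpDl// addr_ge0// mulr_ge0.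
have ec : 0 < e / c by rewrite divr_gt0.
have [C [h' [C0 sh' hh']]] := smooth_dense rh ec.
have rh' := sh'.1.
have h1 := Ent_avg_smooth C0 sh'.
have /ler_normlP[_ h2] := Ent_lip gM a0 (rng_avg rh) (rng_avg rh').
have /ler_normlP[h3 _] := Ent_lip gM a0 rh rh'.
have h4 := avg_L1 (rng_bm rh) (rng_bm rh').
rewrite -/L in h2 h3.
have h5 : L * Ex gM (fun x => `|avg h x - avg h' x|) <= L * (e / c).
  by apply: ler_wpM2l => //; exact: le_trans hh'.
have h6 : kp * (L * Ex gM (fun x => `|h x - h' x|)) <= kp * (L * (e / c)).
  by do 2 apply: ler_wpM2l => //.
have h7 := ler_wpM2l k0 h3.
have h8 : (L + kp * L + 1) * (e / c) = e by rewrite /c; field; rewrite gt_eqF.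
have h9 : (L + kp * L) * (e / c) <= e by rewrite -[leRHS]h8 ler_wpM2r ?(ltW ec)// lerDl.
have g1 : Ent gM (avg h) <= Ent gM (avg h') + L * (e / c).
  by rewrite -lerBlDl; exact: le_trans h2 h5.
have g2 : kp * Ent gM h' <= kp * Ent gM h + kp * (L * (e / c)).
  by rewrite -lerBlDl -mulrBr; apply: le_trans h6; rewrite opprB in h7.
apply: (le_trans g1); apply: le_trans (lerD (lexx _) h9).
rewrite [(L + kp * L) * _]mulrDl -[kp * L * _]mulrA (addrC (L * _) (kp * _)) [leRHS]addrA; apply: lerD (lexx _).
exact: le_trans h1 g2.
Qed.

End averaged_contraction.

(** * Unbounded densities *)

Section phi_growth.
Variable R : realType.
Implicit Types x m y : R.

Lemma phi_0 : phi (0 : R) = 1.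
Proof. by rewrite /phi mul0r subr0 add0r. Qed.

Lemma phi_nneg x : 0 <= x -> 0 <= phi x.
Proof.
by rewrite le_eqVlt => /predU1P[<-|]; [rewrite phi_0|exact: phi_ge0].
Qed.

Lemma phi_tangent0 x m : 0 <= x -> 0 < m -> phi m + ln m * (x - m) <= phi x.
Proof.
rewrite le_eqVlt => /predU1P[<- m0|]; last exact: phi_tangent.
by rewrite phi_0 /phi; lra.
Qed.

Lemma phi_le_sq x : 0 < x -> phi x <= (x - 1) ^+ 2.
Proof.
by move=> x0; have := ler_wpM2l (ltW x0) (ln_le_sub1 x0); rewrite /phi; lra.
Qed.

Lemma phi_ge_sqrt x : 0 < x -> (1 - Num.sqrt x) ^+ 2 <= phi x.
Proof.
move=> x0; have s0 : 0 < Num.sqrt x by rewrite sqrtr_gt0.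
have e : x = Num.sqrt x ^+ 2 by rewrite sqr_sqrtr// ltW.
have h : ln x = 2 * ln (Num.sqrt x) by rewrite {1}e lnXn// mulr_natl.
have := ler_wpM2l (ltW x0) (ln_ge_1subV s0).
have -> : x * (1 - (Num.sqrt x)^-1) = x - Num.sqrt x.
  by rewrite {1}e; move: (Num.sqrt x) s0 e => s s0 ->; field; rewrite gt_eqF.
by rewrite /phi h; move: e; move: (Num.sqrt x) => s e; nra.
Qed.

(** Cost of adding a small floor [y]: after integration against a density of mean 1, the extra term
    is of order [y]. *)
Lemma phi_shift x y : 0 <= x -> 0 < y -> phi (x + y) <= phi x + y * (x + y).
Proof.
move=> x0 y0; have xy : 0 < x + y by rewrite ltr_wpDl.
have := phi_tangent0 x0 xy; have := ler_wpM2l (ltW y0) (ln_le_sub1 xy).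
by lra.
Qed.

Lemma phi_min_le x m : 0 <= x -> 1 <= m -> phi (Num.min x m) <= phi x.
Proof.
move=> x0 m1; case: (leP x m) => // mx.
have m0 : 0 < m := lt_le_trans ltr01 m1.
have : 0 <= ln m * (x - m) by rewrite mulr_ge0 ?ln_ge0// subr_ge0 ltW.
by have := phi_tangent0 x0 m0; lra.
Qed.

(** Tangent at [expR 1], where the slope is 1; it forces [phi] to infinity along with its
    argument. *)
Lemma phi_ge_linear x : 0 <= x -> x - expR 1 <= phi x.
Proof.
move=> x0; have := phi_tangent0 x0 (expR_gt0 1); have := phi_ge0 (@expR_gt0 R 1).
by rewrite expRK; lra.
Qed.

(* Only meaningful on [0, +oo]: the value at -oo is the junk k 0. *)
Definition ext (k : R -> R) (x : \bar R) : \bar R :=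
  if (x < +oo)%E then (k (fine x))%:E else +oo%E.

Lemma measurable_ext d (T : measurableType d) (k : R -> R) (G : T -> \bar R) :
  measurable_fun setT k -> measurable_fun setT G -> measurable_fun setT (fun p => ext k (G p)).
Proof.
move=> mk mG; apply: measurable_fun_ifT.
- by apply: measurable_fun_lte => //; exact: measurable_cst.
- apply/measurable_EFinP; apply: (measurableT_comp mk).
  exact: (measurableT_comp (@fine_measurable _ setT measurableT) mG).
- exact: measurable_cst.
Qed.

Lemma phi_cvg (u : nat -> R) (x : \bar R) : (forall n, 0 < u n) -> (0 <= x)%E ->
  (u n)%:E @[n --> \oo] --> x -> (phi (u n))%:E @[n --> \oo] --> ext (@phi R) x.
Proof.
move=> u0; case: x => [r| |]//; rewrite /ext ?ltry ?ltxx; last first.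
  move=> _ cv; apply/cvgeyPge => A; have H := cvgey_ge cv (A + expR 1).
  near=> n; have h : ((A + expR 1)%:E <= (u n)%:E)%E by near: n; exact: H.
  by move: h; rewrite !lee_fin; have := phi_ge_linear (ltW (u0 n)); lra.
rewrite lee_fin => r0 /fine_cvg cv; apply: cvg_EFin; first exact: nearW.
have {}cv : u n @[n --> \oo] --> r by exact: cv.
move: r0; rewrite le_eqVlt => /predU1P[r0|r0].
  rewrite -r0 /= phi_0; rewrite -r0 in cv.
  apply: (@squeeze_cvgr _ _ _ _ (fun n => (1 - Num.sqrt (u n)) ^+ 2) (fun n => (u n - 1) ^+ 2)).
  - by apply: nearW => n; rewrite phi_ge_sqrt//= phi_le_sq.
  - rewrite [X in _ --> X](_ : 1 = (1 - Num.sqrt 0) * (1 - Num.sqrt 0)); last by rewrite sqrtr0 subr0 mulr1.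
    have c1 : 1 - Num.sqrt (u n) @[n --> \oo] --> 1 - Num.sqrt 0.
      by apply: cvgB; [exact: cvg_cst|exact: (continuous_cvg _ (@sqrt_continuous R 0) cv)].
    by under eq_fun do rewrite expr2; exact: (cvgM c1 c1).
  - rewrite [X in _ --> X](_ : 1 = (0 - 1) * (0 - 1)); last by ring.
    have c1 : u n - 1 @[n --> \oo] --> (0 - 1 : R) by apply: cvgB cv _; exact: cvg_cst.
    by under eq_fun do rewrite expr2; exact: (cvgM c1 c1).
rewrite /comp /= /phi; apply: cvgD; last exact: cvg_cst.
apply: cvgB => //; apply: cvgM => //.
exact: (continuous_cvg _ (continuous_ln r0) cv).
Unshelve. all: by end_near. Qed.

End phi_growth.

Section truncation.
Variable R : realType.

(** A cap and a positive floor bring the values into the range of the bounded theory. The cap is at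
    least 1, from which point on [phi] increases. *)
Definition trunc (n : nat) (x : R) := Num.min x n.+1%:R + n.+1%:R^-1.

Lemma rng_trunc d (T : measurableType d) (f : T -> R) n : measurable_fun setT f ->
  (forall x, 0 <= f x) -> rng n.+1%:R^-1 (n.+1%:R + n.+1%:R^-1) (fun x => trunc n (f x)).
Proof.
move=> mf f0; split=> [|x].
  by apply: measurable_funD => //; exact: measurable_minr.
by rewrite lerDr lerD2r ge_min lexx orbT le_min f0 ler0n.
Qed.

(** [trunc n] is not monotone in [n]: its capped part increases while its floor decreases to 0, so
    the two limits are taken separately. *)
Lemma trunc_cvg d (T : measurableType d) (P : probability T R) (f : T -> R) :
  measurable_fun setT f -> (forall x, 0 <= f x) ->
  (Ex P (fun x => trunc n (f x)))%:E @[n --> \oo] --> (\int[P]_x (f x)%:E)%E.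
Proof.
move=> mf f0.
have mm n : measurable_fun setT (fun x => Num.min (f x) n.+1%:R) by exact: measurable_minr.
have m0 n x : 0 <= Num.min (f x) n.+1%:R by rewrite le_min f0 ler0n.
have E n : (Ex P (fun x => trunc n (f x)))%:E =
    (\int[P]_x (Num.min (f x) n.+1%:R)%:E + (n.+1%:R^-1)%:E)%E.
  rewrite ExE; last exact: (bm_ig _ (rng_bm (rng_trunc n mf f0))).
  under eq_integral do rewrite EFinD.
  rewrite ge0_integralD//; last 2 first.
  - by move=> x _; rewrite lee_fin.
  - exact/measurable_EFinP.
  by rewrite integral_prob_cst.
under eq_fun do rewrite E.
rewrite -[(\int[P]_x (f x)%:E)%E]adde0; apply: cvgeD; first by rewrite fin_num_adde_defl.
- rewrite (_ : (\int[P]_x (f x)%:E = \int[P]_x limn (fun n => (Num.min (f x) n.+1%:R)%:E))%E); last first.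
    apply: eq_integral => x _; apply/esym/cvg_lim => //.
    apply: cvg_near_cst; near=> n; congr EFin; apply: min_l.
    have /le_trans : f x <= n%:R by near: n; exact: nbhs_infty_ger.
    by apply; rewrite ler_nat.
  apply: cvg_monotone_convergence => //.
  + by move=> n; exact/measurable_EFinP.
  + by move=> n x _; rewrite lee_fin.
  + move=> x _ n p np; rewrite lee_fin le_min ge_min lexx/= ge_min.
    by rewrite ler_nat ltnS np orbT.
- by apply: cvg_EFin; [exact: nearW|exact: cvg_harmonic].
Unshelve. all: by end_near. Qed.

End truncation.

Lemma limn_einf_le (R : realType) (u v : nat -> \bar R) (l : \bar R) :
  (forall n, u n <= v n)%E -> v n @[n --> \oo] --> l -> (limn_einf u <= l)%E.
Proof.
move=> uv vl; rewrite limn_einf_lim -(cvg_lim _ vl)//; apply: lee_lim.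
- exact: is_cvg_einfs.
- by apply/cvg_ex; exists l.
- apply: nearW => n; apply: le_trans (uv n); apply: ereal_inf_lbound.
  by exists n => //=.
Qed.

Section unbounded.
Variables (R : realType) (M N : nat).
Local Notation K := (M + N)%N.
Local Notation gM := (gam R M).
Local Notation gN := (gam R N).
Variables (lamS lamR mu t : R).
Hypotheses (lamS0 : 0 < lamS) (lamR0 : 0 < lamR) (mu0 : 0 < mu) (t0 : 0 <= t).
Hypotheses (M0 : (0 < M)%N) (MN : (M <= N)%N).
Local Notation nu := (nu M N lamS0 lamR0 mu0 t0).
Local Notation kp := (kappa M N mu t).
Variable hr : Config R M -> R.
Hypotheses (mhr : measurable_fun setT hr) (hr0 : forall x, 0 <= hr x).
Hypothesis mean1 : (\int[gM]_x (hr x)%:E = 1)%E.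

Definition flow (v : Config R M) : \bar R :=
  (\int[nu]_S \int[gN]_w (hr (appM S (catc v w)))%:E)%E.

Let hn n x := trunc n (hr x).
Let eta n : R := n.+1%:R^-1.
Let eta0 n : 0 < eta n. Proof. by rewrite invr_gt0. Qed.
Let rhn n : rng (eta n) (n.+1%:R + eta n) (hn n).
Proof. exact: rng_trunc. Qed.

Let nhr : nnm (fun x => (hr x)%:E).
Proof. by split=> [|x]; [exact/measurable_EFinP|rewrite lee_fin]. Qed.

Let mmap v : measurable_fun setT (fun p : Mat R M K * Config R N => appM p.1 (catc v p.2)).
Proof. by apply: measurable_appM_cat => //; exact: measurable_cst. Qed.

Lemma nnm_flow : nnm flow.
Proof.
apply: (@nnm_integral _ _ _ _ _ nu (fun v S => \int[gN]_w (hr (appM S (catc v w)))%:E)%E).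
apply: (@nnm_integral _ _ _ _ _ gN (fun p w => (hr (appM p.2 (catc p.1 w)))%:E)).
apply: (nnm_comp nhr); apply: measurable_appM_cat.
- exact: (measurableT_comp measurable_snd measurable_fst).
- exact: (measurableT_comp measurable_fst measurable_fst).
- exact: measurable_snd.
Qed.

(** The averages over [S] and [w] are merged into one product probability, so that [trunc_cvg]
    applies once, also where [flow v] is infinite. *)
Lemma flow_cvg v : (avg N lamS0 lamR0 mu0 t0 (hn n) v)%:E @[n --> \oo] --> flow v.
Proof.
have mh : measurable_fun setT (fun p : Mat R M K * Config R N => hr (appM p.1 (catc v p.2))).
  exact: (measurableT_comp mhr (mmap v)).
have := @trunc_cvg _ _ _ (prodP nu gN) _ mh (fun p => hr0 _).
rewrite (integral_prodP (nnm_comp nhr (mmap v))) => cv.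
suff -> : (fun n => (avg N lamS0 lamR0 mu0 t0 (hn n) v)%:E) =
  (fun n => (Ex (prodP nu gN) (fun p => trunc n (hr (appM p.1 (catc v p.2)))))%:E) by [].
apply/funext => n; congr EFin; rewrite Ex_prod//.
exact: (bm_comp (rng_bm (rhn n)) (mmap v)).
Qed.

Lemma flow_mean : (\int[gM]_v flow v = 1)%E.
Proof.
have n3 : nnm (fun p : Config R M * Mat R M K => \int[gN]_w (hr (appM p.2 (catc p.1 w)))%:E)%E.
  apply: (@nnm_integral _ _ _ _ _ gN (fun p w => (hr (appM p.2 (catc p.1 w)))%:E)).
  apply: (nnm_comp nhr); apply: measurable_appM_cat.
  - exact: (measurableT_comp measurable_snd measurable_fst).
  - exact: (measurableT_comp measurable_fst measurable_fst).
  - exact: measurable_snd.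
rewrite /flow (tonelliP (fun v S => \int[gN]_w (hr (appM S (catc v w)))%:E)%E n3).
transitivity (\int[nu]_S (1 : R)%:E)%E; last exact: integral_prob_cst.
apply: nu_eq.
- apply: (@nnm_integral _ _ _ _ _ gM (fun S v => \int[gN]_w (hr (appM S (catc v w)))%:E)%E).
  exact: (nnm_comp n3 (@measurable_swap _ _ _ _)).
- by split=> [|S]; [exact: measurable_cst|rewrite lee_fin].
- by move=> S gS; rewrite (Good_cat gS nhr).
Qed.

Let mn n := Ex gM (hn n).

Let mn_cvg : mn n @[n --> \oo] --> (1 : R).
Proof. by have := @trunc_cvg _ _ _ gM hr mhr hr0; rewrite mean1 => /fine_cvg. Qed.

Let avg_mean n : Ex gM (avg N lamS0 lamR0 mu0 t0 (hn n)) = mn n.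
Proof.
have rN := rng_NS2 N (rhn n); have bN := rng_bm rN.
rewrite /avg (Ex_fubini gM nu (f := fun x S => NS S (hn n) x))//.
have bS : bm (fun S : Mat R M K => Ex gM (NS S (hn n))).
  apply: (bm_Ex gM (f := fun (S : Mat R M K) x => NS S (hn n) x)).
  exact: (bm_comp bN (@measurable_swap _ _ _ _)).
have S0 S : 0 <= Ex gM (NS S (hn n)) :> R by exact/ltW/(Ex_gt0 gM (eta0 n) (rng_NS S (rhn n))).
have m0 : 0 <= mn n by exact/ltW/(Ex_gt0 gM (eta0 n) (rhn n)).
have e S : Good S -> Ex gM (NS S (hn n)) = mn n by move=> gS; exact: (Ex_Good gS (rng_bm (rhn n))).
apply/eqP; rewrite eq_le; apply/andP; split.
  rewrite -[leRHS](Ex_cst nu); apply: nu_Ex_le => //; first exact: bm_cst.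
  by move=> S /e ->.
rewrite -[leLHS](Ex_cst nu); apply: nu_Ex_le => //; first exact: bm_cst.
by move=> S /e ->.
Qed.

Lemma kappa_gt0 : 0 < kp.
Proof.
apply: ltr_pwDl; first by rewrite divr_gt0// ltr0n// addn_gt0 M0 orbT.
by rewrite mulr_ge0 ?divr_ge0 ?expR_ge0.
Qed.

(** The two costs of truncation: the floor, through [phi_shift], and the mean [mn n], which need not
    be 1, through [phi (mn n) <= (mn n - 1) ^ 2]. *)
Let err n := kp * (eta n * (1 + eta n)) + (mn n - 1) ^+ 2.

Let phi_trunc n :
  (\int[gM]_x (phi (hn n x))%:E <= \int[gM]_x (phi (hr x))%:E + (eta n * (1 + eta n))%:E)%E.
Proof.
have e0 := ltW (eta0 n).
have me : measurable_fun setT (fun x => (eta n * (hr x + eta n))%:E).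
  by apply/measurable_EFinP; apply: measurable_funM => //; exact: measurable_funD.
have -> : (eta n * (1 + eta n))%:E = (\int[gM]_x (eta n * (hr x + eta n))%:E)%E.
  under eq_integral do rewrite EFinM EFinD.
  rewrite ge0_integralZl ?lee_fin//; last 2 first.
  - by apply: emeasurable_funD => //; exact: nhr.1.
  - by move=> x _; rewrite adde_ge0 ?lee_fin.
  rewrite ge0_integralD//; last first.
  - exact: nhr.1.
  - by move=> x _; exact: nhr.2.
  by rewrite mean1 integral_prob_cst -EFinD -EFinM.
have mp : measurable_fun setT (fun x => (phi (hr x))%:E).
  by apply/measurable_EFinP; exact: (measurableT_comp (@measurable_phi R) mhr).
rewrite -ge0_integralD//; last 2 first.
- by move=> x _; rewrite lee_fin phi_nneg.
- by move=> x _; rewrite lee_fin mulr_ge0// addr_ge0.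
apply: ge0_le_integral => //.
- by move=> x _; rewrite lee_fin phi_nneg// ltW// (rng_gt0 (eta0 n) x (rhn n)).
- by apply/measurable_EFinP; exact: (rng_phi (eta0 n) (rhn n)).1.
- exact: emeasurable_funD.
- move=> x _; rewrite -EFinD lee_fin.
  have m0 : 0 <= Num.min (hr x) n.+1%:R by rewrite le_min hr0 ler0n.
  apply: (le_trans (phi_shift m0 (eta0 n))); apply: lerD.
    by apply: phi_min_le => //; rewrite ler1n.
  by apply: ler_wpM2l => //; rewrite lerD2r ge_min lexx.
Qed.

Let entropy_trunc n :
  (\int[gM]_v (phi (avg N lamS0 lamR0 mu0 t0 (hn n) v))%:E <=
   kp%:E * \int[gM]_x (phi (hr x))%:E + (err n)%:E)%E.
Proof.
have ra : rng (eta n) (n.+1%:R + eta n) (avg N lamS0 lamR0 mu0 t0 (hn n)) by exact: rng_avg.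
have bpa := rng_phi (eta0 n) ra; have bph := rng_phi (eta0 n) (rhn n).
have k0 := ltW kappa_gt0.
have m0 : 0 < mn n by exact: (Ex_gt0 gM (eta0 n) (rhn n)).
have H := Ent_avg (eta0 n) lamS0 lamR0 mu0 t0 M0 MN (rhn n).
rewrite {1}/Ent avg_mean in H.
have h1 : Ex gM (fun v => phi (avg N lamS0 lamR0 mu0 t0 (hn n) v)) <=
    kp * Ex gM (fun x => phi (hn n x)) + (mn n - 1) ^+ 2.
  rewrite lerBlDr in H; apply: (le_trans H); apply: lerD (phi_le_sq m0).
  by apply: ler_wpM2l => //; rewrite /Ent gerBl phi_ge0.
rewrite -(ExE (bm_ig gM bpa)).
apply: (@le_trans _ _ (kp%:E * (Ex gM (fun x => phi (hn n x)))%:E + ((mn n - 1) ^+ 2)%:E)%E).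
  by rewrite -EFinM -EFinD lee_fin.
rewrite (ExE (bm_ig gM bph)) /err (EFinD (kp * _)) addeA (EFinM kp) -ge0_muleDr; last 2 first.
- by apply: integral_ge0 => x _; rewrite lee_fin phi_nneg.
- by rewrite lee_fin mulr_ge0 ?ltW// addr_gt0.
apply: leeD => //; apply: lee_wpmul2l; first by rewrite lee_fin.
exact: phi_trunc.
Qed.

Lemma flow_entropy :
  (\int[gM]_v ext (@phi R) (flow v) <= kp%:E * \int[gM]_x (phi (hr x))%:E)%E.
Proof.
have ra n : rng (eta n) (n.+1%:R + eta n) (avg N lamS0 lamR0 mu0 t0 (hn n)) by exact: rng_avg.
have apos n v := rng_gt0 (eta0 n) v (ra n).
have lim v : (limn_einf (fun n => (phi (avg N lamS0 lamR0 mu0 t0 (hn n) v))%:E) = ext (@phi R) (flow v)).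
  have cv := phi_cvg (fun n => apos n v) (nnm_flow.2 v) (@flow_cvg v).
  exact: (cvg_limn_einf_sup cv).1.
under eq_integral do rewrite -lim.
apply: (le_trans (fatou gM measurableT _ _)).
- by move=> n; apply/measurable_EFinP; exact: (rng_phi (eta0 n) (ra n)).1.
- by move=> n v _; rewrite lee_fin phi_ge0.
set A := (kp%:E * _)%E; rewrite -(adde0 A).
apply: (limn_einf_le entropy_trunc); apply: cvgeD.
- by rewrite fin_num_adde_defl.
- exact: cvg_cst.
- apply: cvg_EFin; first exact: nearW.
  have ce : eta n @[n --> \oo] --> (0 : R) by exact: cvg_harmonic.
  have -> : 0 = kp * (0 * (1 + 0)) + (1 - 1) * (1 - 1) :> R by ring.
  apply: cvgD.
    apply: cvgM; first exact: cvg_cst.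
    by apply: cvgM => //; apply: cvgD => //; exact: cvg_cst.
  have c1 : mn n - 1 @[n --> \oo] --> (1 - 1 : R) by apply: cvgB => //; exact: cvg_cst.
  by under eq_fun do rewrite expr2; exact: (cvgM c1 c1).
Qed.

End unbounded.

(** * Entropy with respect to the Gaussian measure *)

Section relative_entropy.
Variables (R : realType) (K : nat).
Local Notation gK := (gam R K).

Definition xlnx (x : R) := x * ln x.

Lemma measurable_xlnx : measurable_fun setT xlnx.
Proof. by apply: measurable_funM => //; exact: measurable_ln. Qed.

Lemma ent_integrand_gauss (G : Config R K -> \bar R) v : (0 <= G v)%E ->
  ent_integrand (fun v => (gauss v)%:E * G v)%E v = (ext xlnx (G v) * (gauss v)%:E)%E.
Proof.
have g0 := gauss_gt0 v; rewrite /ent_integrand /ext; case: (G v) => [r| |]//; last first.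
  by rewrite ltxx gt0_muley ?gt0_mulye ?lte_fin.
rewrite ltry /= => _; rewrite -EFinM; congr EFin; case: eqP => [/eqP|_].
  by rewrite mulf_eq0 gt_eqF//= => /eqP->; rewrite /xlnx !mul0r.
by rewrite (mulrC _ r) mulfK ?gt_eqF// mulrAC.
Qed.

(** As [x ln x >= x - 1 >= - 1], the negative part has integral at most 1, so the difference in
    [intCs] is meaningful even for infinite entropy. The affine terms of [phi] cancel because [G]
    has mean 1. *)
Lemma entropy_gauss (G : Config R K -> \bar R) : nnm G -> (\int[gK]_v G v = 1)%E ->
  entropy (fun v => (gauss v)%:E * G v)%E = (\int[gK]_v ext (@phi R) (G v))%E.
Proof.
move=> nG G1; pose P v := ext xlnx (G v).
have mP : measurable_fun setT P by apply: measurable_ext nG.1; exact: measurable_xlnx.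
have nPp : nnm (P^\+)%E by split=> [|v]; [exact: measurable_funepos|exact: funepos_ge0].
have nPn : nnm (P^\-)%E by split=> [|v]; [exact: measurable_funeneg|exact: funeneg_ge0].
have nF : nnm (fun v => ext (@phi R) (G v)).
  split=> [|v]; first by apply: measurable_ext nG.1; exact: measurable_phi.
  have := nG.2 v; rewrite /ext; case: (G v) => [r| |]; rewrite ?ltxx ?ltry//.
  by rewrite !lee_fin; exact: phi_nneg.
have -> : entropy (fun v => (gauss v)%:E * G v)%E = (\int[gK]_v (P^\+)%E v - \int[gK]_v (P^\-)%E v)%E.
  rewrite /entropy /intCs -(intC_gam nPp) -(intC_gam nPn).
  have gp v : (0 <= (gauss v)%:E :> \bar R)%E by rewrite lee_fin ltW// gauss_gt0.
  congr (_ - _)%E; congr intC; apply/funext => v.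
    by rewrite !funeposE ent_integrand_gauss ?nG.2// maxe_pMl ?mul0e.
  by rewrite !funenegE ent_integrand_gauss ?nG.2// -mulNe maxe_pMl ?mul0e.
have Pn1 v : ((P^\-)%E v <= 1)%E.
  rewrite funenegE /P /ext; have := nG.2 v; case: (G v) => [r| |]; rewrite ?ltxx ?ltry//.
    rewrite lee_fin => r0; rewrite ge_max -EFinN !lee_fin ler01 andbT /=.
    by have := phi_nneg r0; rewrite /phi /xlnx; lra.
  by move=> _; rewrite /= ge_max leNye lee_fin ler01.
have iPn : (\int[gK]_v (P^\-)%E v \is a fin_num)%E.
  rewrite ge0_fin_numE; last by apply: integral_ge0 => v _; exact: nPn.2.
  apply: (@le_lt_trans _ _ 1%E); last exact: ltry.
  rewrite -[leRHS](integral_prob_cst gK 1); apply: ge0_le_integral => //.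
  exact: nPn.1.
(* Written with nonnegative terms on both sides, so that it integrates even where [G] is infinite;
   only finite integrals are subtracted afterwards. *)
have pt v : ((P^\+)%E v + 1 = ext (@phi R) (G v) + G v + (P^\-)%E v)%E.
  rewrite funeposE funenegE /P /ext; have := nG.2 v; case: (G v) => [r| |]; rewrite ?ltxx ?ltry//=; last first.
  by move=> _; rewrite max_l ?leey// max_r ?leNye.
  rewrite lee_fin => r0; rewrite -!EFin_max -!EFinD; congr EFin.
  rewrite (_ : phi r + r = xlnx r + 1); last by rewrite /phi /xlnx; ring.
  by case: (leP (xlnx r) 0) => h; [rewrite max_l ?oppr_ge0//; ring|rewrite max_r ?oppr_le0 ?ltW//; ring].
have E : (\int[gK]_v (P^\+)%E v + 1 = \int[gK]_v ext (@phi R) (G v) + 1 + \int[gK]_v (P^\-)%E v)%E.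
  rewrite -{2}G1 -[X in (_ + X = _)%E](integral_prob_cst gK 1).
  have n1 : nnm (fun _ : Config R K => (1 : R)%:E) by exact: nnm_cst.
  have iD f g (nf : nnm f) (ng : nnm g) :
      (\int[gK]_v f v + \int[gK]_v g v = \int[gK]_v (f v + g v))%E.
    by rewrite (ge0_integralD gK measurableT (fun v _ => nf.2 v) nf.1 (fun v _ => ng.2 v) ng.1).
  rewrite (iD _ _ nPp n1) (iD _ _ nF nG) (iD _ _ (nnmD nF nG) nPn).
  by apply: eq_integral => v _; exact: pt.
move: E; rewrite addeAC => /(congr1 (fun x => x - 1)%E); rewrite !addeK// => ->.
by rewrite addeK.
Qed.

End relative_entropy.

Theorem theorem7p1 (R : realType) (M N : nat) (lamS lamR mu : R)
  (f0 : Config R M -> R) :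
  (0 < M)%N -> (M <= N)%N ->
  0 < lamS -> 0 < lamR -> 0 < mu ->
  measurable_fun setT f0 ->
  (forall v, 0 <= f0 v) ->
  @intC R M (fun v => (f0 v)%:E) = 1%E ->
  forall t : R, 0 <= t ->
  ((@entropy R M (@marginal R M N (@expLt R M N lamS lamR mu t (@F0 R M N f0))))
   <= (M%:R / (N + M)%:R
       + N%:R / (N + M)%:R * expR (- (mu / 3) * ((N + M)%:R / N%:R) * t))%:E
      * @entropy R M (fun v => (f0 v)%:E))%E.
Proof.
move=> M0 MN lamS0 lamR0 mu0 mf0 f00 int1 t t0.
pose hr v := f0 v / gauss v.
have [mh h0] := nnm_hdens mf0 f00.
have hr0 v : 0 <= hr v by rewrite -lee_fin; exact: (h0 v).
have mhr : measurable_fun setT hr by exact/measurable_EFinP.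
have f0E v : (f0 v)%:E = ((gauss v)%:E * (hr v)%:E)%E.
  by rewrite -EFinM /hr mulrCA divff ?mulr1// gt_eqF// gauss_gt0.
have mean1 : (\int[gam R M]_x (hr x)%:E = 1)%E.
  rewrite -(intC_gam (nnm_hdens mf0 f00)) -int1; congr intC; apply/funext => v.
  by rewrite f0E muleC.
have -> : entropy (fun v => (f0 v)%:E) = (\int[gam R M]_v (phi (hr v))%:E)%E.
  have -> : (fun v => (f0 v)%:E) = (fun v => (gauss v)%:E * (hr v)%:E)%E.
    by apply/funext => v; exact: f0E.
  rewrite (entropy_gauss (nnm_hdens mf0 f00) mean1).
  by apply: eq_integral => v _; rewrite /ext ltry.
have -> : @marginal R M N (@expLt R M N lamS lamR mu t (@F0 R M N f0)) =
    (fun v => (gauss v)%:E * flow N lamS0 lamR0 mu0 t0 hr v)%E.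
  by apply/funext => v; rewrite (marginal_F0 N lamS0 lamR0 mu0 mf0 f00 t0).
rewrite entropy_gauss; [|exact: nnm_flow|exact: flow_mean].
exact: (flow_entropy lamS0 lamR0 mu0 t0 M0 MN mhr hr0 mean1).
Qed.
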